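(* The algebra $J$ acts on $C_c^\infty(F^2)^I$ by convolution: for every $w\in\tilde W$ and $h\in C_c^\infty(F^2)^I$ one has $t_w\star h\in C_c^\infty(F^2)^I$, and the assignment $t_w\mapsto(h\mapsto t_w\star h)$ extends to a unital ring homomorphism $J\to\mathrm{End}_{\mathbb C}\big(C_c^\infty(F^2)^I\big)$.
   Context: $\tilde W=\langle s_0,s_1\mid s_0^2=s_1^2=1\rangle$ is the affine Weyl group of $\mathrm{SL}_2$ (the infinite dihedral group), with length function $\ell$, strong Bruhat order $\le$ and identity $1$. With $q^{1/2}$ first viewed as an indeterminate, let $\mathcal A=\mathbb Z[q^{1/2},q^{-1/2}]$. $H$ is the $\mathcal A$-algebra with $\mathcal A$-basis $\{T_w\}_{w\in\tilde W}$ and relations $T_wT_{w'}=T_{ww'}$ if $\ell(ww')=\ell(w)+\ell(w')$, and $(T_s+1)(T_s-q)=0$ for $s\in\{s_0,s_1\}$. The Kazhdan–Lusztig bases (all Kazhdan–Lusztig polynomials equal $1$ here) are $$C_w=\sum_{y\le w}(-1)^{\ell(w)-\ell(y)}q^{\frac{\ell(w)-\ell(y)}{2}}q^{-\frac{\ell(y)}{2}}T_y,\qquad C'_w=q^{-\frac{\ell(w)}{2}}\sum_{y\le w}T_y.$$ Let $\overline{(\,\cdot\,)}$ be the involution of $\mathcal A$ with $\overline{q^{1/2}}=q^{-1/2}$, and let $j$ be the ring involution $j(\sum a_wT_w)=\sum\overline{a_w}(-1)^{\ell(w)}q^{-\ell(w)}T_w$ of $H$; then $C'_w=(-1)^{\ell(w)}j(C_w)$.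 Define $h_{x,y,z}\in\mathcal A$ by $C_xC_y=\sum_z h_{x,y,z}C_z$. The set of distinguished involutions is $\mathcal D=\{1,s_0,s_1\}$, and Lusztig's $a$-function has values $a(1)=0$, $a(w)=1$ for $w\ne1$. $J$ is Lusztig's asymptotic Hecke algebra: the free $\mathbb Z$-module with basis $\{t_w\}_{w\in\tilde W}$ and product $t_xt_y=\sum_z\gamma_{x,y,z}t_z$, where $\gamma_{x,y,z}$ is the constant term of $(-q^{1/2})^{a(z)}h_{x,y,z}\in\mathbb Z[q^{1/2}]$; its unit is $t_1+t_{s_0}+t_{s_1}$. The $\mathcal A$-algebra map $\phi\colon H\to J\otimes_{\mathbb Z}\mathcal A$ is $\phi(C_x)=\sum_{z\in\tilde W,\,d\in\mathcal D,\,a(d)=a(z)}h_{x,d,z}t_z$. Completions: $\mathcal H$ is the set of formal sums $\sum b_xC_x$ with $b_x\in\mathbb Z((q^{1/2}))$ such that for every $N>0$, $b_x\in q^{N/2}\mathbb Z[[q^{1/2}]]$ for $\ell(x)$ large; $\mathcal J$ is the same with $t_x$ in place of $C_x$. $\phi$ extends coefficientwise to an isomorphism $\mathcal H\to\mathcal J$. $\mathcal H'$ is the set of formal sums $\sum b_xC'_x$ with $b_x\in\mathbb Z((q^{-1/2}))$ satisfying the same condition with $q^{-1/2}$ in place of $q^{1/2}$, and $j$ gives mutually inverse bijections between $\mathcal H'$ and $\mathcal H$, $j(\sum b_xC'_x)=\sum(-1)^{\ell(x)}\overline{b_x}C_x$. Expanding each $C'_x$, one writes $(\phi\circ j)^{-1}(t_w)=j(\phi^{-1}(t_w))\in\mathcal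 H'$ as $\sum_x b_{w,x}T_x$; the $b_{w,x}$ are rational functions of $q^{1/2}$ with denominators of the form $q^{m/2}(q+1)$. Now let $F$ be a non-archimedean local field with ring of integers $\mathcal O$, uniformizer $\pi$, and let $q$ be the cardinality of $\mathcal O/\pi\mathcal O$. Let $G=\mathrm{SL}_2(F)$, $K=\mathrm{SL}_2(\mathcal O)$, and let $I\subset K$ be the Iwahori subgroup of matrices that are upper triangular modulo $\pi$. Elements of $\tilde W$ are lifted to $G$ via $s_0\mapsto\begin{pmatrix}0&-1\\1&0\end{pmatrix}$, $s_1\mapsto\begin{pmatrix}0&\pi^{-1}\\-\pi&0\end{pmatrix}$, and $T_x$ is identified with the characteristic function of $IxI$. From here on, $t_w$ also denotes the function $\sum_x b_{w,x}T_x$ on $G$, with $q$ specialized to its numerical value. $C_c^\infty(F^2)^I$ is the complex vector space of locally constant, compactly supported, $I$-invariant functions on $F^2$ (with $G$ acting on column vectors), viewed by restriction as functions on $G/N=F^2\setminus\{0\}$, $N$ being the upper triangular unipotent matrices in $G$. Convolution is $(f\star h)(x)=\int_Gf(u)h(u^{-1}x)\,du$ for $x\in F^2\setminus\{0\}$, with Haar measure normalized by $\mathrm{vol}(I)=1$ (so $f\star h$ is the sum over cosets $uI\in G/I$). *)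

(* Defs.v *)
From HB Require Import structures.
From mathcomp Require Import all_boot all_order all_algebra.
From mathcomp Require Import finmap.
From mathcomp Require Import all_classical all_reals topology normedtype.
From mathcomp Require Import complex.
From mathcomp Require Import -(notations) monalg.
From mathcomp Require summability.
From mathcomp Require Import zify.

Set Implicit Arguments.
Unset Strict Implicit.
Unset Printing Implicit Defensive.
Import Order.TTheory GRing.Theory Num.Theory.

Local Open Scope classical_set_scope.
Local Open Scope ring_scope.

(* The notations of monalg clash with those of mathcomp-analysis. *)
Local Notation "{ 'malg' G [ K ] }" := (malg K G)
  (at level 0, K, G at level 2) : type_scope.
Local Notation "g @_ k" := (mcoeff k g)
  (at level 3, k at level 2, left associativity).
Local Notation "<< k >>" := (mkmalgU k 1) (at level 0).

(* Linear extension of f : K -> V to the free R-module on K. *)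
Section LinExt.
Variables (K : choiceType) (R : nzRingType) (V : lmodType R).
Implicit Types (f : K -> V) (g : {malg R[K]}).

Definition linext f g : V := \sum_(k <- msupp g) g@_k *: f k.

Lemma linextEw (d : {fset K}) f g : (msupp g `<=` d)%fset ->
  linext f g = \sum_(k <- d) g@_k *: f k.
Proof.
move=> le; rewrite /linext (big_fset_incl _ le) // => k _ /mcoeff_outdom ->.
by rewrite scale0r.
Qed.

Lemma linext_is_linear f : linear (linext f).
Proof.
move=> a x y; pose d := (msupp x `|` msupp y)%fset.
have dx : (msupp x `<=` d)%fset by apply: fsubsetUl.
have dy : (msupp y `<=` d)%fset by apply: fsubsetUr.
have dxy : (msupp (a *: x + y) `<=` d)%fset.
  apply: fsubset_trans (msuppD_le _ _) _.
  by apply: fsetSU; apply: msuppZ_le.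
rewrite !(linextEw f dx, linextEw f dy, linextEw f dxy).
rewrite scaler_sumr -big_split /=.
by apply: eq_bigr => k _; rewrite mcoeffD mcoeffZ scalerDl scalerA.
Qed.

HB.instance Definition _ f :=
  GRing.isLinear.Build R {malg R[K]} V _ (linext f) (linext_is_linear f).

Lemma linextU f k : linext f << k >> = f k.
Proof. by rewrite (linextEw f msuppU_le) big_seq_fset1 mcoeffUU scale1r. Qed.

Lemma malgUZ (c : R) (k : K) : mkmalgU k c = c *: << k >>.
Proof. by apply/malgP => l; rewrite mcoeffZ !mcoeffU mulrnAr mulr1. Qed.

Lemma malg_lin_ind (P : {malg R[K]} -> Prop) : P 0 ->
  (forall k, P << k >>) -> (forall c x y, P x -> P y -> P (c *: x + y)) ->
  forall x, P x.
Proof.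
move=> P0 PU PD x; rewrite [x]monalgE; apply: big_ind => //.
  by move=> y z Py Pz; rewrite -[y]scale1r; apply: PD.
by move=> k _; rewrite malgUZ -[X in P X]addr0; apply: PD.
Qed.
End LinExt.

(* Z[v, v^-1] with v = q^(1/2); the basis element << k >> is v^k. *)
Definition laurent : Type := {malg int[int]}.
HB.instance Definition _ := GRing.Lmodule.copy laurent {malg int[int]}.

Definition vpow (k : int) : laurent := << k >>.

Definition laurent_mul (a b : laurent) : laurent :=
  linext (fun k => linext (fun l => vpow (k + l)) b) a.

Fact laurent_mulC : commutative laurent_mul.
Proof.
move=> a b; rewrite /laurent_mul /linext.
under eq_bigr => k _ do rewrite scaler_sumr.
rewrite exchange_big; apply: eq_bigr => l _ /=; rewrite scaler_sumr.
by apply: eq_bigr => k _; rewrite !scalerA mulrC addrC.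
Qed.

Fact laurent_mulPl c (a a' b : laurent) :
  laurent_mul (c *: a + a') b = c *: laurent_mul a b + laurent_mul a' b.
Proof. exact: linearP. Qed.

Fact laurent_mulPr c (a b b' : laurent) :
  laurent_mul a (c *: b + b') = c *: laurent_mul a b + laurent_mul a b'.
Proof. by rewrite laurent_mulC laurent_mulPl ![laurent_mul _ a]laurent_mulC. Qed.

Fact laurent_mulDl : left_distributive laurent_mul +%R.
Proof. by move=> a a' b; rewrite -[a]scale1r laurent_mulPl !scale1r. Qed.

Fact laurent_mul0l b : laurent_mul 0 b = 0.
Proof. exact: linear0. Qed.

Fact laurent_mul0r b : laurent_mul b 0 = 0.
Proof. by rewrite laurent_mulC laurent_mul0l. Qed.

Fact laurent_mulvv k l : laurent_mul (vpow k) (vpow l) = vpow (k + l).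
Proof. by rewrite /laurent_mul !linextU. Qed.

Fact laurent_ind (P : laurent -> Prop) : P 0 -> (forall k, P (vpow k)) ->
  (forall c x y, P x -> P y -> P (c *: x + y)) -> forall x, P x.
Proof. exact: malg_lin_ind. Qed.

Fact laurent_mulA : associative laurent_mul.
Proof.
elim/laurent_ind=> [|k|t a a' IHa IHa'] b c.
- by rewrite !laurent_mul0l.
- elim/laurent_ind: b => [|l|t b b' IHb IHb'].
  + by rewrite laurent_mul0r !laurent_mul0l laurent_mul0r.
  + elim/laurent_ind: c => [|m|t c c' IHc IHc'].
    * by rewrite !laurent_mul0r.
    * by rewrite !laurent_mulvv addrA.
    * by rewrite !laurent_mulPr IHc IHc'.
  + by rewrite !(laurent_mulPl, laurent_mulPr) IHb IHb'.
- by rewrite !laurent_mulPl IHa IHa'.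
Qed.

Fact laurent_mul1l : left_id (vpow 0) laurent_mul.
Proof.
elim/laurent_ind=> [|k|t a a' IHa IHa'].
- exact: laurent_mul0r.
- by rewrite laurent_mulvv add0r.
- by rewrite laurent_mulPr IHa IHa'.
Qed.

Fact laurent_1neq0 : vpow 0 != 0.
Proof. by rewrite monalgU_eq0 oner_eq0. Qed.

HB.instance Definition _ := GRing.Zmodule_isComNzRing.Build laurent
  laurent_mulA laurent_mulC laurent_mul1l laurent_mulDl laurent_1neq0.

(* Reduced words in the letters s_0 = false and s_1 = true: the normal forms of
   the free product <s_0> * <s_1>. *)
Definition reduced (w : seq bool) := sorted (fun a b => a != b) w.
Record weyl := Weyl { word :> seq bool; _ : reduced word }.
HB.instance Definition _ := [isSub for word].
HB.instance Definition _ := [Choice of weyl by <:].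

Definition lmul_word (s : bool) (w : seq bool) :=
  if w is t :: w' then if s == t then w' else s :: w else [:: s].

Fact lmul_word_reduced s (w : weyl) : reduced (lmul_word s w).
Proof.
case: w => -[|t w] //=; rewrite /reduced /=; case: eqVneq => /= [_|-> //].
by case: w => //= u w /andP[].
Qed.

Definition lmul s (w : weyl) : weyl := Weyl (lmul_word_reduced s w).

Fact lmulK s : involutive (lmul s).
Proof.
move=> [[|t w] r]; apply: val_inj => /=; first by rewrite eqxx.
case: eqVneq => [->|] /=; last by rewrite eqxx.
case: w r => [|u w] //=; rewrite /reduced /= => /andP[].
by case: eqVneq.
Qed.

Definition wone : weyl := Weyl (isT : reduced [::]).
Definition wmul (x y : weyl) : weyl := foldr lmul y x.
Definition winv (x : weyl) : weyl := foldr lmul wone (rev x).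

Fact wmul_lmul s x y : wmul (lmul s x) y = lmul s (wmul x y).
Proof.
case: x => -[|t w] r //; rewrite /wmul /=.
by case: eqVneq => //= ->; rewrite lmulK.
Qed.

Fact wmulA : associative wmul.
Proof.
move=> x y z; have -> u : wmul u (wmul y z) = foldr lmul (foldr lmul z y) u by [].
have -> : wmul x y = foldr lmul y x by [].
by elim: (word x) => //= s w ->; rewrite wmul_lmul.
Qed.

Fact wmul1l : left_id wone wmul. Proof. by []. Qed.

Fact word_foldr (x : weyl) : foldr lmul wone x = x.
Proof.
case: x => w r; apply: val_inj => /=.
elim: w r => //= s w IHw; rewrite /reduced /= => sw.
rewrite IHw; last exact: path_sorted sw.
by case: w {IHw} sw => //= t w /andP[/negPf-> _].
Qed.

Fact wmul1r : right_id wone wmul. Proof. exact: word_foldr. Qed.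

Fact foldr_rev_lmul (w : seq bool) y : foldr lmul (foldr lmul y w) (rev w) = y.
Proof.
elim: w y => //= s w IHw y; rewrite rev_cons foldr_rcons lmulK; exact: IHw.
Qed.

Fact wmulVl : left_inverse wone winv wmul.
Proof.
move=> x; rewrite -[X in wmul _ X]word_foldr /winv.
have -> w u y : wmul (foldr lmul u w) y = foldr lmul (wmul u y) w.
  by elim: w => //= s w IHw; rewrite wmul_lmul IHw.
exact: foldr_rev_lmul.
Qed.

Fact wmulVr : right_inverse wone winv wmul.
Proof.
move=> x; rewrite /wmul -/(winv x) -[X in foldr _ _ X]revK.
rewrite -[RHS](foldr_rev_lmul (rev x)) /winv; congr foldr.
Qed.

HB.instance Definition _ := isGroup.Build weyl
  wmulA wmul1l wmul1r wmulVl wmulVr.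

(* The length of an element is that of its unique reduced word. *)
Definition len (w : weyl) : nat := size w.
Definition sgen (s : bool) : weyl := lmul s wone.

Fact scalerDCA (R : comNzRingType) (V : lmodType R) (c a b : R) (x y z t : V) :
  c *: (a *: x + b *: y) + (a *: z + b *: t) =
  a *: (c *: x + z) + b *: (c *: y + t).
Proof. by rewrite !scalerDr !scalerA ![_ * c]mulrC addrACA. Qed.

Fact scalerDAC (R : comNzRingType) (V : lmodType R) (c b : R) (x y z t : V) :
  b *: (c *: x + y) + (c *: z + t) = c *: (b *: x + z) + (b *: y + t).
Proof. by rewrite !scalerDr !scalerA [b * c]mulrC addrACA. Qed.

Fact scalerDZC (R : comNzRingType) (V : lmodType R) (c b : R) (x y : V) :
  b *: (c *: x) + c *: y = c *: (b *: x + y).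
Proof. by rewrite scalerDr !scalerA mulrC. Qed.

(* The Hecke algebra of the infinite dihedral group over A with parameter q. *)
Definition hecke_alg (A : comNzRingType) (q : A) : Type := {malg A[weyl]}.
HB.instance Definition _ (A : comNzRingType) (q : A) :=
  GRing.Lmodule.copy (hecke_alg q) {malg A[weyl]}.

Section Hecke.
Variables (A : comNzRingType) (q : A).
Local Notation hecke := (hecke_alg q).

Definition Tbas (w : weyl) : hecke := << w >>.

(* Left multiplication by T_s. *)
Definition Tgen (s : bool) : hecke -> hecke := linext (fun w : weyl =>
  if (len w < len (lmul s w))%N then Tbas (lmul s w)
  else (q - 1) *: Tbas w + q *: Tbas (lmul s w) : hecke).

Definition hecke_mul (a b : hecke) : hecke :=
  linext (fun w : weyl => foldr Tgen b w : hecke) a.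

Fact TgenP s c (x y : hecke) : Tgen s (c *: x + y) = c *: Tgen s x + Tgen s y.
Proof. exact: linearP. Qed.

Fact TgenD s (x y : hecke) : Tgen s (x + y) = Tgen s x + Tgen s y.
Proof. exact: linearD. Qed.

Fact TgenZ s c (x : hecke) : Tgen s (c *: x) = c *: Tgen s x.
Proof. exact: linearZ. Qed.

Fact Tgen0 s : Tgen s 0 = 0.
Proof. exact: linear0. Qed.

Fact hecke_ind (P : hecke -> Prop) : P 0 -> (forall w, P (Tbas w)) ->
  (forall c x y, P x -> P y -> P (c *: x + y)) -> forall x, P x.
Proof. exact: malg_lin_ind. Qed.

Fact TgenT s w : Tgen s (Tbas w) =
  if (len w < len (lmul s w))%N then Tbas (lmul s w)
  else (q - 1) *: Tbas w + q *: Tbas (lmul s w).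
Proof. exact: linextU. Qed.

Fact hecke_mulT w x : hecke_mul (Tbas w) x = foldr Tgen x w.
Proof. exact: linextU. Qed.

Fact len_lmul s w :
  (len w < len (lmul s w))%N = ~~ (len (lmul s w) < len w)%N.
Proof.
case: w => -[|t w] r; rewrite /len //=.
case: eqVneq => _ /=; first by rewrite ltnS leqnn ltnNge leqnSn.
by rewrite leqnn ltnNge leqnSn.
Qed.

Fact Tgen_quadratic s x : Tgen s (Tgen s x) = (q - 1) *: Tgen s x + q *: x.
Proof.
elim/hecke_ind: x => [|w|c x y IHx IHy].
- by rewrite !Tgen0 !scaler0 addr0.
- rewrite TgenT; case: ifPn => ws.
    by rewrite TgenT lmulK ifF //; apply/negbTE; rewrite -len_lmul.
  rewrite TgenD !TgenZ !TgenT lmulK (negPf ws) ifT //.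
  by rewrite len_lmul negbK in ws.
- by rewrite 2!TgenP IHx IHy; apply: scalerDCA.
Qed.

Fact hecke_mulPl c (x x' y : hecke) :
  hecke_mul (c *: x + x') y = c *: hecke_mul x y + hecke_mul x' y.
Proof. exact: linearP. Qed.

Fact hecke_mulDl : left_distributive hecke_mul +%R.
Proof. by move=> x x' y; apply: linearD. Qed.

Fact hecke_mulZl c (x y : hecke) : hecke_mul (c *: x) y = c *: hecke_mul x y.
Proof. exact: linearZ. Qed.

Fact hecke_mul0l y : hecke_mul 0 y = 0.
Proof. exact: linear0. Qed.

Fact hecke_mulPr c (x y y' : hecke) :
  hecke_mul x (c *: y + y') = c *: hecke_mul x y + hecke_mul x y'.
Proof.
elim/hecke_ind: x => [|w|b x x' IHx IHx'].
- by rewrite !hecke_mul0l scaler0 addr0.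
- by rewrite !hecke_mulT; elim: (word w) => //= s u ->; rewrite TgenP.
- rewrite !hecke_mulPl IHx IHx'.
  exact: scalerDAC.
Qed.

Fact word_lmul s w : (len w < len (lmul s w))%N -> lmul s w = s :: w :> seq bool.
Proof.
case: w => -[|t w] r //=; rewrite /len /=.
by case: eqVneq => //= _; rewrite ltnNge leqnSn.
Qed.

Fact hecke_mul_Tgen s x y : hecke_mul (Tgen s x) y = Tgen s (hecke_mul x y).
Proof.
elim/hecke_ind: x => [|w|c x x' IHx IHx'].
- by rewrite Tgen0 !hecke_mul0l Tgen0.
- rewrite TgenT hecke_mulT; case: ifPn => ws.
    by rewrite hecke_mulT word_lmul.
  have {ws} : (len (lmul s w) < len (lmul s (lmul s w)))%N.
    by rewrite lmulK; rewrite len_lmul negbK in ws.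
  move/word_lmul; rewrite lmulK => ew.
  rewrite hecke_mulDl !hecke_mulZl !hecke_mulT ew /=.
  by symmetry; apply: Tgen_quadratic.
- by rewrite TgenP !hecke_mulPl IHx IHx' TgenP.
Qed.

Fact hecke_mulA : associative hecke_mul.
Proof.
elim/hecke_ind=> [|w|c x x' IHx IHx'] y z.
- by rewrite !hecke_mul0l.
- rewrite !hecke_mulT; elim: (word w) => //= s u ->.
  by rewrite hecke_mul_Tgen.
- by rewrite !hecke_mulPl IHx IHx'.
Qed.

Fact hecke_mul1l : left_id (Tbas 1%g) hecke_mul.
Proof. by move=> x; rewrite hecke_mulT. Qed.

Fact len_lmul_le s w : (len (lmul s w) <= (len w).+1)%N.
Proof.
by case: w => -[|t w] r //=; rewrite /len /=; case: eqVneq => //= _; lia.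
Qed.

Fact len_wmul_le x y : (len (x * y)%g <= len x + len y)%N.
Proof.
rewrite -[(x * y)%g]/(wmul x y) /len /wmul; elim: (word x) => //= s u IHu.
by apply: leq_trans (len_lmul_le _ _) _; rewrite addSn ltnS.
Qed.

Fact hecke_mulTT (x y : weyl) :
  len (x * y)%g = (len x + len y)%N -> hecke_mul (Tbas x) (Tbas y) = Tbas (x * y)%g.
Proof.
rewrite hecke_mulT -[(x * y)%g]/(wmul x y); case: x => w.
rewrite /wmul /len /=; elim: w => //= s w IHw sw lenE.
have wr : reduced w by exact: path_sorted sw.
have := len_wmul_le (Weyl wr) y; rewrite -[(_ * _)%g]/(wmul _ _).
have := len_lmul_le s (foldr lmul y w); rewrite /wmul /len /= => le2 le1.
have lenw : size (foldr lmul y w) = (size w + size y)%N.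
  by move: lenE le1 le2; rewrite /=; lia.
rewrite IHw // TgenT ifT // /len /= lenw.
by move: lenE => /= ->; rewrite addSn.
Qed.

Fact hecke_mul1r : right_id (Tbas 1%g) hecke_mul.
Proof.
elim/hecke_ind=> [|w|c x x' IHx IHx'].
- exact: hecke_mul0l.
- by rewrite hecke_mulTT mulg1 // addn0.
- by rewrite hecke_mulPl IHx IHx'.
Qed.

Fact hecke_mulDr : right_distributive hecke_mul +%R.
Proof. by move=> x y y'; rewrite -[y]scale1r hecke_mulPr !scale1r. Qed.

Fact hecke_1neq0 : Tbas 1%g != 0.
Proof. by rewrite monalgU_eq0 oner_eq0. Qed.

HB.instance Definition _ := GRing.Zmodule_isNzRing.Build hecke
  hecke_mulA hecke_mul1l hecke_mul1r hecke_mulDl hecke_mulDr hecke_1neq0.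

Fact hecke_scalerAl (c : A) (x y : hecke) : c *: (x * y) = c *: x * y.
Proof. by rewrite -[RHS]/(hecke_mul _ _) hecke_mulZl. Qed.
HB.instance Definition _ :=
  GRing.Lmodule_isLalgebra.Build A hecke hecke_scalerAl.

Fact hecke_mulZr c (x y : hecke) : hecke_mul x (c *: y) = c *: hecke_mul x y.
Proof.
elim/hecke_ind: x => [|w|b x x' IHx IHx'].
- by rewrite !hecke_mul0l scaler0.
- by rewrite !hecke_mulT; elim: (word w) => //= s u ->; rewrite TgenZ.
- by rewrite !hecke_mulPl IHx IHx'; apply: scalerDZC.
Qed.

Fact hecke_scalerAr (c : A) (x y : hecke) : c *: (x * y) = x * (c *: y).
Proof. by rewrite -[RHS]/(hecke_mul _ _) hecke_mulZr. Qed.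
HB.instance Definition _ :=
  GRing.Lalgebra_isAlgebra.Build A hecke hecke_scalerAr.

Lemma hecke_TT (x y : weyl) :
  len (x * y)%g = (len x + len y)%N -> Tbas x * Tbas y = Tbas (x * y)%g.
Proof. exact: hecke_mulTT. Qed.

Lemma hecke_quadratic s : (Tbas (sgen s) + 1) * (Tbas (sgen s) - q%:A) = 0.
Proof.
have TE : Tbas (sgen s) * Tbas (sgen s) = (q - 1) *: Tbas (sgen s) + q%:A.
  by rewrite [LHS]hecke_mulT /= TgenT /sgen lmulK.
rewrite mulrDl mul1r mulrBr TE -scalerAr mulr1 scalerBl scale1r.
rewrite -[X in X - _ + _]addrA [X in X + (_ - _)]addrAC subrr add0r addrACA.
by rewrite addNr subrr addr0.
Qed.
End Hecke.

(* The indeterminate q is v^2. *)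
Definition hecke := hecke_alg (vpow 2).
Definition T (w : weyl) : hecke := Tbas (vpow 2) w.

Definition reflection (t : weyl) := exists x s, t = (x * sgen s * x^-1)%g.

Inductive bruhat (y : weyl) : weyl -> Prop :=
| bruhat_refl : bruhat y y
| bruhat_step x t : bruhat y x -> reflection t -> (len x < len (x * t)%g)%N ->
    bruhat y (x * t)%g.

Definition KLC (w : weyl) : hecke :=
  \sum_(y \in [set y | bruhat y w])
    ((-1) ^+ (len w - len y) * vpow ((len w)%:Z - (len y)%:Z)
      * vpow (- (len y)%:Z)) *: T y.

Definition KLC' (w : weyl) : hecke :=
  vpow (- (len w)%:Z) *: \sum_(y \in [set y | bruhat y w]) T y.

(* Coordinates of x in the basis (C_z)_z of the Hecke algebra. *)
Definition KLcoord (x : hecke) : {malg laurent[weyl]} :=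
  xget 0 [set c | x = linext KLC c].

Definition hstr (x y z : weyl) : laurent := (KLcoord (KLC x * KLC y))@_z.

Definition afun (w : weyl) : nat := (w != 1%g).
Definition dinvol : seq weyl := [:: 1%g; sgen false; sgen true].

Definition gammastr (x y z : weyl) : int := ((- vpow 1) ^+ afun z * hstr x y z)@_0.

Definition asymp : Type := {malg int[weyl]}.
HB.instance Definition _ := GRing.Lmodule.copy asymp {malg int[weyl]}.

Definition tbas (w : weyl) : asymp := << w >>.

Definition asymp_mul (x y : asymp) : asymp :=
  linext (fun a : weyl => linext (fun b : weyl =>
    \sum_(z \in [set: weyl]) gammastr a b z *: tbas z : asymp) y) x.

Definition asymp_one : asymp := \sum_(d <- dinvol) tbas d.

(* The coefficient of t_z in phi(C_x). *)
Definition phicoef (x z : weyl) : laurent :=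
  \sum_(d <- dinvol | afun d == afun z) hstr x d z.

(* f : series stands for sum_n f(n) v^n, infinite in both directions; Z((v)) and
   Z((v^-1)) are the series with support bounded below, resp. above. *)
Definition series := int -> int.

Definition series_scale (a : laurent) (f : series) : series :=
  fun n => \sum_(k <- msupp a) a@_k * f (n - k).

(* The family b stands for the formal sum of the b(x) C_x. *)
Definition calH (b : weyl -> series) : Prop :=
  (forall x, exists m, forall n, n < m -> b x n = 0) /\
  (forall N : nat, (0 < N)%N -> exists L : nat, forall x, (L <= len x)%N ->
    forall n, n < N%:Z -> b x n = 0).

(* The map phi extended coefficientwise; for b in calH and fixed z, n only finitely
   many x contribute. *)
Definition phihat (b : weyl -> series) : weyl -> series :=
  fun z n => \sum_(x \in [set: weyl]) series_scale (phicoef x z) (b x) n.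

(* phi^-1(t_w): phi is a bijection from calH to its analogue for the t_w. *)
Definition phihat_inv_t (w : weyl) : weyl -> series :=
  xget (fun _ _ => 0) [set b | calH b /\
    phihat b = (fun z n => ((z == w) && (n == 0))%:R)].

(* j(sum_x b_x C_x) = sum_x (-1)^l(x) bar(b_x) C'_x *)
Definition jhat (b : weyl -> series) : weyl -> series :=
  fun x n => (-1) ^+ len x * b x (- n).

(* The coefficient of T_x in j(phi^-1(t_w)), as an element of Z((v^-1)). *)
Definition bcoef (w x : weyl) : series :=
  fun n => \sum_(y \in [set: weyl])
    series_scale ((KLC' y)@_x) (jhat (phihat_inv_t w) y) n.

Section Specialization.
Variables (R : realType) (v : R).

Definition laurent_eval (a : laurent) : R :=
  \sum_(k <- msupp a) (a@_k)%:~R * v ^ k.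

(* The value at v of the rational function P / Q of which f is an expansion. *)
Definition ratval (f : series) : R :=
  xget 0 [set r | exists P Q : laurent,
    [/\ series_scale Q f = (fun n => P@_n), laurent_eval Q != 0
      & r = laurent_eval P / laurent_eval Q]].
End Specialization.

(* A non-archimedean local field: a field complete for a (normalized) discrete
   valuation with finite residue field, with the valuation topology. The value
   of the valuation at 0 is meaningless. *)
HB.mixin Record isNonarchLocal F of GRing.Field F & Topological F := {
  valuation : F -> int;
  val_uniformizer : exists pi : F, pi != 0 /\ valuation pi = 1;
  valM : forall x y : F, x != 0 -> y != 0 ->
    valuation (x * y) = valuation x + valuation y;
  valD : forall x y : F, x != 0 -> y != 0 -> x + y != 0 ->
    Num.min (valuation x) (valuation y) <= valuation (x + y);
  nbhs_val : forall x : F, nbhs x = filter_from setT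
    (fun n : int => [set y | y = x \/ n <= valuation (y - x)]);
  val_complete : forall u : nat -> F,
    (forall n : int, exists N : nat, forall i j : nat, (N <= i)%N -> (N <= j)%N ->
      u i = u j \/ n <= valuation (u i - u j)) ->
    exists l : F, u @ \oo --> l;
  val_residue : finite_set [set [set y : F | y = x \/ 0 < valuation (y - x)]
    | x in [set x : F | x = 0 \/ 0 <= valuation x]]
}.

#[short(type="nonarchLocalFieldType")]
HB.structure Definition NonarchLocalField :=
  {F of GRing.Field F & Topological F & isNonarchLocal F}.

Section LocalField.
Variable F : nonarchLocalFieldType.

Definition integers : set F := [set x | x = 0 \/ 0 <= valuation x].

Definition uniformizer (pi : F) : Prop := pi != 0 /\ valuation pi = 1.

Definition residue_field (pi : F) : set (set F) :=
  [set [set x + pi * y | y in integers] | x in integers].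

Definition SL2 : set 'M[F]_2 := [set g | \det g = 1].

Definition iwahori (pi : F) : set 'M[F]_2 :=
  [set g | [/\ SL2 g, forall i j, integers (g i j)
    & exists2 y, integers y & g 1 0 = pi * y]].

Definition mx2 (a b c d : F) : 'M[F]_2 :=
  \matrix_(i, j) (if i == 0 then if j == 0 then a else b
                  else if j == 0 then c else d).

Definition lift_gen (pi : F) (s : bool) : 'M[F]_2 :=
  if s then mx2 0 pi^-1 (- pi) 0 else mx2 0 (- 1) 1 0.

Definition lift_weyl (pi : F) (w : weyl) : 'M[F]_2 :=
  \prod_(s <- word w) lift_gen pi s.

Definition double_coset (pi : F) (w : weyl) : set 'M[F]_2 :=
  [set g | exists i j, [/\ iwahori pi i, iwahori pi j
    & g = i *m lift_weyl pi w *m j]].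

Definition left_cosets (pi : F) : set (set 'M[F]_2) :=
  [set [set g *m i | i in iwahori pi] | g in SL2].

Section Functions.
Variables (R : realType) (pi : F).
Local Notation C := R[i].

(* The function t_w on G, for the residue cardinality q. *)
Definition tfun (q : nat) (w : weyl) (g : 'M[F]_2) : R :=
  \sum_(x \in [set: weyl])
    ratval (Num.sqrt q%:R : R) (bcoef w x) * (g \in double_coset pi x)%:R.

Definition schwartz (h : 'cV[F]_2 -> C^o) : Prop :=
  [/\ forall x, \forall y \near x, h y = h x,
      compact (closure [set x | h x != 0])
    & forall i x, iwahori pi i -> h (i *m x) = h x].

Definition schwartzb : {pred 'cV[F]_2 -> C^o} := [pred h | `[< schwartz h >]].

Fact schwartzbP h : reflect (schwartz h) (h \in schwartzb).
Proof. exact: asboolP. Qed.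

Fact schwartz_submod : submod_closed schwartzb.
Proof.
split=> [|a f g].
  apply/schwartzbP; split=> //.
  - by move=> x; near=> y.
  - rewrite [X in closure X](_ : _ = set0) ?closure0; first exact: compact0.
    by apply/seteqP; split=> x //=; rewrite eqxx.
move=> /schwartzbP[lf cf If] /schwartzbP[lg cg Ig]; apply/schwartzbP; split.
- move=> x; near=> y; rewrite -[LHS]/(a *: f y + g y).
  have -> : f y = f x by near: y; apply: lf.
  by have -> : g y = g x by near: y; apply: lg.
- apply: (@subclosed_compact _ _ (closure [set x | f x != 0] `|`
    closure [set x | g x != 0])); first exact: closed_closure.
    exact: compactU.
  rewrite -closureU; apply: closure_subset => x /=.
  apply: contraPP => /not_orP[/negP/negbNE/eqP fx /negP/negbNE/eqP gx].
  by apply/negP/negPn; rewrite -[X in X == 0]/(a *: f x + g x) fx gx addr0 scaler0.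
- by move=> i x Ii; rewrite -[LHS]/(a *: f _ + g _) If // Ig.
Unshelve. all: by end_near. Qed.

HB.instance Definition _ :=
  GRing.isSubmodClosed.Build C ('cV[F]_2 -> C^o) schwartzb schwartz_submod.

(* C_c^oo(F^2)^I *)
Record schwartzT := Schwartz {
  schwartz_fun :> 'cV[F]_2 -> C^o; _ : schwartz_fun \in schwartzb }.
HB.instance Definition _ := [isSub for schwartz_fun].
HB.instance Definition _ := [Choice of schwartzT by <:].
HB.instance Definition _ := [SubChoice_isSubLmodule of schwartzT by <:].

(* The integrand u |-> f(u) h(u^-1 x) is constant on left cosets of I when f and
   h are I-invariant, so that, with vol(I) = 1, the integral over G is the sum of
   its values over G / I. *)
Definition conv_term (f : 'M[F]_2 -> R) (h : 'cV[F]_2 -> C^o) (x : 'cV[F]_2)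
    (c : set 'M[F]_2) : C^o :=
  if c \in left_cosets pi then
    let u := xget 1%:M c in (f u)%:C%C * h (invmx u *m x)
  else 0.

(* f * h = k on F^2 \ {0}; convergence along finite sets of cosets ordered by
   inclusion is absolute convergence. *)
Definition is_conv (f : 'M[F]_2 -> R) (h k : 'cV[F]_2 -> C^o) : Prop :=
  forall x : 'cV[F]_2, x != 0 ->
    summability.partial_sum (conv_term f h x) @ summability.totally --> k x.

End Functions.
End LocalField.

(* Main.v *)
Require Import Defs.
From HB Require Import structures.
From mathcomp Require Import all_boot all_order all_algebra.
From mathcomp Require Import finmap.
From mathcomp Require Import all_classical all_reals topology normedtype.
From mathcomp Require Import complex.
From mathcomp Require Import -(notations) monalg.
From mathcomp Require summability.
From mathcomp Require Import zify ring lra.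

Set Implicit Arguments.
Unset Strict Implicit.
Unset Printing Implicit Defensive.
Import Order.TTheory GRing.Theory Num.Theory.

Local Open Scope classical_set_scope.
Local Open Scope ring_scope.

Local Notation "{ 'malg' G [ K ] }" := (malg K G)
  (at level 0, K, G at level 2) : type_scope.
Local Notation "g @_ k" := (mcoeff k g)
  (at level 3, k at level 2, left associativity).
Local Notation "<< k >>" := (mkmalgU k 1) (at level 0).
Import numFieldNormedType.Exports.

(** Write v for q^(1/2). The orbits of I on F^2 \ {0} are indexed by the integers
    ([lev], [lev_transitive]): the vectors of level at least i form, with 0, an open
    compact lattice L_i, and L_(i+1) has index q in L_i. Hence the normalized
    indicator functions psi_i = v^i 1_(L_i) are a basis of the space of invariant
    Schwartz functions ([schwartz_of_inj], [schwartz_of_surj]).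

    Summing over the cosets of I in a Bruhat cell makes the Hecke algebra act on
    functions of the level ([sum_lists]), and C'_s = v^-1 (1 + T_s) multiplies psi_i
    by v + v^-1 when i has the parity of s, and sends it to psi_(i-1) + psi_(i+1)
    otherwise ([Elev_psi]). Left multiplication by C_s in the basis C_w has, up to sign,
    the same form. Everything is therefore governed
    by the Clebsch-Gordan rule for SL_2: it gives the products C_x C_y ([KLD_mul]), the
    product of J ([asymp_mulE]), and an action of J on the free module on Z, in which
    t_w, with w of length n, sends e_i to plus or minus the string
    e_(i-n+1) + e_(i-n+3) + .. + e_(i+n-1) when i has the parity of the last letter of
    w, and to 0 otherwise ([Jop_mul], [Jop_one]). This action, transported by the basis
    psi, is the representation.

    What remains is that t_w * psi_i converges to t_w psi_i. The element phi^-1(t_w)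
    is the fundamental solution of a Chebyshev recurrence ([phihat_inv_tE]), whence the
    b_(w,x), which depend only on the length and the first letter of x and decrease
    like v^(-2 l(x)) ([bcoef_alt], [bval_ge]). On functions of the level, C'_w for w of
    length n acts on psi_i, up to sign, as (v + v^-1) X_n - X_(n+1) - X_(n-1), where
    X_n is the string of length n ([ClevE]). A summation by parts of the sum of the
    b_(w,x) T_x psi_i over a Bruhat interval of height N then leaves X_m, for m the
    length of w, up to O(v^-N) ([lsumE], [lsum_limit]), and the elements of length N
    contribute O(v^-N) in absolute value ([layer_bound]), so that the convergence is
    absolute ([totally_cvg], [conv_alt]). *)

(** * The infinite dihedral group and its Bruhat order *)
Fixpoint altw (s : bool) (n : nat) : seq bool :=
  if n is n'.+1 then s :: altw (~~ s) n' else [::].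

Lemma size_altw s n : size (altw s n) = n.
Proof. by elim: n s => //= n IHn s; rewrite IHn. Qed.

Lemma altw_reduced s n : reduced (altw s n).
Proof.
rewrite /reduced; case: n => //= n; elim: n s => //= n IHn s.
by rewrite IHn andbT; case: s.
Qed.

Definition alt s n : weyl := Weyl (altw_reduced s n).

Lemma len_alt s n : len (alt s n) = n. Proof. exact: size_altw. Qed.

Lemma alt0 s : alt s 0 = 1%g. Proof. exact: val_inj. Qed.

Lemma weyl_alt (w : weyl) : w = alt (head false w) (len w).
Proof.
apply: val_inj; case: w => w r; rewrite /len /=.
case: w r => //= s w; rewrite /reduced /=; elim: w s => //= t w IHw s /andP[st].
by move/IHw => e; rewrite e; case: s t st e => -[].
Qed.

Lemma alt_inj s t m n : alt s m = alt t n -> m = n /\ ((0 < m)%N -> s = t).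
Proof.
move=> e; have mn : m = n by rewrite -(len_alt s m) e len_alt.
by split=> // m0; move: e; rewrite -mn; case: m m0 {mn} => // m _ [].
Qed.

Lemma alt_eq s t m n : (alt s m == alt t n) = (m == n) && ((s == t) || (m == 0)%N).
Proof.
apply/eqP/andP => [/alt_inj[-> e]|[/eqP <-]].
  by split=> //; case: posnP e => [_|_ ->] //; rewrite ?eqxx ?orbT.
by case/orP => /eqP->; rewrite ?alt0.
Qed.

Lemma alt_neq1 s n : alt s n.+1 != 1%g.
Proof. by rewrite -(alt0 s) alt_eq. Qed.

Lemma lmul_alt_neg s n : lmul s (alt (~~ s) n) = alt s n.+1.
Proof. by apply: val_inj; case: n => //= n; case: s. Qed.

Lemma sgen_alt s : sgen s = alt s 1.
Proof. by rewrite /sgen -(lmul_alt_neg s 0) alt0. Qed.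

Lemma sgen_mul s x : (sgen s * x)%g = lmul s x. Proof. by []. Qed.

Lemma alt_rcons s n : (alt s n * sgen (s (+) odd n))%g = alt s n.+1.
Proof.
rewrite -[LHS]/(wmul _ _) /wmul /=; elim: n s => [|n IHn] s /=.
  by rewrite addbF sgen_alt.
by rewrite -(lmul_alt_neg s n.+1) -IHn; case: s; case: (odd n).
Qed.

(** A letter added at the end or at the beginning of y multiplies y on the right by a
    generator or by a conjugate of one. *)
Lemma bruhat_cover y w : len w = (len y).+1 -> bruhat y w.
Proof.
rewrite (weyl_alt y) (weyl_alt w); move: (head _ _) (head _ _) (len y) (len w).
move=> b a n m; rewrite !len_alt => ->.
have [->|] := eqVneq b a.
  rewrite -alt_rcons; apply: bruhat_step; first exact: bruhat_refl.
    by exists 1%g, (a (+) odd n); rewrite invg1 mulg1 mul1g.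
  by rewrite alt_rcons !len_alt.
move=> ba; have -> : b = ~~ a by case: a b ba => -[].
set x := alt _ n.
have -> : alt a n.+1 = (x * (x^-1 * sgen a * x))%g.
  by rewrite !mulgA mulgV mul1g sgen_mul lmul_alt_neg.
apply: bruhat_step; first exact: bruhat_refl.
  by exists x^-1%g, a; rewrite invgK.
by rewrite !mulgA mulgV mul1g sgen_mul lmul_alt_neg !len_alt.
Qed.

Lemma bruhat_trans x y z : bruhat x y -> bruhat y z -> bruhat x z.
Proof.
by move=> xy; elim=> // u t yu xu rt ut; apply: bruhat_step.
Qed.

(** Length increases along chains; conversely an element is covered by both elements
    of the next length. *)
Lemma bruhatE y w : bruhat y w <-> y = w \/ (len y < len w)%N.
Proof.
split.
  elim=> [|x t _ [<-|yx] _ xt]; [by left|by right|right].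
  exact: ltn_trans yx xt.
case=> [->|]; first exact: bruhat_refl.
move=> yw; have -> : w = alt (head false w) (len w) by exact: weyl_alt.
move: (len w) yw => n; elim: n => // n IHn; rewrite ltnS leq_eqVlt.
case/orP => [/eqP yn|/IHn yw]; first by apply: bruhat_cover; rewrite len_alt yn.
apply: bruhat_trans yw _; apply: bruhat_cover; rewrite !len_alt //.
Qed.

(** For n > 0, the Bruhat interval below [alt s n], as the union of the pairs
    {y, s y} with y = [alt (~~ s) j]. *)
Definition below s n : seq weyl :=
  [seq alt (~~ s) j | j <- iota 0 n] ++ [seq alt s j.+1 | j <- iota 0 n].

Lemma below_uniq s n : uniq (below s n).
Proof.
rewrite cat_uniq !map_inj_uniq ?iota_uniq ?andbT //=.
- apply/hasPn => _ /mapP[j _ ->]; apply/mapP => -[i _ /alt_inj[_ /(_ isT)]].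
  by case: s.
- by move=> i j /alt_inj[[]].
- by move=> i j /alt_inj[].
Qed.

Lemma mem_below s n y : (y \in below s n.+1) = (y == alt s n.+1) || (len y < n.+1)%N.
Proof.
rewrite (weyl_alt y) len_alt; move: (head _ _) (len y) => b m.
rewrite alt_eq mem_cat; apply/orP/idP => [[]/mapP[j]|].
- by rewrite mem_iota => /= jn /alt_inj[-> _]; rewrite jn orbT.
- rewrite mem_iota => /= jn /alt_inj[-> /(_ isT)->]; rewrite eqxx andbT.
  by rewrite eqSS -leq_eqVlt.
- case/orP => [/andP[/eqP->]|mn].
    case/orP => // /eqP->; right; apply/mapP; exists n => //.
    by rewrite mem_iota /= ltnSn.
  have [bs|bs] := eqVneq b (~~ s).
    by left; apply/mapP; exists m; rewrite ?bs // mem_iota.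
  have {bs}-> : b = s by case: b s bs => -[].
  case: m mn => [|m] mn; [left|right]; apply/mapP.
    by exists 0; rewrite ?alt0.
  by exists m; rewrite // mem_iota /= add0n; lia.
Qed.

(** * Modules over the Hecke algebra of the infinite dihedral group *)
Section HeckeModule.
Variables (A : comNzRingType) (q : A) (V : lmodType A).
Variable theta : bool -> {linear V -> V}.
Hypothesis thetaE : forall s x,
  theta s (theta s x) = (q - 1) *: theta s x + q *: x.

Definition Tact (s : bool) n (x : V) : V := foldr (fun t => theta t) x (altw s n).
Definition Tsum s n x : V := \sum_(j < n) Tact s j x.
(** The sum of the T_y over y <= [alt s n], where T_s was factored out; for n = 0 the
    value is 0, not x. *)
Definition Csum s n x : V := Tsum (~~ s) n x + theta s (Tsum (~~ s) n x).

Lemma Tsum_shift s n x : Tsum s n.+1 x = x + theta s (Tsum (~~ s) n x).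
Proof. by rewrite /Tsum big_ord_recl linear_sum. Qed.

Lemma Csum0 s x : Csum s 0 x = 0.
Proof. by rewrite /Csum /Tsum big_ord0 linear0 addr0. Qed.

Lemma Csum1 s x : Csum s 1 x = x + theta s x.
Proof. by rewrite /Csum /Tsum big_ord1. Qed.

Lemma Csum_same s n x : theta s (Csum s n x) = q *: Csum s n x.
Proof.
rewrite /Csum linearD thetaE scalerDr addrA -[X in X + _ + _]scale1r -scalerDl.
by rewrite addrCA subrr addr0 addrC.
Qed.

Lemma Csum_split s n x : Csum (~~ s) n.+1 x = Tsum (~~ s) n.+2 x + theta s (Tsum (~~ s) n x).
Proof.
rewrite /Csum negbK [Tsum (~~ s) n.+2 x]Tsum_shift negbK.
by rewrite {1}(Tsum_shift s n) addrAC.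
Qed.

(** The Kazhdan-Lusztig multiplication rule for a letter that is not the first
    one, before normalization. *)
Lemma Csum_neg s n x :
  Csum (~~ s) n.+1 x + theta s (Csum (~~ s) n.+1 x)
    = Csum s n.+2 x + q *: Csum s n x.
Proof.
rewrite Csum_split linearD addrACA; congr (_ + _).
rewrite thetaE scalerDr addrA -[X in X + _ + _]scale1r -scalerDl.
by rewrite addrCA subrr addr0 addrC.
Qed.
End HeckeModule.

(** * Odd functions of an integer *)
(** Three-term recurrences have no boundary terms once sequences indexed by lengths,
    with value 0 at 0, are extended to odd functions. *)
Definition oddz (V : zmodType) (f : nat -> V) (k : int) : V :=
  match k with Posz n => f n | Negz n => - f n.+1 end.

Lemma oddzN (V : zmodType) (f : nat -> V) k : f 0%N = 0 -> oddz f (- k) = - oddz f k.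
Proof. by case: k => [[|n]|n] f0 /=; rewrite ?f0 ?oppr0 ?NegzE ?opprK. Qed.

Lemma oddz_map (V W : zmodType) (g : {additive V -> W}) f k :
  oddz (fun n => g (f n)) k = g (oddz f k).
Proof. by case: k => n /=; rewrite ?raddfN. Qed.

(** In degree 0 the two neighbours cancel, and negative degrees follow by parity. *)
Lemma oddz_rec (V W : zmodType) (g : V -> W) f h :
  g 0 = 0 -> {morph g : x / - x} -> f 0%N = 0 -> h 0%N = 0 -> (forall n, g (f n.+1) = h n.+2 + h n) ->
  forall k, g (oddz f k) = oddz h (k + 1) + oddz h (k - 1).
Proof.
move=> g0 gN f0 h0 gf.
have P n : g (oddz f n%:Z) = oddz h (n%:Z + 1) + oddz h (n%:Z - 1).
  case: n => [|n]; first by rewrite -[oddz f _]/(f 0%N) f0 g0 add0r sub0r oddzN // subrr.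
  have -> : n.+1%:Z + 1 = n.+2%:Z by lia.
  by rewrite (_ : n.+1%:Z - 1 = n%:Z) ?gf //; lia.
move=> k; case: (lerP 0 k) => [/gez0_abs <- //|/ltW/lez0_abs].
set n := absz k => kE; have -> : k = - n%:Z by rewrite kE opprK.
rewrite oddzN // gN P addrC opprD -!oddzN //.
by congr (oddz h _ + oddz h _); lia.
Qed.

(** The arguments are symmetric with respect to 0. *)
Lemma oddz_sum0 (V : zmodType) (f : nat -> V) n : f 0%N = 0 ->
  \sum_(k < n) oddz f (1 - n%:Z + 2 * k%:Z) = 0.
Proof.
move=> f0; elim/ltn_ind: n => -[|[|n]] IHn; first by rewrite big_ord0.
  by rewrite big_ord1.
rewrite big_ord_recl big_ord_recr.
rewrite [X in _ + (X + _)](_ : _ = 0); last first.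
  rewrite -[RHS](IHn n (leqnSn _)); apply: eq_bigr => k _; congr oddz.
  by rewrite /= /bump leq0n; lia.
set x := (X in oddz f X + _); set y := (X in _ + (_ + oddz f X)).
have -> : y = - x by rewrite /x /y /= /bump leq0n; lia.
by rewrite add0r oddzN // addrN.
Qed.

(** A string of m + 1 terms of step 2 and its shift by 2 have m terms in common and
    cover m + 2: this is the decomposition of the product of a character of SL_2 by
    the standard one. *)
Lemma string_rec (V : zmodType) (f : int -> V) x m :
  \sum_(k < m.+1) (f (x + 2 * k%:Z + 2) + f (x + 2 * k%:Z)) =
  \sum_(k < m.+2) f (x + 2 * k%:Z) + \sum_(k < m) f (x + 2 + 2 * k%:Z).
Proof.
rewrite big_split /= [X in X + _ = _]big_ord_recr [X in _ = X + _]big_ord_recr /=.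
rewrite [RHS]addrC [X in X + _ = _](_ : _ = \sum_(k < m) f (x + 2 + 2 * k%:Z)
  + f (x + 2 * m.+1%:Z)) -?addrA; first by congr (_ + _); rewrite addrC.
by congr (_ + _); [apply: eq_bigr => k _|]; congr f; lia.
Qed.

(** * Chebyshev elements of a Hecke algebra *)
Section Chebyshev.
Variables (A : comNzRingType) (v vi : A) (H : algType A) (t : bool -> H).
Hypothesis vvi : v * vi = 1.
Hypothesis tE : forall s, t s * t s = (v ^+ 2 - 1) *: t s + (v ^+ 2)%:A.

Definition dualT (s : bool) (x : H) : H := - vi ^+ 2 *: (t s * x).

Fact dualT_is_linear s : linear (dualT s).
Proof.
move=> c x y; rewrite /dualT mulrDr scalerDr -scalerAr !scalerA.
by rewrite [c * _]mulrC.
Qed.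
HB.instance Definition _ s := GRing.isLinear.Build A H H _
  (dualT s) (dualT_is_linear s).

(** The rescaled generator -T_s/q is again a Hecke generator, for the parameter
    1/q; the alternating sum that defines C_w becomes the plain sum Csum. *)
Lemma dualTE s x :
  dualT s (dualT s x) = (vi ^+ 2 - 1) *: dualT s x + vi ^+ 2 *: x.
Proof.
rewrite /dualT -scalerAr mulrA tE mulrDl !scalerDr -!scalerAl mul1r !scalerA.
congr (_ *: _ + _ *: _); ring: vvi.
Qed.

(** [KLD s n] is C_w for the word w of length n starting with s, and 0 instead of
    C_1 for n = 0; extended to an odd function of n, it obeys the Chebyshev
    recurrence without boundary terms. *)
Definition KLD s n : H := ((-1) ^+ n * v ^+ n) *: Csum dualT s n 1.

Lemma KLD0 s : KLD s 0 = 0.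
Proof. by rewrite /KLD Csum0 scaler0. Qed.

Lemma KLD1_mul s x : KLD s 1 * x = (- v) *: (x + dualT s x).
Proof.
by rewrite /KLD Csum1 -scalerAl mulrDl mul1r /dualT -scalerAl mulr1 !expr1 mulN1r.
Qed.

Lemma KLD_same s n : KLD s 1 * KLD s n = - (v + vi) *: KLD s n.
Proof.
rewrite KLD1_mul /KLD linearZ /= (Csum_same dualTE) !scalerA.
rewrite -scalerDl scalerA; congr (_ *: _); ring: vvi.
Qed.

Lemma KLD_neg s n : KLD s 1 * KLD (~~ s) n.+1 = KLD s n.+2 + KLD s n.
Proof.
rewrite KLD1_mul /KLD linearZ /= -scalerDr (Csum_neg dualTE) scalerA.
rewrite [LHS]scalerDr scalerA.
congr (_ *: _ + _ *: _); rewrite !exprS; move: (v ^+ n) ((-1) ^+ n) => x y; ring: vvi.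
Qed.

Definition KLDz s := oddz (KLD s).

Lemma KLDz_neg s k : KLD s 1 * KLDz (~~ s) k = KLDz s (k + 1) + KLDz s (k - 1).
Proof.
apply: (oddz_rec (mulr0 _) (mulrN _)) => [||n]; rewrite ?KLD0 //.
exact: KLD_neg.
Qed.

Lemma KLDz_same s k : KLD s 1 * KLDz s k = - (v + vi) *: KLDz s k.
Proof. by case: k => n; rewrite /KLDz /= ?mulrN KLD_same // scalerN. Qed.

(** The Clebsch-Gordan rule: C_w for w of length n plays the role of the
    irreducible representation of dimension n of SL_2. The neighbouring letters of
    the two words agree or differ according to [a (+) odd m (+) b]. *)
Lemma KLD_mul a m b n : KLD a m * KLD b n =
  if a (+) odd m (+) b
  then - (v + vi) *: \sum_(k < m) KLDz a (n%:Z - m%:Z + 1 + 2 * k%:Z)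
  else \sum_(k < m) (KLDz a (n%:Z - m%:Z + 2 * k%:Z + 2) + KLDz a (n%:Z - m%:Z + 2 * k%:Z)).
Proof.
elim/ltn_ind: m a => -[|[|m]] IHm a.
- by rewrite KLD0 mul0r !big_ord0 scaler0 if_same.
- rewrite !big_ord1 addbT addNb.
  have [->|ab] := eqVneq a b.
    rewrite addbb /= -[KLD b n]/(KLDz b n%:Z) KLDz_same.
    by congr (_ *: KLDz _ _); rewrite /=; lia.
  have -> : b = ~~ a by case: (a) (b) ab => -[].
  rewrite -[KLD _ n]/(KLDz _ n%:Z) KLDz_neg.
  case: ifP => [|_]; first by rewrite addbN addbb.
  by congr (KLDz _ _ + KLDz _ _); rewrite /=; lia.
have -> : KLD a m.+2 = KLD a 1 * KLD (~~ a) m.+1 - KLD a m.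
  by rewrite KLD_neg addrK.
rewrite mulrBl -mulrA !IHm // ?ltnS ?leqnSn //.
have [-> ->] : (~~ a (+) odd m.+1 = a (+) odd m) /\ (a (+) odd m.+2 = a (+) odd m).
  by rewrite /= negbK addNb addbN negbK.
case: ifP => _.
  rewrite -scalerAr -scalerBr mulr_sumr; congr (_ *: _); apply/eqP.
  rewrite subr_eq; apply/eqP.
  transitivity (\sum_(k < m.+1) (KLDz a (n%:Z - m.+2%:Z + 1 + 2 * k%:Z + 2)
      + KLDz a (n%:Z - m.+2%:Z + 1 + 2 * k%:Z))).
    by apply: eq_bigr => k _; rewrite KLDz_neg; congr (KLDz a _ + KLDz a _); lia.
  by rewrite string_rec; congr (_ + _); apply: eq_bigr => k _; congr KLDz; lia.
rewrite mulr_sumr; apply/eqP; rewrite subr_eq; apply/eqP.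
pose F x := KLDz a (x + 2) + KLDz a x.
transitivity (\sum_(k < m.+1) (F (n%:Z - m.+2%:Z + 2 * k%:Z + 2)
    + F (n%:Z - m.+2%:Z + 2 * k%:Z))).
  apply: eq_bigr => k _; rewrite mulrDr !KLDz_neg /F.
  by congr (KLDz a _ + KLDz a _ + (KLDz a _ + KLDz a _)); lia.
rewrite string_rec; congr (_ + _); apply: eq_bigr => k _; rewrite /F;
by congr (KLDz a _ + KLDz a _); lia.
Qed.
End Chebyshev.

(** * The Kazhdan-Lusztig basis *)
Lemma vpowD k l : vpow (k + l) = vpow k * vpow l.
Proof. by rewrite -[RHS]/(laurent_mul _ _) laurent_mulvv. Qed.

Lemma vpow0 : vpow 0 = 1. Proof. by []. Qed.

Lemma vpowN k : vpow k * vpow (- k) = 1.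
Proof. by rewrite -vpowD subrr. Qed.

Lemma vpowX k n : vpow k ^+ n = vpow (k * n%:Z).
Proof.
elim: n => [|n IHn]; first by rewrite mulr0.
by rewrite exprS IHn -vpowD; congr vpow; lia.
Qed.

Lemma big_iota0 (V : nmodType) n (F : nat -> V) :
  \sum_(j <- iota 0 n) F j = \sum_(j < n) F j.
Proof. by rewrite -(big_mkord xpredT) /index_iota subn0. Qed.

Section HeckeBasis.
Variables (A : comNzRingType) (q v vi : A).
Local Notation Tb := (Tbas q).
Local Notation th := (dualT vi (fun s => Tb (sgen s))).

Lemma Tbas_sqr s : Tb (sgen s) * Tb (sgen s) = (q - 1) *: Tb (sgen s) + q%:A.
Proof.
by rewrite [LHS]hecke_mulT /= TgenT /sgen lmulK.
Qed.

Lemma Tact_Tbas s n : Tact th s n 1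
  = ((-1) ^+ n * vi ^+ (2 * n)) *: Tb (alt s n).
Proof.
elim: n s => [|n IHn] s; first by rewrite mulr1 scale1r alt0.
rewrite -[LHS]/(th s (Tact th (~~ s) n 1)) IHn linearZ /= /dualT.
rewrite hecke_TT sgen_mul lmul_alt_neg ?sgen_alt ?len_alt // scalerA; congr (_ *: _).
by rewrite mulnS exprD [(-1) ^+ n.+1]exprS; ring.
Qed.

Lemma KLD_Tbas s n : KLD v vi (fun s => Tb (sgen s)) s n
  = \sum_(y <- below s n)
      ((-1) ^+ n * v ^+ n * ((-1) ^+ len y * vi ^+ (2 * len y))) *: Tb y.
Proof.
rewrite /KLD /Csum /Tsum linear_sum scalerDr !scaler_sumr big_cat !big_map.
rewrite !big_iota0.
apply: (f_equal2 +%R).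
  apply: eq_bigr => j _.
  by rewrite Tact_Tbas scalerA len_alt.
apply: eq_bigr => j _.
by rewrite -[X in _ *: X]/(Tact th s j.+1 1) Tact_Tbas scalerA len_alt.
Qed.
End HeckeBasis.

Lemma bruhat_below s n : [set y | bruhat y (alt s n.+1)] = [set` below s n.+1].
Proof.
apply/seteqP; split=> y /=; rewrite mem_below.
  by case/bruhatE => [->|]; rewrite ?eqxx // len_alt => ->; rewrite orbT.
by case/orP => [/eqP->|h]; apply/bruhatE; [left|right; rewrite len_alt].
Qed.

Lemma KLC1 : KLC 1%g = 1.
Proof.
rewrite /KLC (_ : [set y | _] = [set` [:: 1%g : weyl]]).
  rewrite -fsbig_seq // big_seq1 !subrr oppr0 vpow0 !mulr1; exact: scale1r.
apply/seteqP; split=> y /=; rewrite inE.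
  by case/bruhatE => [->|].
by move/eqP->; apply: bruhat_refl.
Qed.

(** ** Coordinates in the Kazhdan-Lusztig basis *)
Lemma Tcoef (c : laurent) y x : (c *: T y)@_x = c *+ (y == x).
Proof. by rewrite mcoeffZ mcoeffU mulr_natr. Qed.

Lemma mcoeff_sum (G : zmodType) (K : choiceType) (x : K) I r (P : pred I) (F : I -> malg K G) :
  (\sum_(i <- r | P i) F i)@_x = \sum_(i <- r | P i) (F i)@_x.
Proof. exact: (raddf_sum (mcoeff x)). Qed.

Lemma finite_bruhat w : finite_set [set y | bruhat y w].
Proof.
rewrite (weyl_alt w); case: (len w) => [|n]; last first.
  by rewrite bruhat_below; apply: finite_seq.
apply: (@sub_finite_set _ _ [set` [:: 1%g : weyl]]); last exact: finite_seq.
move=> y /= /bruhatE; rewrite alt0 => -[->|]; first exact: mem_head.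
by rewrite ltn0.
Qed.

Lemma fsum_mcoeff (c : weyl -> laurent) (D : set weyl) x : finite_set D ->
  ((\sum_(y \in D) c y *: T y) : hecke)@_x = if x \in D then c x else 0.
Proof.
move=> Df; rewrite fsbig_finite // mcoeff_sum.
under eq_bigr do rewrite Tcoef.
case: ifPn => xD.
  rewrite (big_fsetD1 x) /=; last by rewrite in_fset_set.
  rewrite eqxx mulr1n big1_seq ?addr0 // => y /=.
  by rewrite in_fsetD1 => /andP[/negPf->].
apply: big1_seq => y /= yD; case: eqP => // yx.
by rewrite -yx -in_fset_set // yD in xD.
Qed.

Lemma KLC_coef w x : (KLC w)@_x = if `[< bruhat x w >]
  then (-1) ^+ (len w - len x) * vpow ((len w)%:Z - (len x)%:Z) * vpow (- (len x)%:Z)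
  else 0.
Proof. by rewrite /KLC fsum_mcoeff ?mem_setE ?inE //; apply: finite_bruhat. Qed.

Lemma KLC'_coef w x :
  (KLC' w)@_x = if `[< bruhat x w >] then vpow (- (len w)%:Z) else 0.
Proof.
rewrite /KLC' mcoeffZ.
under eq_fsbigr do rewrite -[T _]scale1r.
rewrite fsum_mcoeff; last exact: finite_bruhat.
have -> : (x \in [set y | bruhat y w]) = `[< bruhat x w >] by [].
by case: ifP => _; rewrite ?mulr1 ?mulr0.
Qed.

Lemma vpow_lreg k (a : laurent) : a * vpow k = 0 -> a = 0.
Proof. by move=> e; rewrite -[a]mulr1 -(vpowN k) mulrA e mul0r. Qed.

Lemma seq_argmax (T : eqType) (f : T -> nat) (s : seq T) x : x \in s ->
  exists2 w, w \in s & forall y, y \in s -> (f y <= f w)%N.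
Proof.
elim: s x => // a [|b s] IHs x _.
  by exists a => [|y]; rewrite ?inE // => /eqP->.
have [w ws wmax] := IHs b (mem_head _ _).
have [aw|wa] := leqP (f a) (f w).
  by exists w => [|y]; rewrite in_cons ?ws ?orbT // => /orP[/eqP->|/wmax].
exists a => [|y]; rewrite in_cons ?eqxx // => /orP[/eqP->//|/wmax yw].
exact: leq_trans yw (ltnW wa).
Qed.

(** At an element of maximal length in the support, only one C_w contributes. *)
Lemma linext_KLC_inj (c : {malg laurent[weyl]}) : linext KLC c = 0 -> c = 0.
Proof.
move=> c0; apply/malgP => w0; rewrite mcoeff0; apply/eqP.
rewrite mcoeff_eq0; apply/negP => w0c.
have [w wc lem] := seq_argmax len w0c.
have := congr1 (mcoeff w) c0; rewrite /linext mcoeff_sum mcoeff0.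
rewrite (big_fsetD1 w) //= big1_seq ?addr0 => [|y /=].
  rewrite mcoeffZ KLC_coef ifT; last by apply/asboolP; apply: bruhat_refl.
  rewrite subnn expr0 mul1r -vpowD => /vpow_lreg/eqP.
  by rewrite mcoeff_eq0 wc.
rewrite in_fsetD1 => /andP[yw /lem yc]; rewrite mcoeffZ KLC_coef ifF ?mulr0 //.
apply/asboolPn => /bruhatE[/esym/eqP|]; first by rewrite (negPf yw).
by rewrite ltnNge yc.
Qed.

(** By linear independence, structure constants can be read off any expansion. *)
Lemma KLcoordE c : KLcoord (linext KLC c) = c.
Proof.
rewrite /KLcoord; apply: xget_unique => [|d /esym/eqP]; first exact: erefl.
rewrite -subr_eq0 -linearB => /eqP/linext_KLC_inj/eqP.
by rewrite subr_eq0 => /eqP.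
Qed.

(** The basis element of [alt s n] with the convention of [KLD]: index 0 stands for
    0 and not for the unit. *)
Definition nzbas (A : nzRingType) s n : {malg A[weyl]} :=
  if n is 0 then 0 else << alt s n >>.
Definition zbas (A : nzRingType) s := oddz (nzbas A s).

Definition Tgen1 (s : bool) : hecke := T (sgen s).
Local Notation KD := (KLD (vpow 1) (vpow (- 1)) Tgen1).
Local Notation KDz := (KLDz (vpow 1) (vpow (- 1)) Tgen1).

Lemma Tgen1E s :
  Tgen1 s * Tgen1 s = (vpow 1 ^+ 2 - 1) *: Tgen1 s + (vpow 1 ^+ 2)%:A.
Proof. by rewrite vpowX; apply: Tbas_sqr. Qed.

Fact sign_split (A : comNzRingType) n i (x y z w : A) : (i <= n)%N ->
  x * y = z * w ->
  (-1) ^+ (n - i) * x * y = (-1) ^+ n * z * ((-1) ^+ i * w).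
Proof.
move=> i_le e; have -> : (-1) ^+ n = (-1) ^+ (n - i) * (-1) ^+ i :> A.
  by rewrite -exprD subnK.
by rewrite -mulrA e; have := sqrr_sign A i; move: ((-1) ^+ i) => b b1; ring: b1.
Qed.

(** The coefficients of C_w factor into a scalar and the powers of -1/q by which
    [dualT] rescales the T_y. *)
Lemma KLCoefE n i : (i <= n)%N ->
  (-1) ^+ (n - i) * vpow (n%:Z - i%:Z) * vpow (- i%:Z) =
  (-1) ^+ n * vpow 1 ^+ n * ((-1) ^+ i * vpow (- 1) ^+ (2 * i)) :> laurent.
Proof.
move=> i_le; rewrite !vpowX; apply: (sign_split i_le).
by rewrite -!vpowD; congr vpow; lia.
Qed.

Lemma KLC_KD s n : KLC (alt s n.+1) = KD s n.+1.
Proof.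
rewrite /KLC bruhat_below -fsbig_seq ?below_uniq // KLD_Tbas.
apply: eq_big_seq => y; rewrite mem_below len_alt => yle.
rewrite KLCoefE //; case/orP: yle => [/eqP->|/ltnW//].
by rewrite len_alt.
Qed.

Lemma linext_zbas s k : linext KLC (zbas laurent s k) = KDz s k.
Proof.
rewrite -(oddz_map (linext KLC)); congr oddz; apply/funext => -[|n].
  by rewrite KLD0; apply: linear0.
exact: etrans (linextU _ _) (KLC_KD _ _).
Qed.

Lemma hstr1l y z : hstr 1%g y z = (z == y)%:R.
Proof.
rewrite /hstr KLC1 mul1r (_ : KLC y = linext KLC << y >>); last by rewrite linextU.
rewrite KLcoordE mcoeffU eq_sym.
by case: eqP.
Qed.

Lemma hstr1r x z : hstr x 1%g z = (z == x)%:R.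
Proof.
rewrite /hstr KLC1 mulr1 (_ : KLC x = linext KLC << x >>); last by rewrite linextU.
rewrite KLcoordE mcoeffU eq_sym.
by case: eqP.
Qed.

Section Strings.
Variables (A : nzRingType) (V : lmodType A) (K : weyl -> V) (a : bool) (g : int -> V).
Hypothesis Kg : forall k, linext K (zbas A a k) = g k.

Lemma linext_stringZ c m (x : nat -> int) :
  linext K (c *: \sum_(k < m) zbas A a (x k)) = c *: \sum_(k < m) g (x k).
Proof. by rewrite linearZ linear_sum /=; under eq_bigr do rewrite Kg. Qed.

Lemma linext_stringD m (x y : nat -> int) :
  linext K (\sum_(k < m) (zbas A a (x k) + zbas A a (y k))) =
  \sum_(k < m) (g (x k) + g (y k)).
Proof. by rewrite linear_sum /=; under eq_bigr do rewrite linearD /= !Kg. Qed.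
End Strings.

(** The coordinates of the right-hand side of [KLD_mul]. *)
Definition hcoord a m b n : {malg laurent[weyl]} :=
  if a (+) odd m (+) b then
    - (vpow 1 + vpow (- 1)) *: \sum_(k < m) zbas laurent a (n%:Z - m%:Z + 1 + 2 * k%:Z)
  else \sum_(k < m) (zbas laurent a (n%:Z - m%:Z + 2 * k%:Z + 2)
                   + zbas laurent a (n%:Z - m%:Z + 2 * k%:Z)).

Lemma hstrE a m b n z :
  hstr (alt a m.+1) (alt b n.+1) z = (hcoord a m.+1 b n.+1)@_z.
Proof.
have e : KLC (alt a m.+1) * KLC (alt b n.+1) = linext KLC (hcoord a m.+1 b n.+1).
  rewrite !KLC_KD.
  rewrite (KLD_mul (vpowN 1) Tgen1E) /hcoord.
  case: ifP => _; apply: esym.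
    exact: (linext_stringZ (linext_zbas a) _ _ (fun k => n.+1%:Z - m.+1%:Z + 1 + 2 * k%:Z)).
  exact: (linext_stringD (linext_zbas a) _ (fun k => n.+1%:Z - m.+1%:Z + 2 * k%:Z + 2)
    (fun k => n.+1%:Z - m.+1%:Z + 2 * k%:Z)).
by rewrite /hstr e KLcoordE.
Qed.

(** * Structure constants of the asymptotic algebra *)
Lemma fsumT_seq (I : choiceType) (V : nmodType) (r : seq I) (F : I -> V) :
  uniq r -> (forall i, i \notin r -> F i = 0) ->
  \sum_(i \in [set: I]) F i = \sum_(i <- r) F i.
Proof.
move=> ur F0; rewrite (@fsbigE _ _ _ _ _ r) //; last by move=> i _ /F0.
by apply: eq_bigl => i; rewrite in_setT.
Qed.

Lemma basis_sum_coef (A : nzRingType) (K : choiceType) (f : K -> A) (r : seq K) z :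
  uniq r -> (z \notin r -> f z = 0) -> (\sum_(i <- r) f i *: << i >>)@_z = f z.
Proof.
move=> ur f0; rewrite mcoeff_sum; under eq_bigr do rewrite mcoeffZ mcoeffU mulr_natr.
have [zr|zr] := boolP (z \in r); last first.
  by rewrite f0 // big1_seq // => i /= ir; case: eqP => // iz; rewrite -iz ir in zr.
rewrite (bigD1_seq z) //= eqxx mulr1n big1 ?addr0 // => i /negPf iz.
by rewrite iz.
Qed.

Lemma asymp_mul_coef x y z : (asymp_mul (tbas x) (tbas y))@_z = gammastr x y z.
Proof.
rewrite /asymp_mul /tbas !linextU.
pose c := KLcoord (KLC x * KLC y).
have g0 i : i \notin msupp c -> gammastr x y i = 0.
  by move=> /mcoeff_outdom ci; rewrite /gammastr /hstr ci mulr0 mcoeff0.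
rewrite (@fsumT_seq _ _ (msupp c)) ?fset_uniq // => [|i /g0->]; last exact: scale0r.
by apply: basis_sum_coef => [|/g0]; rewrite ?fset_uniq.
Qed.

Lemma mcoeff_intr (a : laurent) (n : int) k : (a * n%:~R)@_k = a@_k * n.
Proof. by rewrite mulrzr raddfMz -mulrzr intz. Qed.

Lemma mcoeff_vpow k l : (vpow k)@_l = (k == l)%:R.
Proof. exact: mcoeffU. Qed.

Lemma zbas_Negz (A : nzRingType) a n : zbas A a (Negz n) = - nzbas A a n.+1.
Proof. by []. Qed.

Lemma zbas_coefE a k z : (zbas laurent a k)@_z = ((zbas int a k)@_z)%:~R.
Proof.
have P n : (nzbas laurent a n)@_z = ((nzbas int a n)@_z)%:~R.
  by case: n => [|n] /=; rewrite ?mcoeff0 // !mcoeffU; case: (_ == _).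
case: k => n; first exact: P.
by rewrite !zbas_Negz !mcoeffN P mulrNz.
Qed.

Lemma zbas_coef1 a k : (zbas int a k)@_1%g = 0.
Proof.
have P n : (nzbas int a n)@_1%g = 0.
  by case: n => [|n] /=; rewrite ?mcoeff0 // mcoeffU (negPf (alt_neq1 _ _)).
by case: k => n; [apply: P | rewrite zbas_Negz mcoeffN P oppr0].
Qed.

Lemma gamma_same (n : int) :
  (- vpow 1 * (- (vpow 1 + vpow (- 1)) * n%:~R))@_0 = n.
Proof.
by rewrite mulrA mcoeff_intr mulrNN mulrDr -!vpowD mcoeffD !mcoeff_vpow mul1r.
Qed.

Lemma gamma_diff (n : int) : (- vpow 1 * n%:~R)@_0 = 0.
Proof. by rewrite mcoeff_intr mcoeffN mcoeff_vpow oppr0 mul0r. Qed.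

(** The asymptotic product keeps only the coefficient 1/v + v of the products
    with agreeing neighbouring letters, whence the plain Clebsch-Gordan rule. *)
Lemma asymp_mulE a m b n : asymp_mul (tbas (alt a m.+1)) (tbas (alt b n.+1)) =
  if a (+) odd m.+1 (+) b
  then \sum_(k < m.+1) zbas int a (n.+1%:Z - m.+1%:Z + 1 + 2 * k%:Z) else 0.
Proof.
apply/malgP => z; rewrite asymp_mul_coef /gammastr hstrE /hcoord /afun.
pose S (x : nat -> int) := (\sum_(k < m.+1) zbas int a (x k))@_z.
have S1 x : z = 1%g -> S x = 0.
  by move=> z1; rewrite /S mcoeff_sum big1 // => k _; rewrite z1 zbas_coef1.
have SE (x : nat -> int) : (\sum_(k < m.+1) zbas laurent a (x k))@_z = (S x)%:~R.
  by rewrite /S !mcoeff_sum rmorph_sum; apply: eq_bigr => k _; apply: zbas_coefE.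
case: ifP => _.
  rewrite mcoeffZ (SE (fun k => n.+1%:Z - m.+1%:Z + 1 + 2 * k%:Z)).
  rewrite -/(S (fun k => n.+1%:Z - m.+1%:Z + 1 + 2 * k%:Z)).
  have [z1|z1] := eqVneq z 1%g; last by rewrite expr1 gamma_same.
  by rewrite S1 // !mulr0 mcoeff0.
rewrite big_split mcoeffD (SE (fun k => n.+1%:Z - m.+1%:Z + 2 * k%:Z + 2)).
rewrite (SE (fun k => n.+1%:Z - m.+1%:Z + 2 * k%:Z)) -intrD.
have [z1|z1] := eqVneq z 1%g; last by rewrite expr1 gamma_diff mcoeff0.
by rewrite !S1 // !mulr0 !mcoeff0.
Qed.

Lemma gamma_unit y z :
  ((- vpow 1) ^+ (z != 1%g) * (z == y)%:R)@_0 = ((if y == 1%g then tbas 1%g else 0) : asymp)@_z.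
Proof.
rewrite mulr_natr raddfMn /=.
have [->|zy] := eqVneq z y; last first.
  rewrite mulr0n; case: (y =P 1%g) zy => [->|_ _]; last by rewrite mcoeff0.
  by rewrite mcoeffU eq_sym => /negPf->.
rewrite mulr1n; case: eqP => [->|_]; first by rewrite expr0 -vpow0 mcoeff_vpow mcoeffUU.
by rewrite expr1 mcoeffN mcoeff_vpow mcoeff0 oppr0.
Qed.

Lemma asymp_mul1l y : asymp_mul (tbas 1%g) (tbas y) = if y == 1%g then tbas 1%g else 0.
Proof.
by apply/malgP => z; rewrite asymp_mul_coef /gammastr hstr1l; apply: gamma_unit.
Qed.

Lemma asymp_mul1r x : asymp_mul (tbas x) (tbas 1%g) = if x == 1%g then tbas 1%g else 0.
Proof.
by apply/malgP => z; rewrite asymp_mul_coef /gammastr hstr1r; apply: gamma_unit.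
Qed.

(** * The action of the asymptotic algebra on a space with basis Z *)
Section Strings.
Variables (V : zmodType) (f : int -> V).

(** The character of the n-dimensional irreducible representation of SL_2,
    as a sum of shifts, centered at i. *)
Definition str n (i : int) : V := \sum_(j < n) f (i - n%:Z + 1 + 2 * j%:Z).

Lemma str0 i : str 0 i = 0. Proof. exact: big_ord0. Qed.

Lemma str1 i : str 1 i = f i.
Proof. by rewrite /str big_ord1; congr f; rewrite /=; lia. Qed.

Lemma str_rec n i : str n.+1 (i + 1) + str n.+1 (i - 1) = str n.+2 i + str n i.
Proof.
rewrite /str -big_split /=.
transitivity (\sum_(k < n.+1) (f (i - n.+2%:Z + 1 + 2 * k%:Z + 2)
    + f (i - n.+2%:Z + 1 + 2 * k%:Z))).
  by apply: eq_bigr => k _; congr (f _ + f _); lia.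
by rewrite string_rec; congr (_ + _); apply: eq_bigr => k _; congr f; lia.
Qed.

Definition strz k i := oddz (str^~ i) k.

Lemma strz_rec k i : strz k (i + 1) + strz k (i - 1) = strz (k + 1) i + strz (k - 1) i.
Proof.
have P n : strz n%:Z (i + 1) + strz n%:Z (i - 1) = strz (n%:Z + 1) i + strz (n%:Z - 1) i.
  case: n => [|n].
    by rewrite /strz [oddz _ 0 in LHS]str0 [oddz _ 0]str0 add0r sub0r oddzN ?str0 // subrr.
  have -> : n.+1%:Z + 1 = n.+2%:Z by lia.
  by rewrite (_ : n.+1%:Z - 1 = n%:Z) ?[LHS]str_rec //; lia.
have [/gez0_abs <- //|/ltW/lez0_abs] := lerP 0 k.
set n := absz k => kE; have -> : k = - n%:Z by rewrite kE opprK.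
rewrite /strz !(oddzN _ (str0 _)) -opprD [X in - X]P addrC opprD -!(oddzN _ (str0 _)).
by congr (oddz _ _ + oddz _ _); lia.
Qed.

(** The Clebsch-Gordan rule for compositions of strings of shifts. *)
Lemma str_comp m n i :
  \sum_(j < n) str m (i - n%:Z + 1 + 2 * j%:Z) =
  \sum_(k < m) strz (n%:Z - m%:Z + 1 + 2 * k%:Z) i.
Proof.
elim/ltn_ind: m i => -[|[|m]] IHm i.
- by rewrite big_ord0 big1 // => j _; rewrite str0.
- rewrite big_ord1; under eq_bigr do rewrite str1.
  by rewrite -[LHS]/(strz n i); congr strz; rewrite /=; lia.
apply: (@addIr _ (\sum_(j < n) str m (i - n%:Z + 1 + 2 * j%:Z))).
rewrite -big_split /=; under eq_bigr do rewrite -str_rec.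
rewrite big_split /= IHm //.
have e (c : int) : \sum_(j < n) str m.+1 (i - n%:Z + 1 + 2 * j%:Z + c) =
    \sum_(k < m.+1) strz (n%:Z - m.+1%:Z + 1 + 2 * k%:Z) (i + c).
  by rewrite -IHm //; apply: eq_bigr => j _; congr str; lia.
rewrite !e -big_split /=.
transitivity (\sum_(k < m.+1) (strz (n%:Z - m.+2%:Z + 1 + 2 * k%:Z + 2) i
    + strz (n%:Z - m.+2%:Z + 1 + 2 * k%:Z) i)).
  by apply: eq_bigr => k _; rewrite strz_rec; congr (strz _ _ + strz _ _); lia.
rewrite (string_rec (strz^~ i)); congr (_ + _).
by apply: eq_bigr => k _; congr strz; lia.
Qed.
End Strings.

(** Indices of parity s correspond to words with last letter s. *)
Definition parz (i : int) : bool := odd `|i|%N.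

Lemma parzD i j : parz (i + j) = parz i (+) parz j.
Proof. rewrite /parz; lia. Qed.

Lemma parz_nat (n : nat) : parz n = odd n. Proof. by []. Qed.

Lemma parzN i : parz (- i) = parz i.
Proof. by rewrite /parz abszN. Qed.

Lemma parz2 i : parz (2 * i) = false.
Proof. rewrite /parz; lia. Qed.

Lemma parz_odd k : parz (2 * k + 1). Proof. by rewrite parzD parz2. Qed.

Lemma parz1 i : parz (i + 1) = ~~ parz i.
Proof. by rewrite parzD addbT. Qed.

Lemma parzB1 i : parz (i - 1) = ~~ parz i.
Proof. by rewrite parzD addbT. Qed.

Section Jaction.
Variables (V : zmodType) (f : int -> V).

(** The basis element t_w with w of length n starting with a, acting on the basis
    vector of index i: it vanishes unless the parity of i is that of the last
    letter of w. *)
Definition Jstr a n i : V :=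
  if parz i (+) a (+) odd n then str f n i *~ (-1) ^+ n.+1 else 0.

Definition Jbas (x : weyl) i : V := Jstr (head false x) (len x) i.

Lemma Jstr0 a i : Jstr a 0 i = 0.
Proof. by rewrite /Jstr str0 mul0rz if_same. Qed.

Lemma Jbas_alt a n i : Jbas (alt a n) i = Jstr a n i.
Proof. by rewrite /Jbas len_alt; case: n => [|n] //; rewrite !Jstr0. Qed.

Lemma Jbas1 i : Jbas 1%g i = 0.
Proof. exact: Jstr0. Qed.

Definition Jlin i : {linear {malg int[weyl]} -> zmodule V} :=
  linext (V := zmodule V) (Jbas^~ i).
Definition Jact (t : asymp) i : V := Jlin i t.

Lemma Jact_bas x i : Jact (tbas x) i = Jbas x i.
Proof. exact: (@linextU _ int (zmodule V)). Qed.

Lemma JactD s t i : Jact (s + t) i = Jact s i + Jact t i.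
Proof. exact: (linearD (Jlin i)). Qed.

Lemma JactZ (c : int) t i : Jact (c *: t) i = Jact t i *~ c.
Proof. exact: (linearZ_LR (Jlin i)). Qed.

Lemma Jact0 i : Jact 0 i = 0. Proof. exact: (linear0 (Jlin i)). Qed.

Lemma JactN t i : Jact (- t) i = - Jact t i. Proof. exact: (linearN (Jlin i)). Qed.

Lemma Jact_sum I (r : seq I) (F : I -> asymp) i :
  Jact (\sum_(j <- r) F j) i = \sum_(j <- r) Jact (F j) i.
Proof. exact: (linear_sum (Jlin i)). Qed.

Lemma Jact_zbas a k i : Jact (zbas int a k) i =
  if parz i (+) a (+) parz k then strz f k i *~ (-1) ^+ (parz k).+1 else 0.
Proof.
have P n : Jact (nzbas int a n) i =
    if parz i (+) a (+) odd n then str f n i *~ (-1) ^+ (odd n).+1 else 0.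
  case: n => [|n]; first by rewrite Jact0 str0 mul0rz if_same.
  by rewrite [LHS]Jact_bas Jbas_alt /Jstr [in RHS]exprS signr_odd -exprS.
case: k => n; first exact: P.
rewrite zbas_Negz JactN P /parz; case: ifP => _; last by rewrite oppr0.
by rewrite -mulNrz.
Qed.
End Jaction.

Section Jmodule.
Variable A : nzRingType.
Local Notation M := {malg A[int]}.
Local Notation e := (fun i : int => << i >> : M).

Definition Jop (t : asymp) : {linear M -> M} := linext (Jact e t).

Lemma Jop_bas t i : Jop t (e i) = Jact e t i.
Proof. exact: linextU. Qed.

Lemma Jop_str t n i :
  Jop t (str e n i) = \sum_(j < n) Jact e t (i - n%:Z + 1 + 2 * j%:Z).
Proof. by rewrite /str linear_sum; apply: eq_bigr => j _; apply: Jop_bas. Qed.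

(** The product of J and the composition of strings both obey the Clebsch-Gordan
    rule; the parities of the letters make the same products vanish. *)
Lemma Jact_mul_bas x y i : Jact e (asymp_mul (tbas x) (tbas y)) i = Jop (tbas x) (Jact e (tbas y) i).
Proof.
rewrite [in RHS]Jact_bas.
rewrite (weyl_alt x) (weyl_alt y); move: (head _ x) (head _ y) (len x) (len y) => a b.
move=> [|m] [|n]; rewrite ?alt0.
- rewrite asymp_mul1l eqxx Jact_bas Jbas1; exact: esym (linear0 _).
- rewrite asymp_mul1l (negPf (alt_neq1 _ _)) Jact0 Jbas_alt /Jstr.
  case: ifP => _; last by apply: esym (linear0 _).
  rewrite raddfMz /= Jop_str big1 ?mul0rz // => j _.
  by rewrite Jact_bas Jbas1.
- rewrite asymp_mul1r (negPf (alt_neq1 _ _)) Jact0 Jbas1; exact: esym (linear0 _).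
rewrite asymp_mulE Jbas_alt /Jstr.
have par (j : 'I_n.+1) : parz (i - n.+1%:Z + 1 + 2 * j%:Z) = parz i (+) odd n.
  by rewrite !parzD parzN parz2 !parz_nat /= addbF; case: (parz i) (odd n) => [] [].
case: (boolP (parz i (+) b (+) odd n.+1)) => ib; last first.
  rewrite [RHS]linear0; case: ifP => ab; last by rewrite Jact0.
  rewrite Jact_sum big1 // => k _; rewrite Jact_zbas ifF //.
  rewrite !parzD parzN parz2 !parz_nat /=; move: ib ab => /=.
  by case: (parz i) (a) (b) (odd n) (odd m) => [] [] [] [] [].
rewrite raddfMz /= Jop_str; case: ifP => ab; last first.
  rewrite Jact0 big1 ?mul0rz // => j _; rewrite Jact_bas Jbas_alt /Jstr ifF //.
  rewrite par; move: ib ab => /=.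
  by case: (parz i) (a) (b) (odd n) (odd m) => [] [] [] [] [].
have -> : \sum_(j < n.+1) Jact e (tbas (alt a m.+1)) (i - n.+1%:Z + 1 + 2 * j%:Z) =
    (\sum_(j < n.+1) str e m.+1 (i - n.+1%:Z + 1 + 2 * j%:Z)) *~ (-1) ^+ m.+2.
  rewrite mulrz_suml; apply: eq_bigr => j _.
  rewrite Jact_bas Jbas_alt /Jstr par ifT //.
  move: ib ab => /=.
  by case: (parz i) (a) (b) (odd n) (odd m) => [] [] [] [] [].
rewrite Jact_sum str_comp -mulrzA -exprD mulrz_suml; apply: eq_bigr => k _.
rewrite Jact_zbas ifT; last first.
  rewrite !parzD parzN parz2 !parz_nat /=; move: ib ab => /=.
  by case: (parz i) (a) (b) (odd n) (odd m) => [] [] [] [] [].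
rewrite !parzD parzN parz2 !parz_nat -signr_odd -[in RHS]signr_odd.
by rewrite oddD /=; case: (odd n) (odd m) => [] [].
Qed.

Lemma Jop0 m : Jop 0 m = 0.
Proof.
elim/malg_lin_ind: m => [|j|d m1 m2 IH1 IH2]; first exact: linear0.
  by rewrite Jop_bas Jact0.
by rewrite linearP /= IH1 IH2 scaler0 addr0.
Qed.

Lemma Jop_mul s t m : Jop (asymp_mul s t) m = Jop s (Jop t m).
Proof.
have mulPl c (s1 s2 : asymp) : asymp_mul (c *: s1 + s2) t = c *: asymp_mul s1 t + asymp_mul s2 t.
  exact: linearP.
have mulPr c x (t1 t2 : asymp) : asymp_mul (tbas x) (c *: t1 + t2)
    = c *: asymp_mul (tbas x) t1 + asymp_mul (tbas x) t2.
  by rewrite /asymp_mul /tbas !linextU linearP.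
suff P i : Jact e (asymp_mul s t) i = Jop s (Jact e t i).
  elim/malg_lin_ind: m => [|i|c m1 m2 IH1 IH2].
  - by rewrite !linear0.
  - by rewrite !Jop_bas P.
  - by rewrite !linearP /= IH1 IH2.
have JopPl c s1 s2 m0 : Jop (c *: s1 + s2) m0 = Jop s1 m0 *~ c + Jop s2 m0.
  elim/malg_lin_ind: m0 => [|j|d m1 m2 IH1 IH2].
  - by rewrite !linear0 mul0rz addr0.
  - by rewrite !Jop_bas JactD JactZ.
  - rewrite !linearP /= IH1 IH2 scalerDr mulrzDl addrACA.
    by rewrite scalerMzr.
elim/malg_lin_ind: s mulPl => [|x|c s1 s2 IH1 IH2] mulPl.
- by rewrite (_ : asymp_mul 0 t = 0) ?Jact0 ?Jop0 //; apply: linear0.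
- elim/malg_lin_ind: t {mulPl} => [|y|c t1 t2 IH1 IH2].
  + rewrite (_ : asymp_mul _ 0 = 0) ?Jact0; first by rewrite linear0.
    by rewrite /asymp_mul linextU linear0.
  + exact: Jact_mul_bas.
  + by rewrite mulPr !JactD !JactZ IH1 IH2 linearD raddfMz.
- by rewrite mulPl !JactD !JactZ IH1 // IH2 // JopPl.
Qed.

Lemma Jop_D s t m : Jop (s + t) m = Jop s m + Jop t m.
Proof.
elim/malg_lin_ind: m => [|j|d m1 m2 IH1 IH2].
- by rewrite !linear0 addr0.
- by rewrite !Jop_bas JactD.
- by rewrite !linearP /= IH1 IH2 scalerDr addrACA.
Qed.

(** An index has the parity of exactly one of the two generators, and the
    corresponding string has length 1. *)
Lemma Jop_one m : Jop asymp_one m = m.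
Proof.
elim/malg_lin_ind: m => [|j|d m1 m2 IH1 IH2].
- by rewrite linear0.
- rewrite Jop_bas /asymp_one Jact_sum /dinvol !big_cons big_nil !Jact_bas Jbas1.
  rewrite !sgen_alt !Jbas_alt /Jstr !str1 mulr1z addr0 add0r /=.
  by case: (parz j); rewrite /= ?addr0 ?add0r.
- by rewrite !linearP /= IH1 IH2.
Qed.
End Jmodule.

(** * The inverse of the map phi *)
Section Green.
Variables (V : zmodType) (f : int -> V).

(** The solution in n of a Chebyshev recurrence that vanishes at 0 and has a source
    at m: a string of length the smaller of m and n, centered at the larger. *)
Definition green m n : V := if (n <= m)%N then str f n m else str f m n.

Lemma green0r m : green m 0 = 0.
Proof. exact: str0. Qed.

Lemma green_ge m n : (m <= n)%N -> green m n = str f m n.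
Proof.
by rewrite /green leq_eqVlt => /orP[/eqP->|]; [rewrite leqnn | rewrite ltnNge => /negPf->].
Qed.

Lemma green_le m n : (n <= m)%N -> green m n = str f n m.
Proof. by rewrite /green => ->. Qed.
End Green.

Lemma str_shift (V : zmodType) (f : int -> V) c n i :
  str (fun l => f (l + c)) n i = str f n (i + c).
Proof. by apply: eq_bigr => j _; congr f; lia. Qed.

Lemma strD (V : zmodType) (f g : int -> V) n i :
  str (fun l => f l + g l) n i = str f n i + str g n i.
Proof. exact: big_split. Qed.

(** Below m and above m this is the recurrence for strings, in the length or in the
    center; at n = m the two regimes differ by the lowest term, f 0. *)
Lemma green_rec (V : zmodType) (f : int -> V) m k :
  green f m k.+2 + green f m k + (if m == k.+1 then f 0 else 0)
  = green (fun l => f (l + 1) + f (l - 1)) m k.+1.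
Proof.
have [mk|km|mk] := ltngtP m k.+1.
- rewrite !green_ge ?(leq_trans _ mk) //; try lia.
  rewrite strD !str_shift addr0; congr (str _ _ _ + str _ _ _); lia.
- rewrite !green_le; try lia.
  by rewrite strD !str_shift str_rec addr0.
rewrite mk green_ge // !green_le // strD !str_shift str_rec addrAC; congr (_ + _).
rewrite [RHS]/str big_ord_recl addrC; congr (_ + _); first by congr f; rewrite /=; lia.
by apply: eq_bigr => j _; congr f; rewrite /= /bump leq0n; lia.
Qed.

Lemma series_scaleD a b f n :
  series_scale (a + b) f n = series_scale a f n + series_scale b f n.
Proof. exact: (linearD (linext (fun k => f (n - k) : int^o)) a b). Qed.

Lemma series_scaleN a f n : series_scale (- a) f n = - series_scale a f n.
Proof. exact: (linearN (linext (fun k => f (n - k) : int^o)) a). Qed.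

Lemma series_scaleZ (c : int) a f n : series_scale (c *: a) f n = c * series_scale a f n.
Proof. exact: (linearZ_LR (linext (fun k => f (n - k) : int^o)) c a). Qed.

Lemma series_scale0 f n : series_scale 0 f n = 0.
Proof. exact: (linear0 (linext (fun k => f (n - k) : int^o))). Qed.

Lemma series_scale_vpow k f n : series_scale (vpow k) f n = f (n - k).
Proof. exact: (linextU (fun k => f (n - k) : int^o) k). Qed.

Lemma series_scale1 f n : series_scale 1 f n = f n.
Proof. by rewrite -vpow0 series_scale_vpow subr0. Qed.

(** The terms cancel in pairs, except the last one. *)
Lemma oddz_sum_last (V : zmodType) (f : nat -> V) n : f 0%N = 0 ->
  \sum_(k < n.+1) oddz f (1%:Z - n.+1%:Z + 1 + 2 * k%:Z) = f n.+1.
Proof.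
move=> f0; rewrite big_ord_recr /= [X in X + _](_ : _ = 0) ?add0r.
  by rewrite (_ : _ + _ = n.+1%:Z) //; lia.
by rewrite -[RHS](oddz_sum0 n f0); apply: eq_bigr => k _; congr oddz; lia.
Qed.

Lemma oddz_sum_last2 (V : zmodType) (f : nat -> V) n : f 0%N = 0 ->
  \sum_(k < n.+1) (oddz f (1%:Z - n.+1%:Z + 2 * k%:Z + 2) + oddz f (1%:Z - n.+1%:Z + 2 * k%:Z))
  = f n.+2 + f n.
Proof.
move=> f0; rewrite big_split /= oddz_sum0 // addr0 big_ord_recr /= addrC.
rewrite (_ : 1%:Z - n.+1%:Z + 2 * n%:Z + 2 = n.+2%:Z); last by lia.
congr (_ + _); case: n => [|n]; first by rewrite big_ord0 f0.
by rewrite -[RHS](oddz_sum_last n f0); apply: eq_bigr => k _; congr oddz; lia.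
Qed.

Lemma phicoef_alt b n z : z != 1%g -> phicoef (alt b n.+1) z =
  - (vpow 1 + vpow (- 1)) * (nzbas laurent b n.+1)@_z
  + ((nzbas laurent b n.+2)@_z + (nzbas laurent b n)@_z).
Proof.
move=> z1; rewrite /phicoef /dinvol !big_cons big_nil /afun z1 eqxx.
rewrite !sgen_alt !alt_neq1 !hstrE /hcoord.
rewrite (oddz_sum_last _ (erefl _)) (oddz_sum_last2 _ (erefl _)).
case: (b (+) _) => /=; rewrite mcoeffZ mcoeffD addr0 //.
by rewrite addrC.
Qed.

Lemma phicoef1 x : phicoef x 1%g = (x == 1%g)%:R.
Proof.
rewrite /phicoef /dinvol !big_cons big_nil /afun !sgen_alt !alt_neq1 eqxx /=.
by rewrite hstr1r addr0 eq_sym.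
Qed.

Lemma phicoef_one z : z != 1%g ->
  phicoef 1%g z = (z == sgen false)%:R + (z == sgen true)%:R.
Proof.
move=> z1; rewrite /phicoef /dinvol !big_cons big_nil /afun !sgen_alt z1 eqxx !alt_neq1.
by rewrite !hstr1l addr0.
Qed.

Lemma nzbas_coef b n a k : (nzbas laurent b n)@_(alt a k.+1) = ((n == k.+1) && (b == a))%:R.
Proof.
case: n => [|n]; first by rewrite mcoeff0.
by rewrite mcoeffU alt_eq orbF.
Qed.

Lemma phicoefE b n a k : phicoef (alt b n) (alt a k.+1) =
  - (vpow 1 + vpow (- 1)) * ((n == k.+1) && (b == a))%:R
  + ((n.+1 == k.+1) && ((b == a) || (n == 0)%N))%:R + ((n.-1 == k.+1) && (b == a))%:R.
Proof.
case: n => [|n].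
  rewrite alt0 phicoef_one ?alt_neq1 // mulr0 add0r addr0.
  rewrite !sgen_alt !alt_eq.
  by case: a; case: k => [|k] /=; rewrite ?orbT ?addr0 ?add0r.
by rewrite phicoef_alt ?alt_neq1 // !nzbas_coef orbF addrA.
Qed.

(** With the convention alt a 0 = 1, the transpose of phi is the Chebyshev
    recurrence without boundary terms. *)
Lemma phihat_alt b a k n : phihat b (alt a k.+1) n =
  b (alt a k) n + b (alt a k.+2) n - (b (alt a k.+1) (n - 1) + b (alt a k.+1) (n + 1)).
Proof.
rewrite /phihat (@fsumT_seq _ _ [:: alt a k; alt a k.+1; alt a k.+2]).
- rewrite !big_cons big_nil !phicoefE !eqxx !eqSS /=.
  have -> : (k == k.+1) = false by lia.
  have -> : (k.-1 == k.+1) = false by lia.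
  have -> : (k.+2 == k) = false by lia.
  have -> : (k.+1 == k) = false by lia.
  rewrite /= !mulr0 !mulr1 !add0r !addr0 !series_scale1 series_scaleN series_scaleD.
  rewrite !series_scale_vpow opprK.
  ring.
- rewrite /= !inE !alt_eq; lia.
- move=> x; rewrite (weyl_alt x); move: (head _ _) (len x) => b' m.
  rewrite !inE !alt_eq => xn; rewrite phicoefE.
  have -> : (m == k.+1) && (b' == a) = false by lia.
  have -> : (m.+1 == k.+1) && ((b' == a) || (m == 0)%N) = false by lia.
  have -> : (m.-1 == k.+1) && (b' == a) = false by lia.
  by rewrite mulr0 !addr0 series_scale0.
Qed.

Lemma phihat_1 b n : phihat b 1%g n = b 1%g n.
Proof.
rewrite /phihat (@fsumT_seq _ _ [:: 1%g]) // => [|x].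
  by rewrite big_seq1 phicoef1 eqxx series_scale1.
by rewrite inE phicoef1 => /negPf->; rewrite series_scale0.
Qed.

(** Applied to a string of exponents, this extracts the coefficient of v^p from the
    corresponding sum of powers of v. *)
Definition dser (p : int) (l : int) : int := (l == p)%:R.

Lemma str_dser0 p n i : p < i - n%:Z + 1 -> str (dser p) n i = 0.
Proof.
by move=> pi; apply: big1 => j _; rewrite /dser; case: eqP => // e; exfalso; lia.
Qed.

Lemma green_dser0 p m n : p <= `|n%:Z - m%:Z| -> green (dser p) m n = 0.
Proof. by move=> pn; rewrite /green; case: leqP => nm; apply: str_dser0; lia. Qed.

Lemma green_dser_rec m k p :
  green (dser p) m k.+2 + green (dser p) m k + ((m == k.+1) && (p == 0))%:R
  = green (dser (p - 1)) m k.+1 + green (dser (p + 1)) m k.+1.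
Proof.
have -> : ((m == k.+1) && (p == 0))%:R = if m == k.+1 then dser p 0 else 0.
  by case: eqP => // _; rewrite /dser eq_sym.
rewrite green_rec /green; case: ifP => _;
  rewrite strD; congr (_ + _); apply: eq_bigr => j _; rewrite /dser; congr (_%:R); lia.
Qed.

(** The candidate for phi^-1(t_w), for w of length m > 0 starting with a. *)
Definition phisol1 a m (x : weyl) : series := fun p =>
  if head false x == a then - green (dser p) m (len x) else 0.

(** For w = 1 the recurrence has the unit 1 as its term of index 0, which creates
    sources at s_0 and s_1. *)
Definition phisol (w : weyl) (x : weyl) : series := fun p =>
  if w == 1%g then dser p 0 *+ (x == 1%g) - phisol1 false 1 x p - phisol1 true 1 x p
  else phisol1 (head false w) (len w) x p.

Lemma phisol1_alt a m b n p :
  phisol1 a m (alt b n) p = if b == a then - green (dser p) m n else 0.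
Proof.
rewrite /phisol1 len_alt; case: n => [|n] //=.
by rewrite green0r oppr0 !if_same.
Qed.

Lemma phisol1_one a m p : phisol1 a m 1%g p = 0.
Proof. by rewrite -(alt0 a) phisol1_alt green0r oppr0 if_same. Qed.

Lemma phisol1_0 a m x p : p <= `|(len x)%:Z - m%:Z| -> phisol1 a m x p = 0.
Proof. by move=> px; rewrite /phisol1 green_dser0 // oppr0 if_same. Qed.

Lemma phisol1_rec a m b k p :
  phisol1 a m (alt b k) p + phisol1 a m (alt b k.+2) p
  - (phisol1 a m (alt b k.+1) (p - 1) + phisol1 a m (alt b k.+1) (p + 1))
  = (alt b k.+1 == alt a m)%:R * (p == 0)%:R.
Proof.
rewrite !phisol1_alt alt_eq orbF -natrM mulnb.
case: eqP => _; last by rewrite andbF !addr0.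
rewrite andbT; have := green_dser_rec m k p; rewrite eq_sym.
by set c := ((k.+1 == m) && _)%:R => e; lia.
Qed.

Lemma phisol_1 w p : phisol w 1%g p = ((1%g == w) && (p == 0))%:R.
Proof.
rewrite /phisol eqxx !phisol1_one eq_sym; case: (_ == w) => //=.
by rewrite !subr0 /dser eq_sym.
Qed.

Lemma phisol_rec w a k p :
  phisol w (alt a k) p + phisol w (alt a k.+2) p
  - (phisol w (alt a k.+1) (p - 1) + phisol w (alt a k.+1) (p + 1))
  = ((alt a k.+1 == w) && (p == 0))%:R.
Proof.
rewrite /phisol; case: eqP => [->|_]; last first.
  by rewrite [X in _ == X]weyl_alt -mulnb natrM -phisol1_rec.
rewrite !(negPf (alt_neq1 _ _)) !mulr0n /=.
have h b := phisol1_rec b 1 a k p.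
have -> : dser p 0 *+ (alt a k == 1%g) = (alt a k.+1 == alt false 1)%:R * (p == 0)%:R
    + (alt a k.+1 == alt true 1)%:R * (p == 0)%:R.
  rewrite -(alt0 a) !alt_eq /dser eq_sym.
  by case: a {h} k => [] [|k] /=; case: (p == 0); rewrite ?orbT.
rewrite -!h; ring.
Qed.

(** The lowest exponent in the coefficient of C_x grows with the length of x. *)
Lemma calH_phisol w : calH (phisol w).
Proof.
have L x p N : p < N%:Z -> (N + len w + 2 <= len x)%N -> phisol w x p = 0.
  move=> pN lx; rewrite /phisol; case: ifP => _; last by rewrite phisol1_0 //; lia.
  have -> : (x == 1%g) = false by apply/eqP => x1; move: lx; rewrite x1 /len /=; lia.
  by rewrite !phisol1_0 ?mulr0n ?subr0 //; lia.
split=> [x|N N0]; last by exists (N + len w + 2)%N => x lx n nN; apply: L lx.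
exists 0 => n n0; rewrite /phisol.
rewrite !phisol1_0; try lia.
rewrite (_ : dser n 0 = 0) ?mul0rn ?subr0 ?if_same // /dser.
by case: eqP => // e; exfalso; lia.
Qed.

Lemma phihat_phisol w : phihat (phisol w) = (fun z n => ((z == w) && (n == 0))%:R).
Proof.
apply/funext => z; apply/funext => n; rewrite (weyl_alt z).
by case: (len z) => [|k]; rewrite ?alt0 ?phihat_1 ?phisol_1 // phihat_alt phisol_rec.
Qed.

(** A family that starts from 0 and satisfies the recurrence without source is
    determined by its first term, whose lowest coefficient moves to lower and lower
    degrees; membership in calH forbids this. *)
Lemma phihat_inj0 (d : weyl -> series) : calH d ->
  (forall p, d 1%g p = 0) ->
  (forall a k p, d (alt a k) p + d (alt a k.+2) p
     = d (alt a k.+1) (p - 1) + d (alt a k.+1) (p + 1)) ->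
  forall x p, d x p = 0.
Proof.
move=> [dlow dhigh] d1 drec.
have first a p : d (alt a 1) p = 0.
  have [m dm] := dlow (alt a 1).
  have step r : (forall s, s < r -> d (alt a 1) s = 0) -> d (alt a 1) r = 0.
    move=> lowr.
    (* From n to n + 1 the lowest possible exponent decreases by one, and its
       coefficient is preserved. *)
    have key n : d (alt a n.+1) (r - n%:Z) = d (alt a 1) r /\
        (forall s, s < r - n%:Z -> d (alt a n.+1) s = 0)
        /\ (forall s, s < r - n%:Z + 1 -> d (alt a n) s = 0).
      elim: n => [|n [IH1 [IH2 IH3]]].
        by rewrite subr0; split=> //; split=> // s _; rewrite alt0.
      have e s : d (alt a n.+2) s = d (alt a n.+1) (s - 1) + d (alt a n.+1) (s + 1) - d (alt a n) s.
        by rewrite -drec addrC addKr.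
      split; last split.
      - rewrite e IH2 ?IH3 ?add0r ?subr0; try lia.
        by rewrite -IH1; congr (d _ _); lia.
      - by move=> s sr; rewrite e !IH2 ?IH3 ?addr0 ?subr0 //; lia.
      - by move=> s sr; apply: IH2; lia.
    have [L dL] := dhigh 1%N isT.
    pose n := (L + `|r|)%N.
    have [<- _] := key n; apply: (dL (alt a n.+1)); rewrite ?len_alt /n; lia.
  have all j s : s < m + Posz j -> d (alt a 1) s = 0.
    elim: j s => [|j IHj] s sj; first by apply: dm; lia.
    by apply: step => t ts; apply: IHj; lia.
  by apply: (all (`|p| + `|m| + 1)%N); lia.
have pairs a n : (forall p, d (alt a n) p = 0) /\ (forall p, d (alt a n.+1) p = 0).
  elim: n => [|n [IH1 IH2]]; first by split=> p; rewrite ?alt0.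
  split=> // p; have := drec a n p; rewrite IH1 !IH2; lia.
by move=> x p; rewrite (weyl_alt x); have [-> _] := pairs (head false x) (len x).
Qed.

(** The difference of two preimages satisfies the recurrence without source. *)
Lemma phihat_inv_tE w : phihat_inv_t w = phisol w.
Proof.
apply: xget_unique => [|b [bH be]]; first by split; [apply: calH_phisol | apply: phihat_phisol].
have [[sl sh] [bl bh]] := (calH_phisol w, bH).
have e : phihat b = phihat (phisol w) by rewrite phihat_phisol.
apply/funext => x; apply/funext => p; apply/eqP; rewrite -subr_eq0; apply/eqP.
apply: (@phihat_inj0 (fun x p => b x p - phisol w x p)) => {x p} [|p|a k p].
- split=> [x|N N0].
    have [[m1 h1] [m2 h2]] := (sl x, bl x).
    exists (Num.min m1 m2) => n; rewrite lt_min => /andP[n1 n2].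
    by rewrite h1 // h2 // subr0.
  have [[L1 h1] [L2 h2]] := (sh N N0, bh N N0).
  exists (maxn L1 L2) => x; rewrite geq_max => /andP[x1 x2] n nN.
  by rewrite h1 // h2 // subr0.
- by rewrite -phihat_1 e phihat_1 subrr.
have := congr1 (fun f => f (alt a k.+1) p) e; rewrite !phihat_alt; lia.
Qed.

(** * Values of rational functions given by expansions *)
Lemma series_scaleB_r a (f g : series) n :
  series_scale a (fun n => f n - g n) n = series_scale a f n - series_scale a g n.
Proof. by rewrite /series_scale -sumrB; apply: eq_bigr => k _; rewrite mulrBr. Qed.

Lemma laurent_scalel (c : int) (a b : laurent) : (c *: a) * b = c *: (a * b).
Proof.
by rewrite -[LHS]/(laurent_mul _ _) -[c *: a]addr0 laurent_mulPl laurent_mul0l addr0.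
Qed.

Lemma series_scaleM a b f n :
  series_scale (a * b) f n = series_scale a (series_scale b f) n.
Proof.
elim/laurent_ind: a n => [|k|c a1 a2 IH1 IH2] n.
- by rewrite mul0r !series_scale0.
- rewrite mulrC; elim/laurent_ind: b n => [|l|c b1 b2 IH1 IH2] n.
  + by rewrite mul0r series_scale_vpow !series_scale0.
  + by rewrite -vpowD !series_scale_vpow; congr f; lia.
  + rewrite mulrDl laurent_scalel series_scaleD series_scaleZ IH1 IH2 !series_scale_vpow.
    by rewrite series_scaleD series_scaleZ.
- rewrite mulrDl laurent_scalel !series_scaleD !series_scaleZ IH1 IH2 //.
Qed.

Lemma series_scale_fin (a b : laurent) n :
  series_scale a (fun n => b@_n) n = (a * b)@_n.
Proof.
elim/laurent_ind: a n => [|k|c a1 a2 IH1 IH2] n.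
- by rewrite mul0r series_scale0 mcoeff0.
- rewrite series_scale_vpow mulrC; elim/laurent_ind: b => [|l|c b1 b2 IH1 IH2].
  + by rewrite mul0r !mcoeff0.
  + by rewrite -vpowD !mcoeff_vpow; congr (_%:R); lia.
  + by rewrite mulrDl laurent_scalel !mcoeffD !mcoeffZ IH1 IH2.
- by rewrite mulrDl laurent_scalel series_scaleD series_scaleZ IH1 IH2 mcoeffD mcoeffZ.
Qed.

Section Rational.
Variables (R : realType) (v : R).
Hypothesis v0 : v != 0.
Local Notation eval := (laurent_eval v).

Fact evalE a : eval a = linext (V := zmodule R) (fun k => v ^ k) a.
Proof. by apply: eq_bigr => k _; rewrite mulrzl. Qed.

Lemma evalD a b : eval (a + b) = eval a + eval b.
Proof. by rewrite !evalE; apply: (linearD (linext (V := zmodule R) (fun k => v ^ k))). Qed.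

Lemma evalZ (c : int) a : eval (c *: a) = eval a *~ c.
Proof. by rewrite !evalE; apply: (linearZ_LR (linext (V := zmodule R) (fun k => v ^ k))). Qed.

Lemma eval0 : eval 0 = 0.
Proof. by rewrite evalE; apply: (linear0 (linext (V := zmodule R) (fun k => v ^ k))). Qed.

Lemma eval_vpow k : eval (vpow k) = v ^ k.
Proof. by rewrite evalE; apply: (@linextU _ int (zmodule R)). Qed.

Lemma evalN a : eval (- a) = - eval a.
Proof. by rewrite !evalE; apply: (linearN (linext (V := zmodule R) (fun k => v ^ k))). Qed.

Lemma evalM a b : eval (a * b) = eval a * eval b.
Proof.
elim/laurent_ind: a => [|k|c a1 a2 IH1 IH2].
- by rewrite mul0r eval0 mul0r.
- rewrite mulrC; elim/laurent_ind: b => [|l|c b1 b2 IH1 IH2].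
  + by rewrite mul0r eval0 mulr0.
  + by rewrite -vpowD !eval_vpow mulrC expfzDr.
  + by rewrite mulrDl laurent_scalel !evalD !evalZ IH1 IH2 mulrDr mulrzAr.
- by rewrite mulrDl laurent_scalel !evalD !evalZ IH1 IH2 mulrDl mulrzAl.
Qed.

Fact eval_is_zmod_morphism : zmod_morphism eval.
Proof. by move=> a b; rewrite evalD evalN. Qed.
HB.instance Definition _ := GRing.isZmodMorphism.Build laurent R eval eval_is_zmod_morphism.

Definition expands (f : series) (r : R) : Prop := exists P Q : laurent,
  [/\ series_scale Q f = (fun n => P@_n), eval Q != 0 & r = eval P / eval Q].

(** Two fractions with the same expansion are equal, since multiplication by a
    Laurent polynomial is compatible with expansions. *)
Lemma ratvalE f r : expands f r -> ratval v f = r.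
Proof.
move=> e; rewrite /ratval; apply: xget_unique => [|r' [P' [Q' [f' Q0' ->]]]]; first exact: e.
have [P [Q [fE Q0 ->]]] := e.
have e1 : Q' * P = Q * P'.
  apply/malgP => n; rewrite -!series_scale_fin -fE -f'.
  by rewrite -!series_scaleM mulrC.
have := congr1 eval e1; rewrite !evalM => {}e1.
apply/eqP; rewrite eqr_div //; apply/eqP.
by rewrite mulrC -e1 mulrC.
Qed.

Lemma expandsB f r g t : expands f r -> expands g t ->
  expands (fun n => f n - g n) (r - t).
Proof.
move=> [P [Q [fE Q0 ->]]] [P' [Q' [gE Q0' ->]]].
exists (Q' * P - Q * P'), (Q' * Q); split.
- apply/funext => n; rewrite series_scaleB_r {1}series_scaleM fE [Q' * Q]mulrC.
  by rewrite series_scaleM gE !series_scale_fin mcoeffB.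
- by rewrite evalM mulf_neq0.
rewrite evalD evalN !evalM mulrBl; congr (_ - _).
  by rewrite -mulf_div divff // mul1r.
by rewrite [eval Q' * _]mulrC -mulf_div divff // mul1r.
Qed.

Lemma expands_fin (P : laurent) : expands (fun n => P@_n) (eval P).
Proof.
exists P, 1; split.
- by apply/funext => n; rewrite series_scale1.
- by rewrite -vpow0 eval_vpow expr0z oner_neq0.
- by rewrite -vpow0 eval_vpow expr0z divr1.
Qed.
End Rational.

(** * The coefficients b_(w,x) *)
(** The threshold for x <= [alt a N], among the positive N. *)
Definition start a (x : weyl) : nat := if head false x == a then len x else (len x).+1.

Lemma bruhat_start a x N : (0 < N)%N -> bruhat x (alt a N) <-> (start a x <= N)%N.
Proof.
move=> N0; rewrite bruhatE len_alt {1}(weyl_alt x) /start.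
split.
  case=> [/alt_inj[-> e]|]; last by case: ifP => // _; apply: ltnW.
  by rewrite -e ?eqxx //; case: (len x) {e}.
case: ifP => [/eqP->|]; last by right.
by rewrite leq_eqVlt => /orP[/eqP->|]; [left|right].
Qed.

(** The contribution of C'_y to the coefficient of T_x. *)
Definition bterm (b : weyl -> series) x n y : int :=
  series_scale ((KLC' y)@_x) (jhat b y) n.

Lemma btermE b x n y : bterm b x n y =
  if `[< bruhat x y >] then (-1) ^+ len y * b y (- n - (len y)%:Z) else 0.
Proof.
rewrite /bterm KLC'_coef; case: ifP => _; last exact: series_scale0.
by rewrite series_scale_vpow /jhat opprK opprD.
Qed.

(** The contribution of C'_y, for y of length N, to the coefficient of any T_x
    with x <= y in the expansion of a basis element of length m. *)
Definition tlau m N : laurent :=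
  green (fun l => vpow (- l - N%:Z)) m N *~ (-1) ^+ N.+1.

Lemma raddf_green (V W : zmodType) (g : {additive V -> W}) f m n :
  g (green f m n) = green (fun l => g (f l)) m n.
Proof. by rewrite /green; case: ifP => _; apply: raddf_sum. Qed.

Lemma mulr_green (A : pzRingType) c (f : int -> A) m n :
  c * green f m n = green (fun l => c * f l) m n.
Proof. by rewrite /green; case: ifP => _; apply: mulr_sumr. Qed.

Lemma eq_green (V : zmodType) (f g : int -> V) m n : f =1 g -> green f m n = green g m n.
Proof. by move=> fg; rewrite /green /str; case: ifP => _; apply: eq_bigr => j _. Qed.

Lemma tlau_coef m N n :
  (tlau m N)@_n = (-1) ^+ N.+1 * green (dser (- n - N%:Z)) m N.
Proof.
rewrite /tlau raddfMz (raddf_green (mcoeff n)) -mulrzl intz; congr (_ * _).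
apply: eq_green => l.
by rewrite /= mcoeff_vpow /dser; congr (_%:R); lia.
Qed.

Lemma tlau_coef0 m N n : (`|n| <= N)%N -> (tlau m N)@_n = 0.
Proof. by move=> nN; rewrite tlau_coef green_dser0 ?mulr0 //; lia. Qed.

Fact green_exp_ge (A : comNzRingType) (p : int -> A) m N :
  (forall k l, p (k + l) = p k * p l) -> (m <= N)%N ->
  green (fun l => p (- l - N.+1%:Z)) m N.+1 *~ (-1) ^+ N.+2 =
  - (p (- 2) * (green (fun l => p (- l - N%:Z)) m N *~ (-1) ^+ N.+1)).
Proof.
move=> pD mN; rewrite exprS mulN1r mulrNz mulrzAr; congr (- (_ *~ _)).
rewrite mulr_green !green_ge ?leqW //; apply: eq_bigr => j _.
by rewrite -pD; congr p; lia.
Qed.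

Lemma tlau_ge m N : (m <= N)%N -> tlau m N.+1 = - (vpow (- 2) * tlau m N).
Proof. exact: green_exp_ge vpowD. Qed.

(** The sum of the [tlau m N] over N >= s: those with N >= |n| have no term of
    degree n. *)
Definition bser m s : series := fun n => \sum_(N < `|n|%N | (s <= N)%N) (tlau m N)@_n.

Lemma bserE m s n M : (`|n| <= M)%N ->
  bser m s n = \sum_(N < M | (s <= N)%N) (tlau m N)@_n.
Proof.
move=> nM; rewrite /bser -(big_mkord (fun N => s <= N)%N (fun N => (tlau m N)@_n)).
rewrite -(big_mkord (fun N => s <= N)%N (fun N => (tlau m N)@_n)).
rewrite [RHS](@big_cat_nat _ _ _ `|n|%N) //= [X in _ = _ + X]big1_seq ?addr0 // => N.
by rewrite mem_index_iota => /andP[_ /andP[nN _]]; apply: tlau_coef0.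
Qed.

Lemma bser_nat m s n M : (`|n| <= M)%N ->
  bser m s n = \sum_(s <= N < M) (tlau m N)@_n.
Proof. by move=> nM; rewrite (bserE _ _ nM) (@big_nat_widenl _ _ _ s 0) // big_mkord. Qed.

Lemma bterm_alt a m x n b N : bterm (phisol1 a m) x n (alt b N) =
  if (start a x <= N)%N && (b == a) then (tlau m N)@_n else 0.
Proof.
rewrite btermE phisol1_alt len_alt tlau_coef.
case: (b =P a) => [->|_]; last by rewrite andbF mulr0 if_same.
rewrite andbT; case: N => [|N].
  by rewrite !green0r oppr0 !mulr0 !if_same.
rewrite [in RHS]exprS mulN1r mulrN mulNr.
case: asboolP => [/bruhat_start->|xN] //.
by case: ifP => // sN; case: xN; apply/bruhat_start.
Qed.

Lemma bterm0 w x n y : (`|n| < len y)%N -> bterm (phisol w) x n y = 0.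
Proof.
move=> ny; rewrite btermE; case: ifP => // _; rewrite /phisol.
have p (k : int) : - n - (len y)%:Z <= `|(len y)%:Z - k| by lia.
case: ifP => _; last by rewrite phisol1_0 ?mulr0.
have -> : (y == 1%g) = false by apply/eqP => y1; move: ny; rewrite y1.
by rewrite !phisol1_0 // mulr0n subr0 mulr0.
Qed.

(** Among the C'_y, only those whose first letter is a contribute, and y >= x is a
    condition on the length of y. *)
Lemma sum_bterm1 a m x n :
  \sum_(y <- below true `|n|.+1) bterm (phisol1 a m) x n y = bser m (start a x) n.
Proof.
rewrite big_cat !big_map !big_iota0 /=.
have z : (tlau m 0)@_n = 0 by rewrite tlau_coef green0r mulr0.
case: a.
  rewrite big1 ?add0r => [|j _]; last by rewrite bterm_alt andbF.
  rewrite (@bserE _ _ _ `|n|.+2) ?leqW // [RHS]big_mkcond [RHS]big_ord_recl.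
  rewrite [X in _ = X + _](_ : _ = 0) ?add0r; last by case: ifP => // _; apply: z.
  by apply: eq_bigr => j _; rewrite bterm_alt andbT.
rewrite [X in _ + X]big1 ?addr0 => [|j _]; last by rewrite bterm_alt andbF.
rewrite (@bserE _ _ _ `|n|.+1) // [RHS]big_mkcond /=.
by apply: eq_bigr => j _; rewrite bterm_alt andbT.
Qed.

Lemma bcoef_sum w x n : bcoef w x n = \sum_(y <- below true `|n|.+1) bterm (phisol w) x n y.
Proof.
rewrite /bcoef phihat_inv_tE.
rewrite (@fsumT_seq _ _ (below true `|n|.+1)) ?below_uniq // => y.
by rewrite mem_below negb_or -leqNgt => /andP[_ ny]; apply: bterm0.
Qed.

Lemma bcoef_alt a m x : bcoef (alt a m.+1) x = bser m.+1 (start a x).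
Proof.
apply/funext => n; rewrite bcoef_sum -sum_bterm1; apply: eq_bigr => y _.
by rewrite !btermE /phisol (negPf (alt_neq1 _ _)) len_alt.
Qed.

Lemma bcoef_1 x : bcoef 1%g x =
  (fun n => ((x == 1%g)%:R : laurent)@_n - bser 1 (start false x) n - bser 1 (start true x) n).
Proof.
apply/funext => n; rewrite bcoef_sum -!sum_bterm1.
pose D (y : weyl) : int := if `[< bruhat x y >] then dser (- n) 0 *+ (y == 1%g) else 0.
have -> : ((x == 1%g)%:R : laurent)@_n = \sum_(y <- below true `|n|.+1) D y.
  have m1 : 1%g \in below true `|n|.+1 by rewrite mem_below orbT.
  rewrite (bigD1_seq 1%g) ?below_uniq //= big1 => [|y /negPf y1]; last first.
    by rewrite /D y1 if_same.
  rewrite addr0 /D eqxx mulr1n.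
  have -> : `[< bruhat x 1%g >] = (x == 1%g).
    by apply/asboolP/eqP => [/bruhatE[]|->] //; exact: bruhat_refl.
  case: eqP => _; rewrite ?mcoeff0 // -vpow0 mcoeff_vpow /dser; congr (_%:R); lia.
rewrite -!sumrB; apply: eq_bigr => y _; rewrite /D !btermE /phisol eqxx.
case: ifP => _; last by rewrite !subr0.
rewrite !mulrBr; congr (_ - _ - _).
case: (y =P 1%g) => [->|_]; last by rewrite mulr0.
by rewrite expr0 mul1r subr0.
Qed.

Section Bvalue.
Variables (R : realType) (v : R).
Hypothesis v1 : 1 < v.
Let v_gt0 : 0 < v. Proof. exact: lt_trans v1. Qed.
Let v0 : v != 0. Proof. exact: lt0r_neq0. Qed.

(** The solution of the Chebyshev recurrence that is small at infinity, at 1/v. *)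
Definition beta m N : R := green (fun l => v ^ (- l)) m N.

Definition bdiff m N : R := (-1) ^+ N.+1 * v ^- N * beta m N.

(** The sum of the [bdiff m N] over N >= s, which is a geometric series of ratio
    - v^-2 from N = m on. *)
Definition bval m s : R :=
  \sum_(s <= N < maxn s m) bdiff m N + bdiff m (maxn s m) / (1 + v ^- 2).

Lemma eval_tlau m N : laurent_eval v (tlau m N) = bdiff m N.
Proof.
rewrite /tlau raddfMz raddf_green /bdiff /beta.
rewrite -mulrzl -mulrA; congr (_ * _); first by rewrite rmorphXn rmorphN1.
rewrite mulr_green; apply: eq_green => l.
by rewrite /= eval_vpow // expfzDr // mulrC exprnN.
Qed.

Lemma bdiff_ge m N : (m <= N)%N -> bdiff m N.+1 = - (v ^- 2 * bdiff m N).
Proof.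
by move=> mN; rewrite -!eval_tlau tlau_ge // evalN evalM // eval_vpow // exprnN.
Qed.

Lemma sqv_neq0 : 1 + v ^- 2 != 0.
Proof. by rewrite lt0r_neq0 // addr_gt0 // invr_gt0 exprn_gt0. Qed.

Lemma bvalB m s : bval m s - bval m s.+1 = bdiff m s.
Proof.
rewrite /bval; have [sm|ms] := ltnP s m.
  rewrite (maxn_idPr sm) big_ltn //.
  by rewrite opprD addrACA subrr addr0 addrK.
rewrite (maxn_idPl (leqW ms)) !big_geq // !add0r bdiff_ge //.
by rewrite mulNr opprK -mulrDl -[X in X + _]mul1r -mulrDl mulrAC divff ?mul1r // sqv_neq0.
Qed.

(** Multiplication by 1 + v^-2 telescopes the series, except for finitely many
    terms. *)
Lemma expands_bser m s : expands v (bser m s) (bval m s).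
Proof.
pose M0 := maxn s m.
pose S : laurent := \sum_(s <= N < M0) tlau m N.
exists ((1 + vpow (- 2)) * S + tlau m M0), (1 + vpow (- 2)); split; last 2 first.
- by rewrite evalD -vpow0 !eval_vpow // expr0z -exprnN sqv_neq0.
- rewrite evalD evalM // evalD -vpow0 !eval_vpow // expr0z -exprnN.
  rewrite mulrDl mulrAC divff ?sqv_neq0 // mul1r eval_tlau; congr (_ + _).
  by rewrite /S raddf_sum; apply: eq_bigr => N _; apply: esym (eval_tlau _ _).
apply/funext => n.
pose M := (M0 + `|n|%N + `|(n + 2)%R|%N)%N.
rewrite series_scaleD series_scale1 series_scale_vpow opprK.
rewrite !(@bser_nat _ _ _ M); try by rewrite /M; lia.
have tel K : (M0 <= K)%N ->
    (1 + vpow (- 2)) * \sum_(M0 <= N < K) tlau m N = tlau m M0 - tlau m K.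
  move=> MK; transitivity (\sum_(M0 <= N < K) (- tlau m N.+1 - - tlau m N)).
    rewrite mulr_sumr; apply: eq_big_nat => N /andP[MN _].
    by rewrite tlau_ge ?opprK ?mulrDl ?mul1r 1?addrC // (leq_trans _ MN) // leq_maxr.
  by rewrite telescope_sumr // opprK addrC.
have sM0 : (s <= M0)%N by exact: leq_maxl.
have M0M : (M0 <= M)%N by rewrite /M; lia.
have cE k : \sum_(s <= N < M) (tlau m N)@_k = (\sum_(s <= N < M) tlau m N)@_k.
  by rewrite mcoeff_sum.
have dE a : a@_(n + 2) = (vpow (- 2) * a)@_n.
  by rewrite -series_scale_fin series_scale_vpow opprK.
rewrite !cE dE -mcoeffD.
have -> : \sum_(s <= N < M) tlau m N + vpow (- 2) * \sum_(s <= N < M) tlau m N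
    = (1 + vpow (- 2)) * \sum_(s <= N < M) tlau m N by rewrite mulrDl mul1r.
rewrite (big_cat_nat sM0 M0M) /= mulrDr tel // addrA mcoeffB.
by rewrite [(tlau m M)@_n]tlau_coef0 ?subr0 // /M; lia.
Qed.
End Bvalue.

(** * Decay of the coefficients *)
Section Bestimates.
Variables (R : realType) (v : R).
Hypothesis v1 : 1 < v.
Let v_gt0 : 0 < v. Proof. exact: lt_trans v1. Qed.
Let v0 : v != 0. Proof. exact: lt0r_neq0. Qed.
Local Notation beta := (beta v).
Local Notation bdiff := (bdiff v).
Local Notation bval := (bval v).

Lemma beta_rec m k : beta m k.+2 + beta m k + (m == k.+1)%:R = (v + v^-1) * beta m k.+1.
Proof.
have -> : (m == k.+1)%:R = if m == k.+1 then v ^ (- (0 : int)) else 0.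
  by rewrite oppr0 expr0z; case: eqP.
rewrite /beta (green_rec (fun l => v ^ (- l))) mulr_green; apply: eq_green => l.
rewrite mulrDl addrC; congr (_ + _).
  by rewrite -[X in X * _]expr1z -expfzDr //; congr (v ^ _); lia.
by rewrite -[v^-1]exprN1 -expfzDr //; congr (v ^ _); lia.
Qed.

Lemma beta_ge m N : (m <= N)%N -> beta m N = v ^- N * (v ^+ m * beta m m).
Proof.
move=> mN; rewrite /beta !green_ge // /str !mulr_sumr; apply: eq_bigr => j _.
by rewrite exprnN -[v ^+ m]/(v ^ m) -!expfzDr //; congr (v ^ _); lia.
Qed.

Lemma bval_ge m s : (m <= s)%N -> `|bval m s| <= `|v ^+ m * beta m m| * v ^- (2 * s).
Proof.
move=> ms; rewrite /bval (maxn_idPl ms) big_geq // add0r /bdiff beta_ge //.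
rewrite !normrM normrX normrN1 expr1n mul1r.
have -> : `|v ^- s| = v ^- s by rewrite ger0_norm // invr_ge0 exprn_ge0 // ltW.
have w0 : 0 <= v ^- 2 by rewrite invr_ge0 exprn_ge0 // ltW.
have i1 : `|(1 + v ^- 2)^-1| <= 1.
  have p0 : 0 < 1 + v ^- 2 by rewrite ltr_pwDl.
  by rewrite ger0_norm ?invr_ge0 ?(ltW p0) // invf_le1 // lerDl.
apply: le_trans (ler_wpM2l _ i1) _; first by rewrite !mulr_ge0 ?invr_ge0 ?exprn_ge0 // ltW.
by rewrite mulr1 mulrA mulrC -invfM -exprD mul2n addnn.
Qed.

Lemma bval01 m : bval m 0 = bval m 1.
Proof. by apply/eqP; rewrite -subr_eq0 bvalB // /bdiff /beta green0r mulr0. Qed.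

Lemma beta0 m : beta m 0 = 0. Proof. exact: green0r. Qed.

(** ** The Hecke action on functions of the level *)
Local Notation V := (int -> R^o).
Local Notation q := (v ^+ 2).

(** A vector of level i has q neighbours of type s: if i has the parity of s, one of
    them has level i + 1 and the others have level i; otherwise all have level
    i - 1. *)
Definition Tlev (s : bool) (c : V) : V := fun i =>
  if parz i == s then (q - 1) * c i + c (i + 1) else q * c (i - 1).

Fact Tlev_is_linear s : linear (Tlev s).
Proof.
move=> t c d; apply/funext => i.
rewrite -[RHS]/(t * Tlev s c i + Tlev s d i) /Tlev.
have E j : (t *: c + d) j = t * c j + d j :> R by [].
by rewrite !E; case: ifP => _; ring.
Qed.
HB.instance Definition _ s := GRing.isLinear.Build R V V _ (Tlev s) (Tlev_is_linear s).

Lemma TlevE s c : Tlev s (Tlev s c) = (q - 1) *: Tlev s c + q *: c.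
Proof.
apply/funext => i; rewrite -[RHS]/((q - 1) * Tlev s c i + q * c i) /Tlev.
rewrite parz1 parzB1 addrK subrK; case: (parz i) s => [] [] /=; ring.
Qed.

(** v^j times the indicator function of the vectors of level at least j. *)
Definition psi (j : int) : V := fun k => if j <= k then v ^ j else 0.

Definition Elev s (c : V) : V := v^-1 *: (c + Tlev s c).

(** C'_s takes a weighted mean over each pair of levels {k, k + 1} with k of parity s,
    hence it is a scalar on the functions that are constant on these pairs. *)
Lemma Elev_psi s j : Elev s (psi j) =
  if parz j == s then (v + v^-1) *: psi j else psi (j - 1) + psi (j + 1).
Proof.
have vz k : v ^ (k + 1) = v ^ k * v by rewrite expfzDr.
have vzB k : v ^ (k - 1) = v ^ k / v by rewrite expfzDr // exprN1.
apply/funext => k.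
rewrite -[LHS]/(v^-1 * (psi j k + Tlev s (psi j) k)).
have -> : (if parz j == s then (v + v^-1) *: psi j else psi (j - 1) + psi (j + 1)) k =
    if parz j == s then (v + v^-1) * psi j k else psi (j - 1) k + psi (j + 1) k.
  by case: ifP.
rewrite /Tlev /psi.
have [jk|kj|<-] := ltgtP j k.
- have -> : j <= k + 1 by lia.
  have -> : j <= k - 1 by lia.
  have -> : j - 1 <= k by lia.
  have -> : j + 1 <= k by lia.
  by rewrite vz vzB; case: ifP => _; case: ifP => _; field.
- have [kE|/eqP kN] := eqVneq j (k + 1); last first.
    have -> : (j <= k + 1) = false by lia.
    have -> : (j <= k - 1) = false by lia.
    have -> : (j - 1 <= k) = false by lia.
    have -> : (j + 1 <= k) = false by lia.
    by rewrite !mulr0 addr0 if_same !addr0 mulr0 if_same.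
  rewrite kE parz1 addrK lexx [k + 1 <= k - 1]lt_geF ?mulr0; last by lia.
  rewrite [k + 1 + 1 <= k]lt_geF ?lexx; last by lia.
  by rewrite !add0r addr0 vz; case: (parz k) s => [] [] /=; field.
- have -> : (j + 1 <= j) = false by lia.
  have -> : j <= j + 1 by lia.
  have -> : (j <= j - 1) = false by lia.
  have -> : j - 1 <= j by lia.
  by rewrite vzB mulr0; case: (parz j == s); field.
Qed.

Fact Elev_is_linear s : linear (Elev s).
Proof.
move=> t c d; rewrite /Elev linearP /= addrACA -scalerDr !scalerDr !scalerA.
by rewrite [v^-1 * t]mulrC.
Qed.
HB.instance Definition _ s := GRing.isLinear.Build R V V _ (Elev s) (Elev_is_linear s).

Lemma Elev_str s n i :
  Elev s (Jstr psi (~~ s) n.+1 i) = - (Jstr psi s n.+2 i + Jstr psi s n i).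
Proof.
rewrite /Jstr.
have -> : parz i (+) ~~ s (+) odd n.+1 = parz i (+) s (+) odd n.
  by rewrite /=; case: (parz i) (odd n) s => [] [] [].
have -> : parz i (+) s (+) odd n.+2 = parz i (+) s (+) odd n by rewrite /= negbK.
case: ifP => ip; last by rewrite linear0 addr0 oppr0.
rewrite !exprS !mulN1r !opprK !mulrNz -opprD opprK -mulrzDl -str_rec raddfMz.
congr (_ *~ _).
rewrite /str raddf_sum -big_split; apply: eq_bigr => j _.
rewrite [LHS]Elev_psi; case: ifP => [jp|_]; last by rewrite addrC; congr (psi _ + psi _); lia.
move: jp ip; rewrite !parzD parzN parz2 !parz_nat /= addbF.
by case: (parz i) (odd n) s => [] [] [].
Qed.

Definition Xz a i := oddz (fun n => Jstr psi a n i).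

Lemma Xz_rec s i k : Elev s (Xz (~~ s) i k) = - (Xz s i (k + 1) + Xz s i (k - 1)).
Proof.
pose f (c : V) := - Elev s c.
have := @oddz_rec _ _ f (fun n => Jstr psi (~~ s) n i) (fun n => Jstr psi s n i).
move=> h; apply: oppr_inj; rewrite opprK; apply: (h _ _ _ _ _ k); rewrite ?Jstr0 /f //.
- by rewrite linear0 oppr0.
- by move=> c; rewrite linearN.
- by move=> n; rewrite Elev_str opprK.
Qed.

(** The normalized C'_w, for w of length n starting with a, applied to psi_i. The
    involution j relates it to C_w, so its expression by strings has the shape of
    phi(C_w), up to sign. *)
Definition Clev a n i : V := v ^- n *: Csum Tlev a n (psi i).

Lemma Clev_rec s n i : Elev s (Clev (~~ s) n.+1 i) = Clev s n.+2 i + Clev s n i.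
Proof.
rewrite /Clev linearZ /= /Elev (Csum_neg TlevE) scalerA scalerDr scalerA.
have vn : v ^+ n != 0 by rewrite expf_neq0.
by congr (_ *: _ + _ *: _); rewrite !exprS; field; rewrite ?v0 ?vn.
Qed.

Lemma Clev1 s i : Clev s 1 i = Elev s (psi i).
Proof. by rewrite /Clev Csum1. Qed.

(** Both sides obey the recurrence of [Clev_rec] in n, by [Xz_rec]. *)
Lemma ClevE a n i : (-1) ^+ n.+1 *: Clev a n i =
  (v + v^-1) *: Xz a i n - (Xz a i (n%:Z + 1) + Xz a i (n%:Z - 1)).
Proof.
elim/ltn_ind: n a => -[|[|n]] IHn a.
- rewrite /Clev Csum0 !scaler0 /Xz [oddz _ 0]Jstr0 scaler0 sub0r.
  by rewrite (_ : (0 : int) - 1 = - (0 + 1)) // oddzN ?Jstr0 // subrr oppr0.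
- rewrite Clev1 Elev_psi sqrrN expr1n scale1r.
  have -> : Xz a i (1%:Z - 1) = 0 by exact: Jstr0.
  have -> : Xz a i 1%:Z = Jstr psi a 1 i by [].
  have -> : Xz a i (1%:Z + 1) = Jstr psi a 2 i by [].
  rewrite addr0 /Jstr str1 sqrrN expr1n mulr1z.
  have -> : (-1) ^+ 3 = -1 :> int by [].
  have e : str psi 2 i = psi (i - 1) + psi (i + 1).
    by rewrite /str big_ord_recl big_ord1; congr (psi _ + psi _); rewrite /= ?/bump ?leq0n; lia.
  rewrite e mulrN1z.
  by case: (parz i) a {IHn} => [] [] /=; rewrite ?scaler0 ?subr0 ?sub0r ?opprK.
have -> : (-1) ^+ n.+3 *: Clev a n.+2 i =
    - Elev a ((-1) ^+ n.+2 *: Clev (~~ a) n.+1 i) - (-1) ^+ n.+1 *: Clev a n i.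
  have -> : Clev a n.+2 i = Elev a (Clev (~~ a) n.+1 i) - Clev a n i.
    by rewrite Clev_rec addrK.
  rewrite [Elev a ((-1) ^+ n.+2 *: _)]linearZ /= scalerBr [(-1) ^+ n.+3]exprS mulN1r !scaleNr opprK.
  by congr (_ + _); rewrite [(-1) ^+ n.+2]exprS mulN1r scaleNr.
have EL c (x y z : V) : Elev a (c *: x - (y + z)) = c *: Elev a x - (Elev a y + Elev a z).
  by rewrite linearB linearZ linearD.
rewrite !IHn // EL !Xz_rec.
have -> : n.+1%:Z + 1 = n.+2%:Z by lia.
have -> : n.+1%:Z - 1 = n%:Z by lia.
have -> : n.+2%:Z - 1 = n%:Z + 1 by lia.
move: (Xz a i n.+2) (Xz a i n) (Xz a i (n.+2%:Z + 1)) (Xz a i (n%:Z + 1)) (Xz a i (n%:Z - 1)).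
move=> x2 x0 x3 x1 xm; move: (v + v^-1) => c; apply/funext => k.
transitivity (- (c * - (x2 k + x0 k) - (- (x3 k + x1 k) + - (x1 k + xm k)))
  - (c * x0 k - (x1 k + xm k))); first by [].
by transitivity (c * x2 k - (x3 k + x1 k)); first by ring.
Qed.
End Bestimates.

(** * Convergence on functions of the level *)
Section LevelEstimates.
Variables (R : realType) (v : R).
Hypothesis v1 : 1 < v.
Let v_gt0 : 0 < v. Proof. exact: lt_trans v1. Qed.
Let v0 : v != 0. Proof. exact: lt0r_neq0. Qed.
Local Notation V := (int -> R^o).
Local Notation q := (v ^+ 2).
Local Notation psi := (psi v).
Local Notation Tlev := (Tlev v).
Variables (a : bool) (i k : int).

Definition nneg (c : V) := forall j, 0 <= c j.

Lemma nneg_Tlev s c : nneg c -> nneg (Tlev s c).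
Proof.
rewrite /nneg => c0 j; rewrite /Tlev.
have q0 : 0 <= q by rewrite exprn_ge0 // ltW.
have q1 : 0 <= q - 1 by rewrite subr_ge0 exprn_ege1 // ltW.
case: ifP => _; last exact: (mulr_ge0 q0).
exact: addr_ge0 (mulr_ge0 q1 (c0 _)) (c0 _).
Qed.

Lemma nneg_psi j : nneg (psi j).
Proof. by move=> l; rewrite /psi; case: ifP => // _; rewrite exprz_ge0 // ltW. Qed.

Lemma nneg_Tact s n j : nneg (Tact Tlev s n (psi j)).
Proof.
elim: n s => [|n IHn] s; first exact: nneg_psi.
exact: nneg_Tlev (IHn _).
Qed.

Lemma evalfD (c d : V) l : (c + d) l = c l + d l. Proof. by []. Qed.

Lemma evalf_sum n (F : 'I_n -> V) l : (\sum_(j < n) F j) l = \sum_(j < n) F j l.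
Proof.
elim: n F => [|n IHn] F; first by rewrite !big_ord0.
by rewrite !big_ord_recr /= evalfD IHn.
Qed.

(** The sum of the T_y psi_i over the two elements y that [alt a j.+1] adds to a
    Bruhat interval; both have the same coefficient b_(w,y). *)
Definition layer j l : R := Tact Tlev (~~ a) j (psi i) l + Tact Tlev a j.+1 (psi i) l.

Lemma Csum_layer n l : Csum Tlev a n (psi i) l = \sum_(j < n) layer j l.
Proof.
rewrite /Csum evalfD /Tsum linear_sum /= !evalf_sum -big_split.
by apply: eq_bigr => j _.
Qed.

Lemma layer_ge0 j l : 0 <= layer j l.
Proof. by rewrite addr_ge0 // ; apply: nneg_Tact. Qed.

(** A string of psi_j at a given level is a geometric sum, bounded uniformly in
    its length. *)
Definition strbound : R := v ^ k / (1 - v ^- 2).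

Lemma q1_gt0 : 0 < 1 - v ^- 2.
Proof. by rewrite subr_gt0 invf_lt1 ?exprn_egt1 // exprn_gt0. Qed.

Lemma strbound_ge0 : 0 <= strbound.
Proof. by rewrite mulr_ge0 ?exprz_ge0 ?invr_ge0 ?(ltW q1_gt0) // ltW. Qed.

Lemma str_psi_bound n j : 0 <= str psi n j k <= strbound.
Proof.
have e : str psi n j k = \sum_(l < n) psi (j - n%:Z + 1 + 2 * l%:Z) k by exact: evalf_sum.
rewrite e; apply/andP; split; first by apply: sumr_ge0 => l _; apply: nneg_psi.
pose Psi (l : int) : R := v ^ (Num.min l k).
have Psi_le l : psi l k <= (Psi l - Psi (l - 2)) / (1 - v ^- 2).
  rewrite ler_pdivlMr ?q1_gt0 // /Psi /psi; case: (leP l k) => lk.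
    have lk2 : l - 2 <= k by lia.
    rewrite (min_l lk2).
    rewrite expfzDr // -exprnN; lra.
  have kl : Num.min (l - 2) k <= k by rewrite ge_min lexx orbT.
  by rewrite mul0r subr_ge0 ler_weXz2l // ltW.
have Psi_ub l : Psi l <= v ^ k.
  have lk : Num.min l k <= k by rewrite ge_min lexx orbT.
  by rewrite /Psi ler_weXz2l // ltW.
have tel (x : int) : \sum_(l < n) psi (x + 2 * l%:Z) k <= (Psi (x + 2 * n%:Z - 2) - Psi (x - 2)) / (1 - v ^- 2).
  elim: n {e} => [|n IHn]; first by rewrite big_ord0 mulr0 addr0 subrr mul0r.
  rewrite big_ord_recr /=.
  apply: le_trans (lerD IHn (Psi_le _)) _.
  rewrite -mulrDl ler_pM2r ?invr_gt0 ?q1_gt0 //.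
  rewrite (_ : x + 2 * n.+1%:Z - 2 = x + 2 * n%:Z); [lra | lia].
apply: le_trans (tel _) _; rewrite ler_pM2r ?invr_gt0 ?q1_gt0 //.
rewrite lerBlDr; apply: le_trans (Psi_ub _) _.
by rewrite lerDl /Psi exprz_ge0 // ltW.
Qed.

Lemma Jstr_bound n b : `|Jstr psi b n i k| <= strbound.
Proof.
rewrite /Jstr; case: ifP => _; last by rewrite normr0 strbound_ge0.
have /andP[s0 sb] := str_psi_bound n i.
have -> : (str psi n i *~ (-1) ^+ n.+1) k = (-1) ^+ n.+1 * str psi n i k.
  by rewrite -scaler_int rmorphXn rmorphN1.
by rewrite normrM normrX normrN1 expr1n mul1r ger0_norm.
Qed.

Lemma vv_ge0 : 0 <= v + v^-1.
Proof. by apply: addr_ge0; rewrite ?invr_ge0 ltW. Qed.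

Definition Cbound : R := (v + v^-1) * strbound + 2 * strbound.

Lemma Cbound_ge0 : 0 <= Cbound.
Proof.
by apply: addr_ge0; apply: mulr_ge0; rewrite ?vv_ge0 ?strbound_ge0.
Qed.

Local Notation X n := (Jstr psi a n i k).

Lemma Csum_X n : (-1) ^+ n.+2 * (v ^- n.+1 * Csum Tlev a n.+1 (psi i) k)
  = (v + v^-1) * X n.+1 - (X n.+2 + X n).
Proof.
have := congr1 (fun c : V => c k) (ClevE v1 a n.+1 i).
have -> : n.+1%:Z + 1 = n.+2%:Z by lia.
by have -> : n.+1%:Z - 1 = n%:Z by lia.
Qed.

(** Up to the factor v^n, this is a combination of three strings. *)
Lemma Csum_bound n : 0 <= Csum Tlev a n (psi i) k <= v ^+ n * Cbound.
Proof.
rewrite {1}Csum_layer sumr_ge0 /= => [|j _]; last exact: layer_ge0.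
case: n => [|n]; first by rewrite Csum0 mul1r Cbound_ge0.
rewrite -ler_pdivrMl ?exprn_gt0 //.
apply: le_trans (ler_norm _) _.
have <- : `|(-1) ^+ n.+2 * (v ^- n.+1 * Csum Tlev a n.+1 (psi i) k)|
    = `|v ^- n.+1 * Csum Tlev a n.+1 (psi i) k|.
  by rewrite normrM normrX normrN1 expr1n mul1r.
rewrite Csum_X; apply: le_trans (ler_normB _ _) _; apply: lerD.
  by rewrite normrM (ger0_norm vv_ge0) ler_wpM2l ?vv_ge0 // Jstr_bound.
by apply: le_trans (ler_normD _ _) _; rewrite mulr2n mulrDl mul1r lerD // Jstr_bound.
Qed.

Variable m : nat.

Definition lsum N : R := \sum_(j < N) bval v m j.+1 * layer j k.

(** Summation by parts: the coefficient of the layer N is a sum of the [bdiff] from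
    N + 1 on, so the layers group into the C'_w, and the [Csum_X] make the beta appear
    through their recurrence, which only leaves the source term X m. *)
Lemma lsumE N : lsum N = (if (0 < m <= N)%N then X m else 0)
  + beta v m N.+1 * X N - beta v m N * X N.+1 + bval v m N.+1 * Csum Tlev a N (psi i) k.
Proof.
elim: N => [|N IHN].
  rewrite /lsum big_ord0 Csum0 Jstr0 beta0 mulr0 mul0r mulr0 subr0 !addr0.
  by case: ifP => //; case: (m).
rewrite /lsum big_ord_recr -/(lsum N) IHN /=.
have -> : layer N k = Csum Tlev a N.+1 (psi i) k - Csum Tlev a N (psi i) k.
  by rewrite !Csum_layer big_ord_recr /= addrAC subrr add0r.
set S1 := Csum _ _ N.+1 _ _; set S0 := Csum _ _ N _ _.
have bE : bval v m N.+1 = bdiff v m N.+1 + bval v m N.+2 by rewrite -bvalB // subrK.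
have dE : bdiff v m N.+1 * S1 = beta v m N.+1 * ((v + v^-1) * X N.+1 - (X N.+2 + X N)).
  by rewrite -Csum_X /bdiff -/S1; ring.
have rE := beta_rec v1 m N.
have -> : (if (0 < m <= N.+1)%N then X m else 0) =
   (if (0 < m <= N)%N then X m else 0) + (m == N.+1)%:R * X N.+1.
  have [->|mN] := eqVneq m N.+1; first by rewrite ltnn andbF leqnn mul1r add0r.
  by rewrite mul0r addr0 [(m <= N.+1)%N]leq_eqVlt (negPf mN) ltnS.
have -> : bval v m N.+1 * (S1 - S0) = bdiff v m N.+1 * S1 + bval v m N.+2 * S1 - bval v m N.+1 * S0.
  by rewrite bE; ring.
rewrite dE.
have -> : (m == N.+1)%:R = (v + v^-1) * beta v m N.+1 - beta v m N.+2 - beta v m N.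
  by rewrite -rE; ring.
have key (I b0 b1 b2 x0 x1 x2 c d s1 s0 d0 : R) :
    I + b1 * x0 - b0 * x1 + d * s0 + (b1 * (c * x1 - (x2 + x0)) + d0 * s1 - d * s0) =
    I + (c * b1 - b2 - b0) * x1 + b2 * x1 - b1 * x2 + d0 * s1 by ring.
exact: key.
Qed.

Definition bbound : R := `|v ^+ m * beta v m m|.

Lemma beta_bound N : (m <= N)%N -> `|beta v m N| <= bbound * v ^- N.
Proof.
have p : 0 <= v ^- N by rewrite invr_ge0 exprn_ge0 // ltW.
by move=> mN; rewrite beta_ge // normrM mulrC (ger0_norm p).
Qed.

Definition layer_const : R := bbound * Cbound.

(** The coefficient is O(v^(-2 j)) while the layer itself is O(v^j). *)
Lemma layer_bound j : (m <= j.+1)%N ->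
  `|bval v m j.+1| * layer j k <= layer_const * v ^- j.+1.
Proof.
move=> mj; have lb : layer j k <= v ^+ j.+1 * Cbound.
  have /andP[_] := Csum_bound j.+1; apply: le_trans.
  by rewrite Csum_layer big_ord_recr /= lerDr sumr_ge0 // => l _; apply: layer_ge0.
apply: le_trans (ler_pM (normr_ge0 _) (layer_ge0 _ _) (bval_ge v1 mj) lb) _.
have vn : v ^+ j.+1 != 0 by rewrite expf_neq0.
rewrite /layer_const -/bbound mul2n -addnn exprD.
by rewrite le_eqVlt; apply/orP; left; apply/eqP; field.
Qed.

Definition limit_const : R := bbound * strbound + bbound * strbound + bbound * Cbound.

(** In [lsumE] the strings are bounded, the beta are O(v^-N), and the last term is the
    product of O(v^(-2 N)) by O(v^N). *)
Lemma lsum_limit N : (0 < m <= N)%N -> `|lsum N - X m| <= limit_const * v ^- N.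
Proof.
move=> mN; have /andP[m0 mN'] := mN.
have p n : 0 <= v ^- n by rewrite invr_ge0 exprn_ge0 // ltW.
have pS : v ^- N.+1 <= v ^- N by rewrite lef_pV2 ?posrE ?exprn_gt0 // ler_weXn2l // ltW.
have b0 : 0 <= bbound by exact: normr_ge0.
have s0 := strbound_ge0; have c0 := Cbound_ge0.
rewrite lsumE mN.
have -> : forall x y z t : R, x + y - z + t - x = y - z + t by move=> *; ring.
have -> : limit_const * v ^- N = bbound * strbound * v ^- N
    + bbound * strbound * v ^- N + bbound * Cbound * v ^- N.
  by rewrite /limit_const !mulrDl.
apply: le_trans (ler_normD _ _) _; apply: lerD.
  apply: le_trans (ler_normB _ _) _; rewrite !normrM; apply: lerD.
    rewrite mulrAC; apply: ler_pM; rewrite ?Jstr_bound //.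
    by apply: le_trans (beta_bound (leqW mN')) _; rewrite ler_wpM2l.
  by rewrite mulrAC; apply: ler_pM; rewrite ?Jstr_bound ?beta_bound.
rewrite normrM; have /andP[C0 CN] := Csum_bound N.
rewrite (ger0_norm C0).
apply: le_trans (ler_pM (normr_ge0 _) C0 (bval_ge v1 (leqW mN')) CN) _.
rewrite -/bbound mul2n -addnn exprD.
have -> : bbound / (v ^+ N.+1 * v ^+ N.+1) * (v ^+ N * Cbound) = bbound * Cbound * (v ^- N.+1 * v^-1).
  have vn : v ^+ N != 0 by rewrite expf_neq0.
  by rewrite !exprS; field; rewrite v0 vn.
apply: ler_wpM2l; first by rewrite mulr_ge0.
by apply: le_trans pS; rewrite ler_piMr // invf_le1 // ltW.
Qed.

End LevelEstimates.

(** * Valuations *)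
Section Valuation.
Variable F : nonarchLocalFieldType.
Implicit Types x y : F.
Local Notation val := (@valuation F).

Lemma val_one : val 1 = 0.
Proof.
have := @Defs.valM F 1 1 (oner_neq0 _) (oner_neq0 _); rewrite mulr1; lia.
Qed.

Lemma valN1 : val (- 1) = 0.
Proof.
have n1 : (- 1 : F) != 0 by rewrite oppr_eq0 oner_neq0.
have := @Defs.valM F (- 1) (- 1) n1 n1; rewrite mulrNN mulr1 val_one; lia.
Qed.

Lemma valN x : val (- x) = val x.
Proof.
have [->|x0] := eqVneq x 0; first by rewrite oppr0.
rewrite -mulN1r Defs.valM ?valN1 ?add0r // oppr_eq0; exact: oner_neq0.
Qed.

Lemma valV x : x != 0 -> val x^-1 = - val x.
Proof.
move=> x0; have := Defs.valM _ _ x0 (invr_neq0 x0); rewrite divff // val_one; lia.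
Qed.

Definition vge (n : int) x : bool := (x == 0) || (n <= val x).

Lemma vge0 n : vge n 0. Proof. by rewrite /vge eqxx. Qed.

Lemma vgeE n x : x != 0 -> vge n x = (n <= val x).
Proof. by rewrite /vge => /negPf->. Qed.

Lemma vge_val x : vge (val x) x.
Proof. by rewrite /vge lexx orbT. Qed.

Lemma vge_le m n x : m <= n -> vge n x -> vge m x.
Proof. by rewrite /vge => mn /orP[->//|nx]; rewrite (le_trans mn) ?orbT. Qed.

Lemma vgeN n x : vge n (- x) = vge n x.
Proof. by rewrite /vge oppr_eq0 valN. Qed.

Lemma vgeD n x y : vge n x -> vge n y -> vge n (x + y).
Proof.
have [->|x0] := eqVneq x 0; first by rewrite add0r.
have [->|y0] := eqVneq y 0; first by rewrite addr0.
have [->|xy0] := eqVneq (x + y) 0; first by rewrite vge0.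
rewrite !vgeE // => nx ny; apply: le_trans (Defs.valD _ _ x0 y0 xy0).
by rewrite le_min nx.
Qed.

Lemma vgeB n x y : vge n x -> vge n y -> vge n (x - y).
Proof. by move=> nx ny; rewrite vgeD ?vgeN. Qed.

Lemma vgeM m n x y : vge m x -> vge n y -> vge (m + n) (x * y).
Proof.
have [->|x0] := eqVneq x 0; first by rewrite mul0r !vge0.
have [->|y0] := eqVneq y 0; first by rewrite mulr0 !vge0.
by rewrite !vgeE ?mulf_neq0 ?Defs.valM //; apply: lerD.
Qed.

Lemma vgeMl n x y : x != 0 -> vge n (x * y) = vge (n - val x) y.
Proof.
move=> x0; have [->|y0] := eqVneq y 0; first by rewrite mulr0 !vge0.
by rewrite !vgeE ?mulf_neq0 ?Defs.valM //; lia.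
Qed.

Lemma val_dom x y : x != 0 -> vge (val x + 1) y -> x + y != 0 /\ val (x + y) = val x.
Proof.
move=> x0 xy; have ge : vge (val x) (x + y).
  by rewrite vgeD ?vge_val //; apply: vge_le xy; lia.
have nge : ~~ vge (val x + 1) (x + y).
  apply/negP => h; have : vge (val x + 1) (x + y - y) by rewrite vgeB.
  rewrite addrK vgeE //; lia.
have xy0 : x + y != 0 by apply: contraNneq nge => ->; rewrite vge0.
by split=> //; move: ge nge; rewrite !vgeE //; lia.
Qed.

Lemma integersP x : reflect (integers x) (vge 0 x).
Proof.
apply: (iffP orP) => [[/eqP->|]|[->|]]; [by left|by right|by left|by right].
Qed.

Variable pi : F.
Hypothesis pi_unif : uniformizer pi.

Lemma pi_neq0 : pi != 0. Proof. by case: pi_unif. Qed.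
Lemma val_pi : val pi = 1. Proof. by case: pi_unif. Qed.

Lemma vge_pi n x : vge n (pi * x) = vge (n - 1) x.
Proof. by rewrite vgeMl ?pi_neq0 // val_pi. Qed.

Lemma vge_piV n x : vge n (pi^-1 * x) = vge (n + 1) x.
Proof. by rewrite vgeMl ?invr_neq0 ?pi_neq0 // valV ?pi_neq0 // val_pi opprK. Qed.

Lemma vge1P x : reflect (exists2 y, integers y & x = pi * y) (vge 1 x).
Proof.
apply: (iffP idP) => [x1|[y /integersP y0 ->]].
  exists (pi^-1 * x); last by rewrite mulVKf ?pi_neq0.
  by apply/integersP; rewrite vge_piV.
by rewrite vge_pi.
Qed.

(** * Levels *)
(** The nonzero orbits of the Iwahori subgroup on F^2 are indexed by their level,
    which is here computed in coordinates (m, o) such that the orbits of even level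
    are those where m dominates. *)
Definition lev0 m o : int :=
  if m == 0 then 2 * val o + 1
  else if o == 0 then 2 * val m else Num.min (2 * val m) (2 * val o + 1).

Lemma lev0_ge i m o : (m, o) != (0, 0) ->
  (i <= lev0 m o) = ((m == 0) || (i <= 2 * val m)) && ((o == 0) || (i <= 2 * val o + 1)).
Proof.
rewrite /lev0 xpair_eqE; case: (m =P 0) => _; case: (o =P 0) => _ //=.
  by rewrite andbT.
by rewrite le_min.
Qed.

Lemma lev0P m o : (m, o) != (0, 0) ->
  (o != 0 /\ vge (val o + 1) m) /\ lev0 m o = 2 * val o + 1 \/
  (m != 0 /\ vge (val m) o) /\ lev0 m o = 2 * val m.
Proof.
rewrite /lev0 /vge xpair_eqE; case: (m =P 0) => m0; case: (o =P 0) => o0 //= _.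
- by left.
- by right.
- by case: (leP (2 * val m) (2 * val o + 1)) => h; [right | left];
    (split; first split) => //; lia.
Qed.

Lemma lev0_odd m o : (m, o) != (0, 0) -> parz (lev0 m o) ->
  [/\ o != 0, vge (val o + 1) m & lev0 m o = 2 * val o + 1].
Proof. by case/lev0P => -[[o0 h] ->] //; rewrite parz2. Qed.

Lemma lev0_even m o : (m, o) != (0, 0) -> ~~ parz (lev0 m o) ->
  [/\ m != 0, vge (val m) o & lev0 m o = 2 * val m].
Proof. by case/lev0P => -[[o0 h] ->] //; rewrite parz_odd. Qed.

Lemma lev0E_even m o : m != 0 -> vge (val m) o -> lev0 m o = 2 * val m.
Proof.
rewrite /lev0 /vge => /negPf->; case: (o =P 0) => //= _ h.
have mo : 2 * val m <= 2 * val o + 1 by lia.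
exact: min_l.
Qed.

Lemma lev0E_odd m o : o != 0 -> vge (val o + 1) m -> lev0 m o = 2 * val o + 1.
Proof.
rewrite /lev0 /vge => /negPf->; case: (m =P 0) => //= _ h.
have mo : 2 * val o + 1 <= 2 * val m by lia.
exact: min_r.
Qed.

(** The coordinate o dominates, hence it determines the valuation of a m - o. *)
Lemma lev0_step_odd m o a : vge 0 a -> (m, o) != (0, 0) -> parz (lev0 m o) ->
  lev0 (a * m - o) m = lev0 m o - 1.
Proof.
move=> a0 mo /lev0_odd-/(_ mo)[o0 om ->].
have am : vge (val (- o) + 1) (a * m) by rewrite valN -[_ + 1]add0r vgeM.
have on0 : - o != 0 by rewrite oppr_eq0.
have [n0 vE] := val_dom on0 am.
by rewrite addrC lev0E_even ?vE ?valN ?addrK //; apply: vge_le om; lia.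
Qed.

(** As a m - o = m (a - o / m), only the residue class of o / m is exceptional. *)
Lemma lev0_step_even m o a : vge 0 a -> (m, o) != (0, 0) -> ~~ parz (lev0 m o) ->
  vge 0 (o / m) /\
  lev0 (a * m - o) m = if vge 1 (a - o / m) then lev0 m o + 1 else lev0 m o.
Proof.
move=> a0 mo /lev0_even-/(_ mo)[m0 om ->].
have om0 : vge 0 (o / m) by rewrite mulrC vgeMl ?invr_neq0 // valV // opprK add0r.
split=> //; have -> : a * m - o = m * (a - o / m).
  by rewrite mulrBr mulrC [m * (_ / _)]mulrC divfK.
case: ifP => h.
  by apply: lev0E_odd => //; rewrite vgeMl // addrAC subrr add0r.
have nz : a - o / m != 0 by apply: contraFneq h => ->; rewrite vge0.
have v0 : val (a - o / m) = 0.
  have : vge 0 (a - o / m) by rewrite vgeB.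
  by move: h; rewrite !vgeE //; lia.
have vE : val (m * (a - o / m)) = val m by rewrite Defs.valM // v0 addr0.
by rewrite lev0E_even ?mulf_neq0 // ?vE // vge_val.
Qed.

(** * Matrices *)
Local Notation mx := (@mx2 F).

Lemma mx2_eta (M : 'M[F]_2) : M = mx (M 0 0) (M 0 1) (M 1 0) (M 1 1).
Proof.
by apply/matrixP => i j; rewrite mxE; case: i j => [[|[|//]] ?] [[|[|//]] ?];
  congr (M _ _); apply: val_inj.
Qed.

Lemma mx2E a b c d :
  (mx a b c d 0 0 = a) * (mx a b c d 0 1 = b) * (mx a b c d 1 0 = c) * (mx a b c d 1 1 = d).
Proof. by rewrite !mxE. Qed.

Lemma mx2M a b c d a' b' c' d' : mx a b c d *m mx a' b' c' d' =
  mx (a * a' + b * c') (a * b' + b * d') (c * a' + d * c') (c * b' + d * d').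
Proof.
by rewrite [LHS]mx2_eta; congr mx; rewrite !mxE !big_ord_recl big_ord0 !mxE addr0.
Qed.

Lemma mx2_1 : mx 1 0 0 1 = 1%:M.
Proof. by rewrite [RHS]mx2_eta; congr mx; rewrite !mxE. Qed.

Lemma det_mx2 (M : 'M[F]_2) : \det M = M 0 0 * M 1 1 - M 0 1 * M 1 0.
Proof.
rewrite (expand_det_row _ 0) !big_ord_recl big_ord0 addr0 /cofactor !det_mx11 !mxE /=.
rewrite expr0 mul1r expr1 mulN1r mulrN; congr (_ * M _ _ - M _ _ * M _ _);
exact: val_inj.
Qed.

Definition cv (x y : F) : 'cV[F]_2 := \col_i (if i == 0 then x else y).

Lemma cvE x y : (cv x y 0 0 = x) * (cv x y 1 0 = y).
Proof. by rewrite !mxE. Qed.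

Lemma cv_eta (z : 'cV[F]_2) : z = cv (z 0 0) (z 1 0).
Proof.
by apply/matrixP => i j; rewrite mxE; case: i j => [[|[|//]] ?] [[|//] ?];
  congr (z _ _); apply: val_inj.
Qed.

Lemma cv_eq0 x y : (cv x y == 0) = ((x, y) == (0, 0)).
Proof.
apply/eqP/eqP => [e|[-> ->]].
  have E i := congr1 (fun z : 'cV[F]_2 => z i 0) e.
  by have := E 0; have := E 1; rewrite !cvE !mxE => -> ->.
by apply/matrixP => i j; rewrite !mxE; case: ifP.
Qed.

Lemma mx2_cv a b c d x y : mx a b c d *m cv x y = cv (a * x + b * y) (c * x + d * y).
Proof.
by rewrite [LHS]cv_eta; congr cv; rewrite !mxE !big_ord_recl big_ord0 !mxE addr0.
Qed.

Definition lev (z : 'cV[F]_2) : int := lev0 (z 1 0) (z 0 0).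

Definition lattice (i : int) (z : 'cV[F]_2) : bool :=
  ((z 1 0 == 0) || (i <= 2 * val (z 1 0))) && ((z 0 0 == 0) || (i <= 2 * val (z 0 0) + 1)).

Lemma lattice_lev i z : z != 0 -> lattice i z = (i <= lev z).
Proof.
rewrite {1}[z]cv_eta cv_eq0 => z0; rewrite /lev lev0_ge //.
by move: z0; rewrite !xpair_eqE andbC.
Qed.

(** Coordinates in which s plays the role of s_0. *)
Definition scv (s : bool) (m o : F) : 'cV[F]_2 :=
  if s then cv m (pi * o) else cv o m.

Lemma scv_surj s z : exists m o, z = scv s m o.
Proof.
rewrite [z]cv_eta; case: s; last by exists (z 1 0), (z 0 0).
by exists (z 0 0), (pi^-1 * z 1 0); rewrite /scv mulVKf ?pi_neq0.
Qed.

Lemma scv_eq0 s m o : (scv s m o == 0) = ((m, o) == (0, 0)).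
Proof.
case: s; rewrite /scv cv_eq0 !xpair_eqE; last by rewrite andbC.
by rewrite mulf_eq0 (negPf pi_neq0).
Qed.

Lemma lev_scv s m o : (m, o) != (0, 0) -> lev (scv s m o) = lev0 m o + (s : nat)%:Z.
Proof.
case: s => mo; rewrite /lev /scv !cvE ?addr0 //.
case/lev0P: (mo) => -[[x0 h] ->].
  rewrite lev0E_even ?mulf_neq0 ?pi_neq0 ?Defs.valM ?pi_neq0 ?val_pi //; first lia.
  by rewrite addrC.
rewrite lev0E_odd ?vge_pi ?addrK //; lia.
Qed.
End Valuation.

(** * Cosets of the Iwahori subgroup *)
Section Cosets.
Variables (F : nonarchLocalFieldType) (pi : F).
Hypothesis pi_unif : uniformizer pi.
Local Notation val := (@valuation F).
Local Notation mx := (@mx2 F).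
Local Notation lev := (@lev F).
Local Notation scv := (scv pi).
Local Notation pi0 := (pi_neq0 pi_unif).

(** A root element, with parameter a, times the lift of s: for a in representatives
    of O/pi, these represent the left cosets of I in I s I. *)
Definition st (s : bool) (a : F) : 'M[F]_2 :=
  if s then mx 0 pi^-1 (- pi) a else mx a (- 1) 1 0.

Definition stV (s : bool) (a : F) : 'M[F]_2 :=
  if s then mx a (- pi^-1) pi 0 else mx 0 1 (- 1) a.

Definition root (s : bool) (a : F) : 'M[F]_2 :=
  if s then mx 1 0 (pi * a) 1 else mx 1 a 0 1.

Lemma stVK s a : stV s a *m st s a = 1%:M.
Proof.
by rewrite /stV /st -mx2_1; case: s; rewrite mx2M; congr mx2; field; rewrite ?pi0.
Qed.

Lemma stK s a : st s a *m stV s a = 1%:M.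
Proof. exact: mulmx1C (stVK s a). Qed.

Lemma st_root s a : st s a = root s a *m lift_gen pi s.
Proof.
by rewrite /st /root /lift_gen; case: s; rewrite mx2M; congr mx2; field; rewrite ?pi0.
Qed.

(** Conjugation by the lift of s moves a root element of the other type into the
    root group of s, with its parameter multiplied by - pi. *)
Lemma st_root_neg s a b : st s a *m root (~~ s) b = st s (a - pi * b).
Proof.
by rewrite /st /root; case: s; rewrite mx2M; congr mx2; field; rewrite ?pi0.
Qed.

Lemma stV_scv s a m o : stV s a *m scv s m o = scv s (a * m - o) m.
Proof.
by rewrite /stV /scv; case: s; rewrite mx2_cv; congr cv; field; rewrite ?pi0.
Qed.

Lemma lev_scv_parity s m o : (m, o) != (0, 0) ->
  parz (lev (scv s m o)) = parz (lev0 m o) (+) s.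
Proof. by move=> mo; rewrite lev_scv // parzD; case: s. Qed.

Lemma lev_stV_neg s a z : vge 0 a -> z != 0 -> parz (lev z) = ~~ s ->
  lev (stV s a *m z) = lev z - 1.
Proof.
move=> a0; have [m [o ->]] := scv_surj pi_unif s z; rewrite scv_eq0 // => mo.
rewrite lev_scv_parity // stV_scv => p.
have odd_mo : parz (lev0 m o) by case: (parz _) s p => [] [].
have [o0 om _] := lev0_odd mo odd_mo.
have amo : (a * m - o, m) != (0, 0).
  apply: contraNneq mo => -[e m0]; move: e; rewrite m0 mulr0 sub0r => /eqP.
  by rewrite oppr_eq0 (negPf o0).
by rewrite !lev_scv // lev0_step_odd // addrAC.
Qed.

Lemma lev_stV_same s z : z != 0 -> parz (lev z) = s ->
  exists2 a0, vge 0 a0 & forall a, vge 0 a ->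
    lev (stV s a *m z) = if vge 1 (a - a0) then lev z + 1 else lev z.
Proof.
have [m [o ->]] := scv_surj pi_unif s z; rewrite scv_eq0 // => mo.
rewrite lev_scv_parity // => p.
have even_mo : ~~ parz (lev0 m o) by case: (parz _) s p => [] [].
have [m0 _ _] := lev0_even mo even_mo.
have [om _] := lev0_step_even (vge0 F 0) mo even_mo.
exists (o / m) => // a a0; have [_ e] := lev0_step_even a0 mo even_mo.
rewrite stV_scv !lev_scv // ?e; last by rewrite xpair_eqE (negPf m0) andbF.
by case: ifP => // _; rewrite addrAC.
Qed.

Lemma mulmx_inv_neq0 (A B : 'M[F]_2) (z : 'cV[F]_2) :
  A *m B = 1%:M -> z != 0 -> B *m z != 0.
Proof.
move=> AB; apply: contraNneq => Bz.
by rewrite -[z]mul1mx -AB -mulmxA Bz mulmx0.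
Qed.

(** Whenever the inverse of [st s a] lowers or preserves a level, the resulting level
    has parity s; so z comes from a vector that this inverse raises. *)
Lemma lev_st s a z : vge 0 a -> z != 0 -> parz (lev z) = ~~ s ->
  lev (st s a *m z) = lev z - 1 /\ parz (lev (st s a *m z)) = s.
Proof.
move=> a0 z0 pz; set w := st s a *m z.
have w0 : w != 0 by apply: mulmx_inv_neq0 (stVK s a) z0.
have zw : z = stV s a *m w by rewrite mulmxA stVK mul1mx.
have [pw|pw] := eqVneq (parz (lev w)) s.
  split=> //; have [b b0 /(_ a a0)] := lev_stV_same w0 pw; rewrite -zw.
  case: ifP => _ e; first by rewrite e addrK.
  by move: pz; rewrite e pw; case: (s).
have {}pw : parz (lev w) = ~~ s by case: (parz _) (s) pw => [] [].
have := lev_stV_neg a0 w0 pw; rewrite -zw => e.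
by move: pz; rewrite e parzD addbT pw negbK; case: (s).
Qed.

(** The product of the matrices [st] along the alternating word that starts with s;
    the lists l with entries in representatives of O/pi parametrize the cosets in
    the Bruhat cell. *)
Fixpoint um (s : bool) (l : seq F) : 'M[F]_2 :=
  if l is a :: l' then st s a *m um (~~ s) l' else 1%:M.

Fixpoint umV (s : bool) (l : seq F) : 'M[F]_2 :=
  if l is a :: l' then umV (~~ s) l' *m stV s a else 1%:M.

Lemma umVK s l : umV s l *m um s l = 1%:M.
Proof.
elim: l s => [|a l IHl] s /=; first by rewrite mulmx1.
by rewrite mulmxA -[_ *m stV s a *m _]mulmxA stVK mulmx1 IHl.
Qed.

Lemma umK s l : um s l *m umV s l = 1%:M.
Proof. exact: mulmx1C (umVK s l). Qed.

Lemma lev_um s l z : all (vge 0) l -> z != 0 ->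
  parz (lev z) = s (+) odd (size l) -> lev (um s l *m z) = lev z - (size l)%:Z.
Proof.
move=> + z0; elim: l s => [|a l IHl] s /=; first by rewrite mul1mx subr0.
move=> /andP[a0 l0] pz; rewrite -mulmxA.
have e : lev (um (~~ s) l *m z) = lev z - (size l)%:Z.
  by apply: IHl => //; rewrite pz addNb addbN.
have [|-> _] := lev_st (s := s) a0 (mulmx_inv_neq0 (umVK (~~ s) l) z0).
  by rewrite e parzD parzN pz parz_nat; case: (s) (odd _) => [] [].
by rewrite e; lia.
Qed.

(** ** The Iwahori subgroup *)
Local Notation iw := (iwahori pi).

Lemma iwahoriP (i : 'M[F]_2) : iw i <->
  [/\ \det i = 1, vge 0 (i 0 0) /\ vge 0 (i 0 1), vge 0 (i 1 1) & vge 1 (i 1 0)].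
Proof.
split=> [[d ii /(vge1P pi_unif) c]|[d [h0 h1] h2 h3]].
  by split=> //; [split|]; apply/integersP.
split=> //; last by apply/(vge1P pi_unif).
move=> k l; apply/integersP; rewrite (mx2_eta i) mxE.
by do 2 case: ifP => _ //; apply: vge_le h3.
Qed.

Lemma iwahori_mx a b c d :
  iw (mx a b c d) <-> [/\ a * d - b * c = 1, vge 0 a /\ vge 0 b, vge 0 d & vge 1 c].
Proof. by rewrite iwahoriP det_mx2 !mx2E. Qed.

Lemma iwahori1 : iw 1%:M.
Proof.
have o : vge 0 (1 : F) by rewrite vgeE ?oner_neq0 // val_one.
by rewrite -mx2_1 iwahori_mx mulr1 mulr0 subr0 !vge0 o.
Qed.

Lemma iwahoriM i j : iw i -> iw j -> iw (i *m j).
Proof.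
rewrite (mx2_eta i) (mx2_eta j) mx2M !iwahori_mx.
move=> [d1 [a1 b1] e1 c1] [d2 [a2 b2] e2 c2]; split.
- rewrite -[RHS]mulr1 -{1}d1 -d2; ring.
- by split; rewrite vgeD // -[0]addr0 vgeM // (vge_le _ c2).
- by rewrite vgeD // -[0]addr0 vgeM // (vge_le _ c1).
- by rewrite vgeD //; [rewrite -[1]addr0|rewrite -[1]add0r]; apply: vgeM.
Qed.

Lemma invmx_SL2 (M : 'M[F]_2) : \det M = 1 ->
  invmx M = mx (M 1 1) (- M 0 1) (- M 1 0) (M 0 0).
Proof.
move=> d; have u : M \in unitmx by rewrite unitmxE d unitr1.
set N := mx _ _ _ _; have MN : M *m N = 1%:M.
  rewrite [M]mx2_eta /N mx2M -mx2_1; move: d; rewrite det_mx2 => d.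
  by congr mx; rewrite -?d; ring.
by rewrite -[N]mul1mx -(mulVmx u) -mulmxA MN mulmx1.
Qed.

Lemma iwahoriV i : iw i -> iw (invmx i).
Proof.
move=> /iwahoriP[d [a b] e c]; rewrite invmx_SL2 // iwahori_mx !vgeN.
by split=> //; rewrite -d det_mx2; ring.
Qed.

Lemma iwahori_unit i : iw i -> i \in unitmx.
Proof. by case/iwahoriP => d _ _ _; rewrite unitmxE d unitr1. Qed.

(** The lower left entry in pi O compensates for the different thresholds on the
    two coordinates. *)
Lemma lattice_iwahori i n z : iw i -> lattice n z -> lattice n (i *m z).
Proof.
rewrite (mx2_eta i) iwahori_mx [z]cv_eta mx2_cv /lattice !cvE.
move: (i 0 0) (i 0 1) (i 1 0) (i 1 1) (z 0 0) (z 1 0) => a b c d x y.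
move=> [_ [a0 b0] d0 c1].
pose k := (n %/ 2)%Z; pose r := (n %% 2)%Z.
have ev u : (u == 0) || (n <= 2 * val u) = vge (- ((- n) %/ 2)%Z) u.
  by rewrite /vge; case: eqP => //= _; lia.
have od u : (u == 0) || (n <= 2 * val u + 1) = vge (n %/ 2)%Z u.
  by rewrite /vge; case: eqP => //= _; lia.
rewrite !ev !od => /andP[hy hx]; apply/andP; split.
  apply: vgeD; last by rewrite -[- _]add0r vgeM.
  by apply: vge_le (vgeM c1 hx); lia.
apply: vgeD; first by rewrite -[(n %/ 2)%Z]add0r vgeM.
by apply: vge_le (vgeM b0 hy); lia.
Qed.

Lemma lev_iwahori i z : iw i -> z != 0 -> lev (i *m z) = lev z.
Proof.
move=> ii z0; have iV := iwahoriV ii; have u := iwahori_unit ii.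
have iz0 : i *m z != 0 by apply: mulmx_inv_neq0 (mulVmx u) z0.
apply/eqP; rewrite eq_le -!lattice_lev //; apply/andP; split.
  by rewrite -[z in lattice _ z](mulKmx u) lattice_iwahori // lattice_lev.
by rewrite lattice_iwahori // lattice_lev.
Qed.

(** ** Bruhat cells *)
Fact lev_drop (x : int) n : x - n.+1%:Z + 1 <= x.
Proof. lia. Qed.

Fact lev_up (x : int) n : x - n%:Z = x - n.+1%:Z + 1.
Proof. lia. Qed.

Lemma e1_lev : cv (1 : F) 0 != 0 /\ lev (cv 1 0) = 1.
Proof.
have o := oner_neq0 F; rewrite cv_eq0 xpair_eqE (negPf o) /lev !cvE.
by rewrite lev0E_odd ?vge0 // val_one.
Qed.

Lemma e0_lev : cv (0 : F) 1 != 0 /\ lev (cv 0 1) = 0.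
Proof.
have o := oner_neq0 F; rewrite cv_eq0 xpair_eqE (negPf o) andbF /lev !cvE.
by rewrite lev0E_even ?vge0 // val_one.
Qed.

(** The basis vectors, of levels 0 and 1, show that the matrix is upper triangular
    modulo pi with diagonal entries in pi O. *)
Lemma det_lev_raise (h : 'M[F]_2) :
  (forall z, z != 0 -> h *m z != 0 /\ lev z + 1 <= lev (h *m z)) -> vge 1 (\det h).
Proof.
move=> hh; have [n1 l1] := e1_lev; have [n0 l0] := e0_lev.
have [h1 r1] := hh _ n1; have [h0 r0] := hh _ n0.
move: h1 r1 h0 r0; rewrite l1 l0 => h1 r1 h0 r0.
have : lattice 2 (h *m cv 1 0) by rewrite lattice_lev.
have : lattice 1 (h *m cv 0 1) by rewrite lattice_lev.
rewrite det_mx2 (mx2_eta h) !mx2_cv !mx2E /lattice !cvE !mulr0 !mulr1 !addr0 !add0r.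
move: (h 0 0) (h 0 1) (h 1 0) (h 1 1) => a b c d /andP[d1 b0] /andP[c1 a1].
have {}d1 : vge 1 d by move: d1; rewrite /vge; case: eqP => //= _; lia.
have {}b0 : vge 0 b by move: b0; rewrite /vge; case: eqP => //= _; lia.
have {}c1 : vge 1 c by move: c1; rewrite /vge; case: eqP => //= _; lia.
have {}a1 : vge 1 a by move: a1; rewrite /vge; case: eqP => //= _; lia.
apply: vgeB; first by apply: vge_le (vgeM a1 d1).
by rewrite -[1]add0r vgeM.
Qed.

Lemma det_st s a : \det (st s a) = 1.
Proof. by rewrite det_mx2 /st; case: s; rewrite !mx2E; field; rewrite ?pi0. Qed.

Lemma det_um s l : \det (um s l) = 1.
Proof.
by elim: l s => [|a l IHl] s /=; rewrite ?det1 // det_mulmx det_st mul1r IHl.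
Qed.

Lemma lev_vec (p : bool) : exists2 z : 'cV[F]_2, z != 0 & parz (lev z) = p.
Proof.
case: p; last by have [z0 l0] := e0_lev; exists (cv 0 1) => //; rewrite l0.
by have [z1 l1] := e1_lev; exists (cv 1 0) => //; rewrite l1.
Qed.

Variable rs : seq F.
Hypothesis rs_vge : all (vge 0) rs.
Hypothesis rs_inj : {in rs &, forall a b, vge 1 (a - b) -> a = b}.

Lemma rs_all l : all (mem rs) l -> all (vge 0) l.
Proof. by move=> lr; apply: sub_all lr => a; apply: (allP rs_vge). Qed.

(** The effect on levels detects everything: if the last letters differed, every
    vector would be raised by the inverse, which [det_lev_raise] forbids; a vector of
    the right parity then shows the length, and the entries are obtained one by one
    from the only residue class that raises the level. *)
Lemma um_inj s l s' l' i : iw i -> all (mem rs) l -> all (mem rs) l' ->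
  um s l *m i = um s' l' -> l = l' /\ (l != [::] -> s = s').
Proof.
move=> ii; have iu := iwahori_unit ii.
elim: l s s' l' => [|a l IHl] s s' l' lr lr' e.
  case: l' lr' e => // a' l' lr' e; exfalso.
  have [z z0 pz] := lev_vec (s' (+) odd (size (a' :: l'))).
  have := lev_um (rs_all lr') z0 pz; rewrite -e /= mul1mx lev_iwahori //; lia.
have iz (z : 'cV[F]_2) : z != 0 -> i *m z != 0 by apply: mulmx_inv_neq0 (mulVmx iu).
case: l' lr' e => [|a' l'] lr' e.
  exfalso; have [z z0 pz] := lev_vec (s (+) odd (size (a :: l))).
  have := lev_um (s := s) (rs_all lr) (iz _ z0); rewrite mulmxA e /= mul1mx.
  by rewrite lev_iwahori // => /(_ pz); lia.
have par_eq : s (+) odd (size (a :: l)) = s' (+) odd (size (a' :: l')).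
  apply/eqP; apply: contraT => par; exfalso.
  have raise z : z != 0 -> umV s (a :: l) *m z != 0 /\ lev z + 1 <= lev (umV s (a :: l) *m z).
    move=> z0; set w := umV _ _ *m z.
    have w0 : w != 0 by apply: mulmx_inv_neq0 (umK s (a :: l)) z0.
    split=> //; have zw : z = um s (a :: l) *m w by rewrite mulmxA umK mul1mx.
    have [pw|pw] := eqVneq (parz (lev w)) (s (+) odd (size (a :: l))).
      have := lev_um (rs_all lr) w0 pw; rewrite -zw => ->.
      exact: lev_drop.
    have u0 : invmx i *m w != 0 by apply: mulmx_inv_neq0 (mulmxV iu) w0.
    have lu : lev (invmx i *m w) = lev w by rewrite lev_iwahori //; apply: iwahoriV.
    have zu : z = um s' (a' :: l') *m (invmx i *m w).
      by rewrite -e -mulmxA mulKVmx.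
    have pu : parz (lev (invmx i *m w)) = s' (+) odd (size (a' :: l')).
      rewrite lu; move: par pw.
      by move: (parz _) (s (+) _) (s' (+) _) => x y t; case: x; case: y; case: t.
    have := lev_um (rs_all lr') u0 pu; rewrite -zu lu => ->.
    exact: lev_drop.
  have := det_lev_raise raise.
  have -> : \det (umV s (a :: l)) = 1.
    by have := congr1 determinant (umVK s (a :: l)); rewrite det_mulmx det_um mulr1 det1.
  by rewrite vgeE ?oner_neq0 // val_one.
have [z z0 pz] := lev_vec (s (+) odd (size (a :: l))).
have pz' : parz (lev z) = s' (+) odd (size (a' :: l')) by rewrite -par_eq.
have pi' : parz (lev (i *m z)) = s (+) odd (size (a :: l)) by rewrite lev_iwahori.
have L1 := lev_um (rs_all lr) (iz z z0) pi'; have L2 := lev_um (rs_all lr') z0 pz'.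
have szE : size l = size l'.
  by move: L1; rewrite mulmxA e L2 lev_iwahori // => /addrI/oppr_inj[].
have ss' : s = s'.
  by move: par_eq; rewrite /= szE; case: (s) (s') (odd _) => [] [] [].
have /andP[ar lr0] := lr; have /andP[ar' lr0'] := lr'.
have a0 := allP rs_vge _ ar; have a0' := allP rs_vge _ ar'.
set w := um s' (a' :: l') *m z in L2.
have w0 : w != 0 by apply: mulmx_inv_neq0 (umVK s' (a' :: l')) z0.
have w1 : stV s a *m w = um (~~ s) l *m (i *m z).
  by rewrite /w -e /= !mulmxA stVK mul1mx.
have w1' : stV s a' *m w = um (~~ s) l' *m z.
  by rewrite /w -ss' /= !mulmxA stVK mul1mx.
have r1 : lev (stV s a *m w) = lev w + 1.
  have p : parz (lev (i *m z)) = ~~ s (+) odd (size l).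
    by rewrite pi' [size _]/= [odd _.+1]/= addbN addNb.
  by rewrite w1 (lev_um (rs_all lr0) (iz z z0) p) L2 lev_iwahori // szE -lev_up.
have r1' : lev (stV s a' *m w) = lev w + 1.
  have p : parz (lev z) = ~~ s (+) odd (size l').
    by rewrite pz' -ss' [size _]/= [odd _.+1]/= addbN addNb.
  by rewrite w1' (lev_um (rs_all lr0') z0 p) L2 -lev_up.
have pw : parz (lev w) = s.
  have [//|ps] := eqVneq (parz (lev w)) s.
  have : parz (lev w) = ~~ s by case: (parz _) (s) ps => [] [].
  by move=> /(lev_stV_neg a0 w0); rewrite r1 => /addrI.
have [b b0 hb] := lev_stV_same w0 pw.
have no (x : int) : x <> x + 1 by clear; lia.
have ab : vge 1 (a - b) by move: r1; rewrite hb //; case: ifP => // _ /no.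
have ab' : vge 1 (a' - b) by move: r1'; rewrite hb //; case: ifP => // _ /no.
have aa : a = a'.
  apply: rs_inj => //.
  by have := vgeB ab ab'; rewrite opprB addrA subrK.
have e2 : um (~~ s) l *m i = um (~~ s) l'.
  move: e; rewrite -ss' -aa /= => /(congr1 (mulmx (stV s a))).
  by rewrite !mulmxA stVK !mul1mx.
by have [-> _] := IHl _ _ _ lr0 lr0' e2; rewrite aa ss'.
Qed.

Hypothesis rs_ex : forall x, vge 0 x -> exists2 a, a \in rs & vge 1 (x - a).

(** By [st_root_neg], all root elements can be moved to the left. *)
Lemma um_root s l : all (vge 0) l ->
  exists2 b, vge 0 b & um s l = root s b *m lift_weyl pi (alt s (size l)).
Proof.
elim: l s => [|a l IHl] s /=.
  move=> _; exists 0; first exact: vge0.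
  by rewrite /lift_weyl big_nil mulmx1 /root -mx2_1 mulr0; case: s.
move=> /andP[a0 /(IHl (~~ s))[b b0 ->]]; exists (a - pi * b).
  by rewrite vgeB // vge_pi // (vge_le _ b0).
rewrite mulmxA st_root_neg st_root -mulmxA; congr (_ *m _).
by rewrite /lift_weyl big_cons.
Qed.

Lemma iwahori_root s b : vge 0 b -> iw (root s b).
Proof.
have o : vge 0 (1 : F) by rewrite vgeE ?oner_neq0 // val_one.
move=> b0; rewrite /root; case: s; rewrite iwahori_mx !vge0 ?o ?b0 ?vge_pi ?b0 //;
by rewrite ?mulr1 ?mulr0 ?mul0r subr0.
Qed.

Lemma double_coset_um s l : all (mem rs) l ->
  double_coset pi (alt s (size l)) (um s l).
Proof.
move=> /rs_all/um_root-/(_ s)[b b0 e]; exists (root s b), 1%:M; split.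
- exact: iwahori_root.
- exact: iwahori1.
- by rewrite mulmx1.
Qed.

(** The lift of s conjugates into I the elements of I whose parameter in the root
    group of s vanishes modulo pi, so only the residue class of this parameter
    matters. *)
Lemma iwahori_st s i : iw i -> exists2 a, a \in rs &
  exists2 j, iw j & i *m lift_gen pi s = st s a *m j.
Proof.
rewrite (mx2_eta i) iwahori_mx; move: (i 0 0) (i 0 1) (i 1 0) (i 1 1) => p b c d.
move=> [dt [p0 b0] d0 c1].
have bc1 : vge 1 (b * c) by rewrite -[1]add0r vgeM.
have pd : p * d != 0 /\ val (p * d) = 0.
  have := @val_dom F 1 (b * c); rewrite oner_neq0 val_one add0r -dt subrK.
  by apply.
have [pn dn] : p != 0 /\ d != 0 by case: pd; rewrite mulf_eq0 => /norP.
have [vp vd] : val p = 0 /\ val d = 0.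
  by move: pd p0 d0 => [_]; rewrite Defs.valM // !vgeE //; clear; lia.
have [a ar [j ij e]] : exists2 a, a \in rs &
    exists2 j, iw j & j = stV s a *m (mx p b c d *m lift_gen pi s).
  case: s.
    have a1 : vge 0 (pi^-1 * c / p).
      by rewrite mulrC vgeMl ?invr_neq0 // valV // vp oppr0 subr0 vge_piV.
    have [a ar ac] := rs_ex a1; have a0 := allP rs_vge _ ar.
    exists a => //; eexists; last reflexivity.
    rewrite /stV /lift_gen !mx2M iwahori_mx.
    have k : vge 1 (a * p - pi^-1 * c).
      have -> : a * p - pi^-1 * c = - (p * (pi^-1 * c / p - a)) by field; rewrite pn pi0.
      by rewrite vgeN vgeMl // vp.
    split.
    - by rewrite -[RHS]dt; field; rewrite pi0.
    - split.
        rewrite (_ : _ + _ = d - pi * (a * b)); last by field; rewrite pi0.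
        by rewrite vgeB // vge_pi // (vge_le _ (vgeM a0 b0)).
      rewrite (_ : _ + _ = pi^-1 * (a * p - pi^-1 * c)); last by field; rewrite pi0.
      by rewrite vge_piV.
    - by rewrite (_ : _ + _ = p) //; field; rewrite pi0.
    - rewrite (_ : _ + _ = - (pi * (pi * b))); last by field.
      by rewrite vgeN !vge_pi // (vge_le _ b0).
  have a1 : vge 0 (b / d) by rewrite mulrC vgeMl ?invr_neq0 // valV // vd oppr0 subr0.
  have [a ar ac] := rs_ex a1; have a0 := allP rs_vge _ ar.
  exists a => //; eexists; last reflexivity.
  rewrite /stV /lift_gen !mx2M iwahori_mx; split.
  - by rewrite -[RHS]dt; ring.
  - split; first by rewrite (_ : _ + _ = d) //; ring.
    rewrite (_ : _ + _ = - c); last by ring.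
    by rewrite vgeN (vge_le _ c1).
  - rewrite (_ : _ + _ = p - a * c); last by ring.
    by rewrite vgeB // -[0]addr0 vgeM // (vge_le _ c1).
  - rewrite (_ : _ + _ = - (d * (b / d - a))); last by field.
    by rewrite vgeN vgeMl // vd.
by exists a => //; exists j => //; rewrite e mulmxA stK mul1mx.
Qed.

Lemma um_cover s n i : iw i -> exists2 l, all (mem rs) l && (size l == n) &
  exists2 j, iw j & i *m lift_weyl pi (alt s n) = um s l *m j.
Proof.
elim: n s i => [|n IHn] s i ii.
  by exists [::] => //; exists i => //; rewrite /lift_weyl big_nil mulmx1 mul1mx.
have [a ar [j ij e]] := iwahori_st s ii.
have [l /andP[lr /eqP ln] [j' ij' e']] := IHn (~~ s) j ij.
exists (a :: l); first by rewrite /= lr ln eqxx ar.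
exists j' => //; rewrite -mulmxA -e' mulmxA -e -mulmxA; congr (_ *m _).
by rewrite /lift_weyl big_cons.
Qed.

Lemma double_coset_cover s n g : double_coset pi (alt s n) g ->
  exists2 l, all (mem rs) l && (size l == n) & exists2 j, iw j & g = um s l *m j.
Proof.
case=> i [j [ii ij ->]]; have [l lP [j' ij' ->]] := um_cover s n ii.
by exists l => //; exists (j' *m j); rewrite ?mulmxA //; apply: iwahoriM.
Qed.

Lemma double_coset_mulr w g i : iw i -> double_coset pi w g -> double_coset pi w (g *m i).
Proof.
move=> ii [j [j' [ij ij' ->]]]; exists j, (j' *m i); split; rewrite ?mulmxA //.
exact: iwahoriM.
Qed.

Lemma double_coset_uniq x y g : double_coset pi x g -> double_coset pi y g -> x = y.
Proof.
rewrite (weyl_alt x) (weyl_alt y); move: (head _ x) (head _ y) (len x) (len y) => s s' n n'.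
move=> /double_coset_cover[l /andP[lr /eqP <-] [j ij gE]].
move=> /double_coset_cover[l' /andP[lr' /eqP <-] [j' ij' gE']].
have e : um s l *m (j *m invmx j') = um s' l'.
  by rewrite mulmxA -gE gE' mulmxK // iwahori_unit.
have [<- ss] := um_inj (iwahoriM ij (iwahoriV ij')) lr lr' e.
by case: l ss {lr lr' e gE gE'} => [|a l] ss; rewrite ?alt0 // ss.
Qed.
End Cosets.

(** * Sums over the cosets of a Bruhat cell *)
Section Representatives.
Variables (F : nonarchLocalFieldType) (pi : F).
Hypothesis pi_unif : uniformizer pi.

Lemma residue_classE x : [set x + pi * y | y in @integers F] = [set z | vge 1 (z - x)].
Proof.
apply/seteqP; split=> z /=.
  by case=> y y0 <-; rewrite addrAC subrr add0r; apply/(vge1P pi_unif); exists y.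
by move/(vge1P pi_unif) => [y y0 e]; exists y; rewrite // -e addrC subrK.
Qed.

(** One point is chosen in each of the residue classes. *)
Lemma reps_ex q : (residue_field pi #= `I_q)%card -> exists rs : seq F,
  [/\ all (vge 0) rs, {in rs &, forall a b, vge 1 (a - b) -> a = b},
      forall x, vge 0 x -> exists2 a, a \in rs & vge 1 (x - a) & uniq rs /\ size rs = q].
Proof.
move=> cq; have fin : finite_set (residue_field pi) by apply/finite_setP; exists q.
pose X := fset_set (residue_field pi).
have XP (c : set F) : c \in X -> exists2 x, vge 0 x & c = [set z | vge 1 (z - x)].
  rewrite in_fset_set // inE => -[x /integersP x0 <-]; exists x => //.
  exact: residue_classE.
pose r (c : set F) := xget 0 c.
have rP c : c \in X -> vge 0 (r c) /\ c = [set z | vge 1 (z - r c)].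
  move=> /XP[x x0 cE]; have : c (r c).
    by apply: (@xgetPex _ 0 c); exists x; rewrite cE /= subrr vge0.
  rewrite {1}cE /= => rx; split.
    by rewrite -[r c](subrK x) vgeD // (vge_le _ rx).
  rewrite cE; apply/seteqP; split=> z /= zx.
    by rewrite -[z](subrK x) -addrA vgeD // -[x - _]opprB vgeN -cE.
  by rewrite -[z](subrK (r c)) -addrA vgeD // cE.
have rI : {in X &, forall c d, vge 1 (r c - r d) -> c = d}.
  move=> c d /rP[_ cE] /rP[_ dE]; move: cE dE; move: (r c) (r d) => x y -> -> xy.
  apply/seteqP; split=> z /= h.
    by have := vgeD h xy; rewrite addrA subrK.
  by have := vgeB h xy; rewrite opprB addrA subrK.
exists [seq r c | c <- X]; split.
- by apply/allP => _ /mapP[c /rP[r0 _] ->].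
- by move=> _ _ /mapP[c cX ->] /mapP[d dX ->] /rI->.
- move=> x x0; have xX : [set z | vge 1 (z - x)] \in X.
    rewrite in_fset_set // inE; exists x; first exact/integersP.
    exact: residue_classE.
  exists (r [set z | vge 1 (z - x)]); first exact: map_f.
  have [_ e] := rP _ xX; have : [set z | vge 1 (z - x)] x by rewrite /= subrr vge0.
  by rewrite {1}e.
- rewrite size_map; split; last exact: card_fset_set cq.
  rewrite map_inj_in_uniq ?fset_uniq // => c d cX dX rcd.
  by apply: rI; rewrite ?rcd ?subrr ?vge0.
Qed.
End Representatives.

Fixpoint lists (T : Type) (rs : seq T) (n : nat) : seq (seq T) :=
  if n is n'.+1 then [seq a :: l | a <- rs, l <- lists rs n'] else [:: [::]].

Lemma mem_lists (T : eqType) (rs : seq T) n l :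
  (l \in lists rs n) = all (mem rs) l && (size l == n).
Proof.
elim: n l => [|n IHn] l /=; first by case: l => //= a l; rewrite andbF.
apply/allpairsP/idP => [[[a l'] /= [ar]]|].
  by rewrite IHn => /andP[lr /eqP ln] ->; rewrite /= ar lr ln eqxx.
case: l => [//|a l] /= /andP[/andP[ar lr] ln].
by exists (a, l); rewrite /= ar IHn lr.
Qed.

Lemma lists_uniq (T : eqType) (rs : seq T) n : uniq rs -> uniq (lists rs n).
Proof.
move=> ur; elim: n => //= n IHn; rewrite allpairs_uniq // => -[a l] [b k] _ _ /=.
by case=> -> ->.
Qed.

Section CellSums.
Variables (F : nonarchLocalFieldType) (pi : F).
Hypothesis pi_unif : uniformizer pi.
Variables (R : realType) (v : R) (rs : seq F).
Hypothesis rs_vge : all (vge 0) rs.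
Hypothesis rs_inj : {in rs &, forall a b, vge 1 (a - b) -> a = b}.
Hypothesis rs_ex : forall x, vge 0 x -> exists2 a, a \in rs & vge 1 (x - a).
Hypothesis rs_uniq : uniq rs.
Hypothesis rs_size : (size rs)%:R = v ^+ 2.
Local Notation V := (int -> R^o).
Local Notation um := (um pi).
Local Notation umV := (umV pi).
Local Notation stV := (stV pi).

(** One letter at a time, by [lev_stV_same] and [lev_stV_neg]: this identifies the
    Hecke action on functions of the level with the action by convolution. *)
Lemma sum_lists s n (c : V) z : z != 0 ->
  \sum_(l <- lists rs n) c (lev (umV s l *m z)) = Tact (Tlev v) s n c (lev z).
Proof.
elim: n s z => [|n IHn] s z z0; first by rewrite big_seq1 mul1mx.
rewrite [lists _ _]/= big_allpairs_dep.
pose G := Tact (Tlev v) (~~ s) n c.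
transitivity (\sum_(a <- rs) G (lev (stV s a *m z))).
  apply: eq_bigr => a _; rewrite /G -IHn; last by apply: mulmx_inv_neq0 (stK pi_unif s a) z0.
  by apply: eq_bigr => l _; rewrite /= mulmxA.
have csum (x : R) : \sum_(a <- rs) x = v ^+ 2 * x.
  by rewrite big_const_seq iter_addr_0 count_predT -rs_size mulr_natl.
rewrite -[RHS]/(Tlev v s G (lev z)) /Tlev; case: eqP => [pz|/eqP pz].
  have [a0 a00 h] := lev_stV_same pi_unif z0 pz.
  have [a1 a1r a01] := rs_ex a00.
  transitivity (\sum_(a <- rs) (G (lev z) + (if a == a1 then G (lev z + 1) - G (lev z) else 0))).
    apply: eq_big_seq => a ar; rewrite h ?(allP rs_vge) //.
    have -> : vge 1 (a - a0) = (a == a1).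
      apply/idP/eqP => [aa|->]; last by rewrite -opprB vgeN.
      by apply: rs_inj => //; have := vgeD aa a01; rewrite addrA subrK.
    by case: ifP => _; rewrite ?addr0 // addrCA subrr addr0.
  rewrite big_split /= csum (bigD1_seq a1) //= eqxx.
  rewrite big1 ?addr0 => [|b /negPf->] //.
  have key (x y : R) : v ^+ 2 * x + (y - x) = (v ^+ 2 - 1) * x + y by ring.
  exact: key.
transitivity (\sum_(a <- rs) G (lev z - 1)); last exact: csum.
apply: eq_big_seq => a ar; congr G.
apply: (lev_stV_neg pi_unif) => //; first exact: (allP rs_vge).
by case: (parz _) (s) pz => [] [].
Qed.

(** ** Cosets *)
Definition coset (u : 'M[F]_2) : set 'M[F]_2 := [set u *m i | i in iwahori pi].

Lemma coset_id u : coset u u.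
Proof. by exists 1%:M; [apply: iwahori1 | rewrite mulmx1]. Qed.

Lemma coset_mulr u i : iwahori pi i -> coset (u *m i) = coset u.
Proof.
move=> ii; have iu := iwahori_unit pi_unif ii.
apply/seteqP; split=> _ [j ij <-].
  by exists (i *m j); rewrite ?mulmxA //; apply: iwahoriM.
exists (invmx i *m j); first by apply: iwahoriM => //; apply: iwahoriV.
by rewrite -!mulmxA mulKVmx.
Qed.

Lemma um_SL2 s l : SL2 (um s l).
Proof. exact: det_um. Qed.

Lemma invmx_um s l : invmx (um s l) = umV s l.
Proof.
have u : um s l \in unitmx by rewrite unitmxE det_um // unitr1.
by rewrite -[RHS]mul1mx -(mulVmx u) -mulmxA umK // mulmx1.
Qed.

Definition cosets (ys : seq weyl) : seq (set 'M[F]_2) :=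
  [seq coset (um (head false y) l) | y : weyl <- ys, l <- lists rs (len y)].

Lemma coset_inj s l s' l' : all (mem rs) l -> all (mem rs) l' ->
  coset (um s l) = coset (um s' l') -> l = l' /\ (l != [::] -> s = s').
Proof.
move=> lr lr' e; have : coset (um s l) (um s' l') by rewrite e; apply: coset_id.
by case=> j ij ue; apply: (um_inj pi_unif rs_vge rs_inj ij lr lr' ue).
Qed.

Lemma cosets_uniq ys : uniq ys -> uniq (cosets ys).
Proof.
move=> uy; rewrite allpairs_uniq_dep // => [y _|]; first exact: lists_uniq.
move=> _ _ /allpairsPdep[y [l [_ + ->]]] /allpairsPdep[y' [l' [_ + ->]]] /= e.
rewrite !mem_lists => /andP[lr /eqP ly] /andP[lr' /eqP ly'].
have [ll ss] := coset_inj lr lr' e.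
have yy : y = y'.
  rewrite (weyl_alt y) (weyl_alt y') -ly -ly' ll.
  by case: l' ll ss {lr lr' ly ly' e} => [|b l'] ll ss; rewrite ?alt0 // -ss // ll.
by rewrite ll yy.
Qed.

Variable q : nat.
Hypothesis vq : Num.sqrt q%:R = v.
Local Notation C := R[i].

Lemma tfun_cell w x g : double_coset pi x g -> tfun R pi q w g = ratval v (bcoef w x).
Proof.
move=> gx; rewrite /tfun (@fsumT_seq _ _ [:: x]) // => [|y].
  by rewrite big_seq1 vq mem_set // mulr1.
rewrite inE => /eqP yx; rewrite memNset ?mulr0 // => gy.
by apply: yx; apply: (double_coset_uniq pi_unif rs_vge rs_inj rs_ex gy gx).
Qed.

Lemma tfun_out w g : (forall x, ~ double_coset pi x g) -> tfun R pi q w g = 0.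
Proof. by move=> gx; rewrite /tfun fsbig1 // => x _; rewrite memNset ?mulr0. Qed.

Definition ifun (h : 'cV[F]_2 -> C^o) := forall i x, iwahori pi i -> h (i *m x) = h x.

Lemma conv_term_um w h x s l : ifun h -> all (mem rs) l ->
  conv_term pi (tfun R pi q w) h x (coset (um s l)) =
  ((ratval v (bcoef w (alt s (size l))))%:C * h (umV s l *m x))%C.
Proof.
move=> hI lr; rewrite /conv_term ifT; last first.
  by apply/mem_set; exists (um s l) => //; apply: um_SL2.
have : coset (um s l) (xget 1%:M (coset (um s l))).
  by apply: xgetPex; exists (um s l); apply: coset_id.
case=> i ii <-; have iu := iwahori_unit pi_unif ii.
have dc := double_coset_um pi_unif rs_vge s lr.
rewrite (tfun_cell w (double_coset_mulr pi_unif ii dc)); congr (_ * _).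
have uu : um s l \in unitmx by rewrite unitmxE det_um // unitr1.
have -> : invmx (um s l *m i) = invmx i *m umV s l.
  rewrite -invmx_um -[RHS]mul1mx -(mulVmx (_ : um s l *m i \in unitmx)); last first.
    by rewrite unitmx_mul uu iu.
  by rewrite -!mulmxA mulKVmx // mulmxV // mulmx1.
rewrite -mulmxA; apply: hI; exact: iwahoriV.
Qed.

Lemma conv_term_out w h x c : conv_term pi (tfun R pi q w) h x c != 0 ->
  exists y, exists2 l, l \in lists rs (len y) & c = coset (um (head false y) l).
Proof.
rewrite /conv_term; case: ifP; last by rewrite eqxx.
move=> /set_mem[g gS cg] /=.
have : c (xget 1%:M c) by apply: xgetPex; exists g; rewrite -cg; apply: coset_id.
set u := xget _ _ => cu; have uc : c = coset u.
  by move: cu; rewrite -cg => -[i ii <-]; rewrite coset_mulr.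
have [[y yu] _|no] := pselect (exists y, double_coset pi y u); last first.
  by rewrite tfun_out ?mul0r ?eqxx // => y yu; apply: no; exists y.
move: yu; rewrite {1}(weyl_alt y) => /(double_coset_cover pi_unif rs_vge rs_ex)[l lP [j ij uE]].
by exists y; exists l; rewrite ?mem_lists // uc uE coset_mulr.
Qed.
End CellSums.

(** * Unordered sums *)
Lemma sum_sub_uniq (I : eqType) (V : zmodType) (g : I -> V) (s1 s2 : seq I) :
  uniq s1 -> uniq s2 -> {subset s1 <= s2} ->
  \sum_(i <- s2) g i - \sum_(i <- s1) g i = \sum_(i <- s2 | i \notin s1) g i.
Proof.
move=> u1 u2 s12; have p : perm_eq [seq i <- s2 | i \in s1] s1.
  apply: uniq_perm => //; first exact: filter_uniq.
  by move=> i; rewrite mem_filter; case: (boolP (i \in s1)) => // /s12->.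
by rewrite (bigID (mem s1)) /= -big_filter (perm_big _ p) /= addrAC subrr add0r.
Qed.

(** A finite set of indices that contains [S N] lies, up to zero terms, in some
    [S M], so that its sum differs from that over [S N] by a tail of absolute values.
    The bounds [e] make this quantitative. *)
Lemma totally_cvg (I : choiceType) (K : numFieldType) (V : normedModType K)
    (f : I -> V) (S : nat -> seq I) (L : V) (e : nat -> K) (m : nat) :
  (forall N, uniq (S N)) ->
  (forall N M, (N <= M)%N -> {subset S N <= S M}) ->
  (forall i, f i != 0 -> exists N, i \in S N) ->
  (forall N M, (m <= N)%N -> (N <= M)%N ->
     \sum_(i <- S M) `|f i| - \sum_(i <- S N) `|f i| <= e N) ->
  (forall N, (m <= N)%N -> `|\sum_(i <- S N) f i - L| <= e N) ->
  (forall eps, 0 < eps -> exists2 N, (m <= N)%N & e N < eps) ->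
  summability.partial_sum f @ summability.totally --> L.
Proof.
move=> uS sS fS aS lS eS; have FF := @summability.totally_filter I.
apply/cvgrPdist_lt => eps eps0.
have [N mN eN] := eS _ (divr_gt0 eps0 (ltr0n K 2)).
exists [fset i in S N]%fset => // J /= /fsubsetP SJ.
have {}SJ : {subset S N <= J} by move=> i iS; apply: SJ; rewrite in_fset.
rewrite distrC /summability.partial_sum -(big_seq_fsetE _ _ xpredT f) /=.
have [M NM JM] : exists2 M, (N <= M)%N & forall i, i \in J -> f i != 0 -> i \in S M.
  have : forall s : seq I, exists2 M, (N <= M)%N & forall i, i \in s -> f i != 0 -> i \in S M.
    elim=> [|i s [M NM h]]; first by exists N.
    have [fi0|fi0] := eqVneq (f i) 0.
      by exists M => // j; rewrite inE => /orP[/eqP->|/h//]; rewrite fi0 eqxx.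
    have [M' iM'] := fS _ fi0; exists (maxn M M'); first by rewrite leq_max NM.
    move=> j; rewrite inE => /orP[/eqP-> _|js fj]; first by apply: sS iM'; apply: leq_maxr.
    by apply: (sS _ _ (leq_maxl _ _)); apply: h.
  by move=> /(_ (enum_fset J)).
have -> : \sum_(i <- J) f i - L = (\sum_(i <- J) f i - \sum_(i <- S N) f i) + (\sum_(i <- S N) f i - L).
  by rewrite addrA subrK.
apply: le_lt_trans (ler_normD _ _) _.
rewrite (splitr eps); apply: ltr_leD; last exact: le_trans (lS _ mN) (ltW eN).
rewrite sum_sub_uniq ?fset_uniq //.
apply: le_lt_trans (ler_norm_sum _ _ _) _; apply: le_lt_trans eN.
apply: le_trans (aS _ _ mN NM); rewrite sum_sub_uniq //; last exact: sS.
pose s1 := [seq i <- J | (i \notin S N) && (f i != 0)].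
pose s2 := [seq i <- S M | i \notin S N].
have s12 : {subset s1 <= s2}.
  by move=> i; rewrite !mem_filter => /andP[/andP[-> fi] iJ]; apply: JM.
have -> : \sum_(i <- J | i \notin S N) `|f i| = \sum_(i <- s1) `|f i|.
  rewrite big_filter big_mkcondr /=; apply: eq_bigr => i _.
  by case: eqP => //= ->; rewrite normr0.
rewrite -[X in _ <= X]big_filter -subr_ge0 -/s2 sum_sub_uniq ?filter_uniq ?fset_uniq //.
by apply: sumr_ge0.
Qed.

Local Open Scope complex_scope.

(** * Convergence of the convolutions *)
Section ComplexReal.
Variable R : realType.
Local Notation C := R[i].

Lemma normc_real (x : R) : `|x%:C| = `|x|%:C :> C.
Proof.
by rewrite normc_def /= expr0n /= addr0 sqrtr_sqr.
Qed.

Lemma complex_gt0 (eps : C) : 0 < eps -> exists2 e : R, 0 < e & eps = e%:C.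
Proof.
case: eps => [x y]; rewrite ltcE => /andP[/eqP e x0]; exists x => //.
by move: e => /= ->.
Qed.

Lemma geometric_small (v K eps : R) m : 1 < v -> 0 <= K -> 0 < eps ->
  exists2 N, (m < N)%N & K * v ^- N < eps.
Proof.
move=> v1 K0 e0; have v0 : 0 < v by apply: lt_trans v1.
have d0 : 0 < v - 1 by rewrite subr_gt0.
have bern N : N%:R * (v - 1) <= v ^+ N.
  elim: N => [|N IHN]; first by rewrite mul0r.
  rewrite exprS -natr1 mulrDl mul1r.
  have : 1 <= v ^+ N by rewrite exprn_ege1 // ltW.
  nra.
have [N KN] : exists N : nat, K / eps / (v - 1) < N%:R.
  by exists (Num.bound (K / eps / (v - 1))); apply/archi_boundP; rewrite !divr_ge0 // ltW.
exists (N + m).+1; first lia.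
rewrite -[_ ^- _]mul1r mulrA mulr1 ltr_pdivrMr ?exprn_gt0 // mulrC -ltr_pdivrMr //.
apply: lt_le_trans (bern _); rewrite -ltr_pdivrMr //; apply: lt_le_trans KN _.
by rewrite ler_nat; lia.
Qed.
End ComplexReal.

Section GeometricTail.
Variables (R : realType) (v : R).
Hypothesis v1 : 1 < v.
Let v_gt0 : 0 < v. Proof. exact: lt_trans v1. Qed.

Lemma geometric_tail N M : (N <= M)%N ->
  \sum_(N <= j < M) v ^- j.+1 <= v ^- N / (v - 1).
Proof.
have d0 : 0 < v - 1 by rewrite subr_gt0.
have vn n : 0 < v ^- n by rewrite invr_gt0 exprn_gt0.
move=> NM; suff -> : \sum_(N <= j < M) v ^- j.+1 = (v ^- N - v ^- M) / (v - 1).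
  by rewrite ler_pM2r ?invr_gt0 // lerBlDr lerDl ltW.
have t j : v ^- j.+1 = (- (v ^- j.+1 / (v - 1))) - (- (v ^- j / (v - 1))).
  have v0 := lt0r_neq0 v_gt0; have w : v ^+ j != 0 by rewrite expf_neq0.
  by rewrite exprS; field; rewrite v0 w lt0r_neq0.
rewrite (eq_bigr _ (fun j _ => t j)) telescope_sumr // mulrBl opprK addrC //.
Qed.
End GeometricTail.

Section Weighted.
Variables (R : realType) (v : R) (a : bool) (i k : int).
Local Notation Tl := (Tact (Tlev v)).

(** The weight depends on y only through its layer. The element 1 belongs to layer 0,
    but [start] gives it the value 0 or 1 according to a, whence the condition on
    [W 0]. *)
Lemma sum_below (W : nat -> R) N : W 0 = W 1 ->
  \sum_(y <- below a N) W (start a y) * Tl (head false y) (len y) (psi v i) k =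
  \sum_(j < N) W j.+1 * layer v a i j k.
Proof.
move=> W01; rewrite /below big_cat !big_map /= !big_iota0 -big_split /=.
apply: eq_bigr => j _; rewrite /layer mulrDr !len_alt; congr (_ + _).
  rewrite /start len_alt; case: (j : nat) => [|n] /=; last by case: (a).
  by case: (a); rewrite /= ?W01.
by rewrite /start len_alt /= eqxx.
Qed.
End Weighted.

Section Convergence.
Variables (F : nonarchLocalFieldType) (pi : F).
Hypothesis pi_unif : uniformizer pi.
Variables (R : realType) (v : R) (rs : seq F).
Hypothesis rs_vge : all (vge 0) rs.
Hypothesis rs_inj : {in rs &, forall a b, vge 1 (a - b) -> a = b}.
Hypothesis rs_ex : forall x, vge 0 x -> exists2 a, a \in rs & vge 1 (x - a).
Hypothesis rs_uniq : uniq rs.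
Hypothesis rs_size : (size rs)%:R = v ^+ 2.
Variable q : nat.
Hypothesis vq : Num.sqrt q%:R = v.
Hypothesis v1 : 1 < v.
Let v_gt0 : 0 < v. Proof. exact: lt_trans v1. Qed.
Let v0 : v != 0. Proof. exact: lt0r_neq0. Qed.
Local Notation C := R[i].
Local Notation um := (um pi).
Local Notation umV := (umV pi).
Local Notation Tl := (Tact (Tlev v)).
Local Notation tf := (tfun R pi q).
Local Notation psi := (psi v).

(** The Schwartz function with the values of [psi j]; at 0, which has no level, it takes
    the value that makes it locally constant. *)
Definition psiC (j : int) (z : 'cV[F]_2) : C^o := if lattice j z then (v ^ j)%:C else 0.

Lemma psiC_lev j z : z != 0 -> psiC j z = (psi j (lev z))%:C.
Proof. by move=> z0; rewrite /psiC lattice_lev // /psi; case: ifP. Qed.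

Lemma ifun_psiC j : ifun pi (psiC j).
Proof.
move=> g z gi; rewrite /psiC; congr (if _ then _ else _).
apply/idP/idP; last exact: (lattice_iwahori pi_unif gi).
move=> /(lattice_iwahori pi_unif (iwahoriV pi_unif gi)).
by rewrite mulKmx // (iwahori_unit pi_unif gi).
Qed.

Lemma ratval_alt a m y : ratval v (bcoef (alt a m.+1) y) = bval v m.+1 (start a y).
Proof. by rewrite bcoef_alt; apply: ratvalE => //; apply: expands_bser. Qed.

Lemma ratval_1 y : ratval v (bcoef 1%g y) =
  (y == 1%g)%:R - bval v 1 (start false y) - bval v 1 (start true y).
Proof.
rewrite bcoef_1; apply: ratvalE => //.
do 2![apply: expandsB => //; last exact: expands_bser].
have -> : ((y == 1%g)%:R : R) = laurent_eval v (y == 1%g)%:R.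
  by case: eqP => _; rewrite ?eval0 // -vpow0 eval_vpow ?expr0z.
exact: expands_fin.
Qed.

Section Cells.
Variables (w : weyl) (i : int) (z : 'cV[F]_2).
Hypothesis z0 : z != 0.
Local Notation ct := (conv_term pi (tf w) (psiC i) z).
Local Notation W := (fun y => ratval v (bcoef w y)).

Lemma conv_term_cell (y : weyl) l : l \in lists rs (len y) ->
  ct (coset pi (um (head false y) l)) =
  (W y * psi i (lev (umV (head false y) l *m z)))%:C.
Proof.
rewrite mem_lists => /andP[lr /eqP ln].
rewrite (conv_term_um pi_unif rs_vge rs_inj rs_ex vq) //; last exact: ifun_psiC.
rewrite ln -weyl_alt psiC_lev ?rmorphM //.
by apply: mulmx_inv_neq0 (umK pi_unif _ _) z0.
Qed.

Lemma sum_cosets ys : \sum_(c <- cosets pi rs ys) ct c =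
  (\sum_(y <- ys) W y * Tl (head false y) (len y) (psi i) (lev z))%:C.
Proof.
rewrite big_allpairs_dep rmorph_sum; apply: eq_bigr => y _ /=.
rewrite -(sum_lists pi_unif rs_vge rs_inj rs_ex rs_uniq rs_size) // mulr_sumr rmorph_sum.
by apply: eq_big_seq => l /conv_term_cell.
Qed.

Lemma sum_cosets_norm ys : \sum_(c <- cosets pi rs ys) `|ct c| =
  (\sum_(y <- ys) `|W y| * Tl (head false y) (len y) (psi i) (lev z))%:C.
Proof.
rewrite big_allpairs_dep rmorph_sum; apply: eq_bigr => y _ /=.
rewrite -(sum_lists pi_unif rs_vge rs_inj rs_ex rs_uniq rs_size) // mulr_sumr rmorph_sum.
apply: eq_big_seq => l /conv_term_cell->; rewrite [LHS]normc_real normrM.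
by congr (_ * _)%:C; apply: ger0_norm; apply: nneg_psi.
Qed.
End Cells.

(** On a union of cells, the sum and the absolute sum of the terms of the convolution
    are sums over the layers, to which [lsum_limit] and [layer_bound] apply. *)
Lemma conv_alt a m i : is_conv pi (tf (alt a m.+1)) (psiC i)
  (fun z => (Jstr psi a m.+1 i (lev z))%:C).
Proof.
move=> z z0; set k := lev z.
(* K v^-N bounds both the distance to the limit and the tail of the absolute sums. *)
pose K := limit_const v k m.+1 + layer_const v k m.+1 / (v - 1).
have vn n : 0 < v ^- n by rewrite invr_gt0 exprn_gt0.
have d0 : 0 < v - 1 by rewrite subr_gt0.
have b0 : 0 <= bbound v m.+1 by exact: normr_ge0.
have s0 : 0 <= strbound v k := strbound_ge0 v1 k.
have c0 : 0 <= Cbound v k := Cbound_ge0 v1 k.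
have L0 : 0 <= layer_const v k m.+1 by rewrite mulr_ge0.
have l0 : 0 <= limit_const v k m.+1 by rewrite !addr_ge0 // mulr_ge0.
have D0 : 0 <= layer_const v k m.+1 / (v - 1) by rewrite divr_ge0 // ltW.
have sumE (W : nat -> R) N : W 0 = W 1 ->
    \sum_(y <- below a N) W (start a y) * Tl (head false y) (len y) (psi i) k =
    \sum_(j < N) W j.+1 * layer v a i j k by exact: sum_below.
apply: (@totally_cvg _ _ _ _ (fun N => cosets pi rs (below a N)) _
  (fun N => (K * v ^- N)%:C) m.+1).
- by move=> N; apply: (cosets_uniq pi_unif rs_vge rs_inj rs_uniq); apply: below_uniq.
- move=> N M NM c /allpairsPdep[y [l [yN lN ->]]]; apply/allpairsPdep; exists y, l.
  split=> //; move: yN NM; case: N => [//|N]; case: M => [|M]; first by rewrite ltn0.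
  rewrite !mem_below ltnS => /orP[/eqP->|yN] NM.
    move: NM; rewrite leq_eqVlt => /orP[/eqP->|NM]; first by rewrite eqxx.
    by rewrite len_alt NM orbT.
  by apply/orP; right; rewrite ltnS (leq_trans yN).
- move=> c /(conv_term_out pi_unif rs_vge rs_ex)[y [l ly ->]]; exists (len y).+1.
  by apply/allpairsPdep; exists y, l; split=> //; rewrite mem_below ltnSn orbT.
- move=> N M mN NM; rewrite !sum_cosets_norm //.
  under eq_bigr => y _ do rewrite ratval_alt.
  under [X in _ - X%:C]eq_bigr => y _ do rewrite ratval_alt.
  rewrite !(sumE (fun s => `|bval v m.+1 s|)) ?bval01 // -rmorphB lecR.
  rewrite -!(big_mkord xpredT (fun j => `|bval v m.+1 j.+1| * layer v a i j k)).
  rewrite (big_cat_nat (leq0n N) NM) /= addrAC subrr add0r.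
  apply: (@le_trans _ _ (\sum_(N <= j < M) layer_const v k m.+1 * v ^- j.+1)).
    by apply: ler_sum_nat => j /andP[Nj _]; apply: layer_bound (leq_trans (leq_trans mN Nj) _).
  rewrite -mulr_sumr; apply: le_trans (ler_wpM2l L0 (geometric_tail v1 NM)) _.
  by rewrite mulrA mulrAC; apply: ler_wpM2r; [exact: ltW | rewrite /K lerDr].
- move=> N mN; rewrite sum_cosets //.
  under eq_bigr => y _ do rewrite ratval_alt.
  rewrite (sumE (bval v m.+1)) ?bval01 // -rmorphB normc_real lecR.
  apply: le_trans (lsum_limit v1 a i k _) _ => //.
  by apply: ler_wpM2r; [exact: ltW | rewrite /K lerDl].
- move=> eps /complex_gt0[e e0 ->].
  have [N mN KN] := geometric_small m v1 (addr_ge0 l0 D0) e0.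
  by exists N; rewrite ?ltcR.
Qed.

(** phi^-1(t_1) = C_1 - phi^-1(t_(s_0)) - phi^-1(t_(s_1)): as a function on G, t_1
    is the unit of the Hecke algebra minus t_(s_0) and t_(s_1). *)
Lemma conv_term_1 i z c : z != 0 ->
  conv_term pi (tf 1%g) (psiC i) z c = (if c == coset pi 1%:M then psiC i z else 0)
    - conv_term pi (tf (alt false 1)) (psiC i) z c
    - conv_term pi (tf (alt true 1)) (psiC i) z c.
Proof.
move=> z0.
have [[y [l ly ->]]|no] := pselect (exists y : weyl, exists2 l,
    l \in lists rs (len y) & c = coset pi (um (head false y) l)); last first.
  have out w : conv_term pi (tf w) (psiC i) z c = 0.
    by apply/eqP/negP => /negP/(conv_term_out pi_unif rs_vge rs_ex).
  rewrite !out !subr0 ifN //; apply: contra_notN no => /eqP->.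
  by exists 1%g, [::].
rewrite (conv_term_cell 1%g i z0 ly) (conv_term_cell (alt false 1) i z0 ly).
rewrite (conv_term_cell (alt true 1) i z0 ly) ratval_1 !ratval_alt.
have -> : (coset pi (um (head false y) l) == coset pi 1%:M) = (y == 1%g).
  have := ly; rewrite mem_lists => /andP[lr /eqP ln].
  apply/eqP/eqP => [e|y1]; last first.
    by move: ln; rewrite y1 => /size0nil->.
  have [l0 _] := @coset_inj _ _ pi_unif _ rs_vge rs_inj _ _ false [::] lr isT e.
  by rewrite (weyl_alt y) -ln l0 alt0.
rewrite !mulrBl !rmorphB; congr (_ - _ - _).
have [y1|_] := eqVneq y 1%g; last by rewrite mul0r.
by move: ly; rewrite y1 inE => /eqP->; rewrite mul1r mul1mx psiC_lev.
Qed.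

Lemma conv_bas w i : is_conv pi (tf w) (psiC i) (fun z => (Jbas psi w i (lev z))%:C).
Proof.
rewrite (weyl_alt w); move: (head _ _) (len w) => a [|m]; last first.
  by rewrite Jbas_alt; apply: conv_alt.
move=> z z0; rewrite alt0 Jbas1.
have c0 := @conv_alt false 0 i z z0; have c1 := @conv_alt true 0 i z z0.
pose d (c : set 'M[F]_2) : C^o := if c == coset pi 1%:M then psiC i z else 0.
have FF := @summability.totally_filter (set 'M[F]_2).
have cd : summability.partial_sum d @ summability.totally --> psiC i z.
  apply: cvg_near_cst.
  exists [fset coset pi 1%:M]%fset => // J /= /fsubsetP sJ.
  have J1 : coset pi 1%:M \in J by apply: sJ; rewrite inE.
  rewrite /summability.partial_sum -(big_seq_fsetE _ _ xpredT d) /= (big_fsetD1 _ J1) /=.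
  rewrite {1}/d eqxx big1_fset ?addr0 // => c.
  by rewrite !inE => /andP[/negPf cn _] _; rewrite /d cn.
have -> : ((0 : int -> R^o) (lev z))%:C = psiC i z - (Jstr psi false 1 i (lev z))%:C
    - (Jstr psi true 1 i (lev z))%:C :> C.
  rewrite psiC_lev // /Jstr !str1 mulr1z.
  by case: (parz i); rewrite /= ?subr0 subrr.
have e : summability.partial_sum (conv_term pi (tf 1%g) (psiC i) z) =
    (fun J => summability.partial_sum d J
      - summability.partial_sum (conv_term pi (tf (alt false 1)) (psiC i) z) J
      - summability.partial_sum (conv_term pi (tf (alt true 1)) (psiC i) z) J).
  apply/funext => J; rewrite /summability.partial_sum -!sumrB.
  by apply: eq_bigr => c _; rewrite conv_term_1.
rewrite e; have := cvgB (cvgB cd c0) c1; by apply.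
Qed.
End Convergence.

(** * Topology of F^2 *)
Section LocalTopology.
Variable F : nonarchLocalFieldType.
Implicit Types x y : F.

Lemma nbhs_vge x (A : set F) :
  nbhs x A <-> exists n, forall y, vge n (y - x) -> A y.
Proof.
rewrite nbhs_val; split.
  case=> n _ nA; exists n => y; rewrite /vge subr_eq0 => xy; apply: nA => /=.
  by case/orP: xy => [/eqP->|]; [left|right].
case=> n nA; exists n => // y yx; apply: nA; rewrite /vge subr_eq0.
by case: yx => [->|->]; rewrite ?eqxx ?orbT.
Qed.

Lemma latticeE i : exists m n : int, forall z : 'cV[F]_2,
  lattice i z = vge m (z 1 0) && vge n (z 0 0).
Proof.
pose k := (i %/ 2)%Z.
have [iE|iE] : i = 2 * k \/ i = 2 * k + 1 by rewrite /k; lia.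
  by exists k, k => z; rewrite /lattice /vge; congr ((_ || _) && (_ || _)); rewrite iE; lia.
by exists (k + 1), k => z; rewrite /lattice /vge; congr ((_ || _) && (_ || _)); rewrite iE; lia.
Qed.

Lemma latticeD i (z t : 'cV[F]_2) : lattice i z -> lattice i t -> lattice i (z + t).
Proof.
have [m [n e]] := latticeE i; rewrite !e !mxE => /andP[a b] /andP[c d].
by rewrite !vgeD.
Qed.

Lemma latticeN i (z : 'cV[F]_2) : lattice i (- z) = lattice i z.
Proof. by have [m [n e]] := latticeE i; rewrite !e !mxE !vgeN. Qed.

Lemma lattice_sub i (z t : 'cV[F]_2) : lattice i (t - z) -> lattice i t = lattice i z.
Proof.
move=> h; apply/idP/idP => k; last by have := latticeD h k; rewrite subrK.
by rewrite -latticeN in h; have := latticeD h k; rewrite opprB subrK.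
Qed.

Lemma lattice2 n (z : 'cV[F]_2) : lattice (2 * n) z = vge n (z 1 0) && vge n (z 0 0).
Proof. by rewrite /lattice /vge; congr ((_ || _) && (_ || _)); lia. Qed.

Lemma lattice0 i : lattice i (0 : 'cV[F]_2).
Proof. by rewrite /lattice !mxE eqxx. Qed.

Lemma lattice_le i j (z : 'cV[F]_2) : i <= j -> lattice j z -> lattice i z.
Proof.
rewrite /lattice => ij /andP[/orP[->|h] /orP[->|h']] //=; rewrite ?andbT.
- by rewrite (le_trans ij) ?orbT.
- by rewrite (le_trans ij) ?orbT.
- by rewrite !(le_trans ij) ?orbT.
Qed.

Lemma ord2 (i : 'I_2) : i = 0 \/ i = 1.
Proof. by case: i => [[|[|//]] ?]; [left|right]; apply: val_inj. Qed.

(** Every lattice contains a product of two equal balls, and conversely. *)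
Lemma nbhs_lattice (z : 'cV[F]_2) (A : set 'cV[F]_2) :
  nbhs z A <-> exists n, forall t, lattice n (t - z) -> A t.
Proof.
split=> [[P zP PA]|[n nA]].
  have [n0 P0] : exists n, forall y, vge n (y - z 0 0) -> P 0 0 y by apply/nbhs_vge.
  have [n1 P1] : exists n, forall y, vge n (y - z 1 0) -> P 1 0 y by apply/nbhs_vge.
  exists (2 * Num.max n0 n1) => t; rewrite lattice2 !mxE => /andP[t1 t0]; apply: PA.
  move=> i j; rewrite (ord1 j); case: (ord2 i) => ->.
    by apply: P0; apply: vge_le t0; rewrite le_max lexx.
  by apply: P1; apply: vge_le t1; rewrite le_max lexx orbT.
have [m [k e]] := latticeE n.
exists (fun i _ => [set y | vge (Num.max m k) (y - z i 0)]%classic) => [i j|t tP].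
  by rewrite (ord1 j); apply/nbhs_vge; exists (Num.max m k).
apply: nA; rewrite e !mxE; apply/andP; split.
  by apply: vge_le (tP 1 0); rewrite le_max lexx.
by apply: vge_le (tP 0 0); rewrite le_max lexx orbT.
Qed.

(** The defining property of ultrafilters, in a form that passes to images under any
    map. *)
Definition dichotomy (T : Type) (U : set_system T) := forall A, U A \/ U (~` A).

Lemma dichotomy_finite (T : Type) (U : set_system T) (I : eqType) (s : seq I) (P : I -> set T) :
  ProperFilter U -> dichotomy U -> U [set x | exists2 a, a \in s & P a x] ->
  exists2 a, a \in s & U (P a).
Proof.
move=> PU dU; elim: s => [|a s IHs] Us.
  have U0 : U set0 by apply: filterS Us => x [].
  by have [] := filter_ex U0.
have [Ua|Ua] := dU (P a); first by exists a; rewrite ?mem_head.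
have [|b bs Ub] := IHs; last by exists b; rewrite // inE bs orbT.
apply: filterS2 Us Ua => x [b]; rewrite inE => /orP[/eqP->|bs] Pb //= _.
by exists b.
Qed.

Variables (pi : F) (rs : seq F).
Hypothesis pi_unif : uniformizer pi.
Hypothesis rs_ex : forall x, vge 0 x -> exists2 a, a \in rs & vge 1 (x - a).

Lemma pow_val (n : int) : exists2 x : F, x != 0 & valuation x = n.
Proof.
have p0 := pi_neq0 pi_unif; have vp := val_pi pi_unif.
have pos (k : nat) : exists2 x : F, x != 0 & valuation x = k.
  elim: k => [|k [x x0 vx]]; first by exists 1; rewrite ?oner_neq0 // val_one.
  by exists (pi * x); rewrite ?mulf_neq0 // Defs.valM // vp vx; lia.
case: n => k; first exact: pos.
have [x x0 vx] := pos k.+1; exists x^-1; rewrite ?invr_neq0 // valV // vx; lia.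
Qed.

(** As the residue field is finite, the filter contains arbitrarily small balls, whose
    centers form a Cauchy sequence. *)
Lemma ball_ultra (U : set_system F) n : ProperFilter U -> dichotomy U ->
  U [set y | vge n y] -> exists l : F, U --> l.
Proof.
move=> PU dU Un.
have balls (k : nat) : exists x, U [set y | vge (n + k%:Z) (y - x)].
  elim: k => [|k [x Ux]]; first by exists 0; rewrite (addr0 n); apply: filterS Un => y ny; rewrite /= subr0.
  have [t t0 vt] := pow_val (n + k%:Z).
  have [|a ar Ua] := @dichotomy_finite _ _ _ rs
      (fun a => [set y | vge (n + k.+1%:Z) (y - (x + t * a))]) PU dU.
    apply: filterS Ux => y /= yx.
    have d0 : vge 0 ((y - x) / t).
      by rewrite mulrC vgeMl ?invr_neq0 // valV // opprK vt add0r.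
    have [a ar h] := rs_ex d0; exists a => //.
    have -> : y - (x + t * a) = t * ((y - x) / t - a).
      by rewrite mulrBr [t * (_ / _)]mulrC divfK // opprD addrA.
    by rewrite vgeMl // vt (_ : _ - _ = 1) //; lia.
  by exists (x + t * a).
have [u uP] := choice balls.
have near_u i j k : k <= n + i%:Z -> k <= n + j%:Z -> vge k (u i - u j).
  move=> ki kj; have [y [yi yj]] := filter_ex (filterI (uP i) (uP j)).
  have -> : u i - u j = (y - u j) - (y - u i) by rewrite opprB [RHS]addrC addrA subrK.
  by rewrite vgeB //; [apply: vge_le yj | apply: vge_le yi].
have [l ul] : exists l : F, u @ \oo --> l.
  apply: val_complete => k; exists `|k - n|%N => i j ki kj.
  have hi : k <= n + i%:Z by lia.
  have hj : k <= n + j%:Z by lia.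
  have := near_u i j k hi hj; rewrite /vge subr_eq0.
  by case/orP => [/eqP->|]; [left|right].
exists l => A /nbhs_vge[k kA].
have [N _ NP] : \forall i \near \oo, vge k (u i - l).
  by apply: (ul [set y | vge k (y - l)]); apply/nbhs_vge; exists k.
pose M := (N + `|k - n|)%N.
have Mk : vge k (u M - l) by apply: NP; rewrite /= /M leq_addr.
apply: filterS (uP M) => y /= yM; apply: kA.
have := vgeD (vge_le _ yM) Mk; rewrite addrA subrK; apply; rewrite /M; lia.
Qed.

(** An ultrafilter converges as soon as its images under both coordinates do. *)
Lemma compact_lattice i : compact [set z : 'cV[F]_2 | lattice i z].
Proof.
rewrite compact_ultra => U UU Ui; have PU := @ultra_proper _ _ UU.
have [m [n e]] := latticeE i.
have dU A : U A \/ U (~` A) by exact: in_ultra_setVsetC.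
pose ev j : set_system F := fmap (fun z : 'cV[F]_2 => z j 0) U.
have [l0 U0] : exists l : F, ev 0 --> l.
  apply: (@ball_ultra _ n); first by move=> A; apply: dU.
  have : U [set z : 'cV[F]_2 | vge n (z 0 0)] by apply: filterS Ui => z /=; rewrite e => /andP[].
  exact.
have [l1 U1] : exists l : F, ev 1 --> l.
  apply: (@ball_ultra _ m); first by move=> A; apply: dU.
  have : U [set z : 'cV[F]_2 | vge m (z 1 0)] by apply: filterS Ui => z /=; rewrite e => /andP[].
  exact.
have UP : U --> (cv l0 l1 : 'cV[F]_2).
  move=> A [P P1 PA].
  have V0 : U [set z : 'cV[F]_2 | P 0 0 (z 0 0)] by apply: U0; have := P1 0 0; rewrite cvE.
  have V1 : U [set z : 'cV[F]_2 | P 1 0 (z 1 0)] by apply: U1; have := P1 1 0; rewrite cvE.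
  apply: filterS2 V0 V1 => z z0 z1; apply: PA => j k; rewrite (ord1 k).
  by case: (ord2 j) => ->.
exists (cv l0 l1); split=> //=.
have Ul : U [set z : 'cV[F]_2 | lattice i (z - cv l0 l1)].
  by apply: UP; apply/nbhs_lattice; exists i.
have [z [zi zl]] := filter_ex (filterI Ui Ul).
by rewrite -(lattice_sub zl).
Qed.
End LocalTopology.

(** * The space of invariant Schwartz functions *)
Section Levels.
Variables (F : nonarchLocalFieldType) (pi : F).
Hypothesis pi_unif : uniformizer pi.

(** A diagonal element with unit entries adjusts the dominant coordinate, and a root
    element the other one. *)
Lemma lev_transitive z t : z != 0 -> t != 0 -> lev z = lev t ->
  exists2 g, iwahori pi g & t = g *m z.
Proof.
have sw (x y : F) : cv x y != 0 -> (y, x) != (0, 0) by rewrite cv_eq0 !xpair_eqE andbC.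
rewrite [z]cv_eta [t]cv_eta /lev !cvE.
move: (z 0 0) (z 1 0) (t 0 0) (t 1 0) => o m o' m' /sw mo /sw mo'.
have vinv (x y : F) : x != 0 -> y != 0 -> valuation x = valuation y -> vge 0 (x / y).
  by move=> x0 y0 xy; rewrite mulrC vgeMl ?invr_neq0 // valV // opprK add0r -xy vge_val.
case: (boolP (parz (lev0 m o))) => p e.
  have p' : parz (lev0 m' o') by rewrite -e.
  have [o0 om lE] := lev0_odd mo p; have [o0' om' lE'] := lev0_odd mo' p'.
  have vo : valuation o = valuation o' by move: e; rewrite lE lE'; clear; lia.
  exists (mx2 (o' / o) 0 ((m' - o / o' * m) / o) (o / o')); last first.
    by rewrite mx2_cv; congr cv; field; rewrite ?o0 ?o0'.
  apply/(iwahori_mx pi_unif); split.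
  - by field; rewrite o0 o0'.
  - by split; [apply: vinv | apply: vge0].
  - exact: vinv.
  - rewrite mulrC vgeMl ?invr_neq0 // valV // opprK [1 + _]addrC vgeB ?vo //.
    by rewrite -[_ + 1]add0r vgeM ?vinv // -vo.
have p' : ~~ parz (lev0 m' o') by rewrite -e.
have [m0 om lE] := lev0_even mo p; have [m0' om' lE'] := lev0_even mo' p'.
have vm : valuation m = valuation m' by move: e; rewrite lE lE'; clear; lia.
exists (mx2 (m / m') ((o' - m / m' * o) / m) 0 (m' / m)); last first.
  by rewrite mx2_cv; congr cv; field; rewrite ?m0 ?m0'.
apply/(iwahori_mx pi_unif); split.
- by field; rewrite m0 m0'.
- split; first exact: vinv.
  rewrite mulrC vgeMl ?invr_neq0 // valV // opprK add0r vgeB ?vm //.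
  by rewrite -[valuation m']add0r vgeM ?vinv // -vm.
- exact: vinv.
- exact: vge0.
Qed.

Lemma lev_surj n : exists2 z : 'cV[F]_2, z != 0 & lev z = n.
Proof.
have [x x0 vx] := pow_val pi_unif (n %/ 2)%Z.
have [nE|nE] : n = 2 * (n %/ 2)%Z \/ n = 2 * (n %/ 2)%Z + 1 by lia.
  exists (cv 0 x); first by rewrite cv_eq0 xpair_eqE (negPf x0) andbF.
  by rewrite /lev !cvE lev0E_even ?vge0 // vx -nE.
exists (cv x 0); first by rewrite cv_eq0 xpair_eqE (negPf x0).
by rewrite /lev !cvE lev0E_odd ?vge0 // vx -nE.
Qed.

End Levels.

Section Schwartz.
Variables (F : nonarchLocalFieldType) (pi : F) (R : realType).
Local Notation S := (schwartzT R pi).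

Lemma schwartz_near0 (h : S) : exists n, forall z, lattice n z -> h z = h 0.
Proof.
have /schwartzbP[lc _ _] := valP h.
have /nbhs_lattice[n nP] := lc 0; exists n => z zn; apply: nP.
by rewrite subr0.
Qed.

(** The open lattices are nested and cover F^2, so one of them contains the compact
    support. *)
Lemma schwartz_support (h : S) : exists n, forall z, h z != 0 -> lattice n z.
Proof.
have /schwartzbP[_ /compact_near_coveringP cc _] := valP h.
have [|N _ NP] := cc nat \oo (fun (n : nat) z => lattice (- n%:Z) z) _ _.
  move=> x _; pose n := if x == 0 then 0%N else `|lev x|%N.
  have xn : lattice (- n%:Z) x.
    rewrite /n; case: (eqVneq x 0) => [->|x0]; first exact: lattice0.
    rewrite lattice_lev //; lia.
  exists ([set z | lattice (- n%:Z) (z - x)], [set k | (n <= k)%N]).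
    by split; [apply/nbhs_lattice; exists (- n%:Z) | exists n].
  move=> [z k] /= [zx nk]; apply: (@lattice_le _ _ (- n%:Z)); first lia.
  by rewrite (lattice_sub zx).
exists (- N%:Z) => z hz; apply: (NP N) => //=.
exact: subset_closure.
Qed.
Hypothesis pi_unif : uniformizer pi.
Variable rs : seq F.
Hypothesis rs_ex : forall x, vge 0 x -> exists2 a, a \in rs & vge 1 (x - a).
Variable v : R.
Local Notation C := R[i].
Local Notation psiC := (psiC v).

(** Lattices are open and compact subgroups. *)
Lemma schwartz_psiC j : schwartz pi (psiC j : 'cV[F]_2 -> C^o).
Proof.
split.
- move=> x; apply/nbhs_lattice; exists j => y xy.
  by rewrite /psiC (lattice_sub xy).
- apply: (subclosed_compact _ (compact_lattice pi_unif rs_ex (i := j))).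
    exact: closed_closure.
  move=> z zc; have /zc[t [tj tz]] : nbhs z [set t : 'cV[F]_2 | lattice j (t - z)].
    by apply/nbhs_lattice; exists j.
  rewrite /= -(lattice_sub tz); move: tj; rewrite /= /psiC.
  by case: ifP; rewrite ?eqxx.
- by move=> i x; apply: ifun_psiC.
Qed.

Definition PsiS j : S := Schwartz (introT (schwartzbP _ _) (schwartz_psiC j)).
End Schwartz.

(** * The representation *)
Lemma raddf_Jbas (V W : zmodType) (phi : {additive V -> W}) (f : int -> V) x i :
  phi (Jbas f x i) = Jbas (phi \o f) x i.
Proof.
rewrite /Jbas /Jstr; case: ifP => _; last exact: raddf0.
by rewrite raddfMz /str raddf_sum.
Qed.

Lemma sum_differences (V : zmodType) (d : int -> V) (lo : int) N n :
  \sum_(j < N) (if lo + j%:Z <= n then d (lo + j%:Z) - d (lo + j%:Z - 1) else 0) =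
  if n < lo then 0 else d (Num.min n (lo + N%:Z - 1)) - d (lo - 1).
Proof.
elim: N => [|N IHN].
  rewrite big_ord0; case: ltP => // ln; rewrite min_r ?addr0 ?subrr //; lia.
rewrite big_ord_recr /= IHN; have [nl|ln] := ltP n lo.
  have nN : ~~ (lo + N%:Z <= n) by clear IHN; lia.
  by rewrite (negPf nN) addr0.
have -> : lo + N.+1%:Z - 1 = lo + N%:Z by clear IHN; lia.
have [nN|nN] := leP (lo + N%:Z) n.
  have nN' : lo + N%:Z - 1 <= n by clear IHN; lia.
  by rewrite (min_r nN') [LHS]addrC addrA subrK.
have nN' : n <= lo + N%:Z - 1 by clear IHN; lia.
by rewrite addr0 (min_l nN').
Qed.

Section Representation.
Variables (F : nonarchLocalFieldType) (pi : F).
Hypothesis pi_unif : uniformizer pi.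
Variables (R : realType) (v : R) (rs : seq F).
Hypothesis rs_vge : all (vge 0) rs.
Hypothesis rs_inj : {in rs &, forall a b, vge 1 (a - b) -> a = b}.
Hypothesis rs_ex : forall x, vge 0 x -> exists2 a, a \in rs & vge 1 (x - a).
Hypothesis rs_uniq : uniq rs.
Hypothesis rs_size : (size rs)%:R = v ^+ 2.
Variable q : nat.
Hypothesis vq : Num.sqrt q%:R = v.
Hypothesis v1 : 1 < v.
Let v_gt0 : 0 < v. Proof. exact: lt_trans v1. Qed.
Let v0 : v != 0. Proof. exact: lt0r_neq0. Qed.
Local Notation C := R[i].
Local Notation psiC := (psiC v).
Local Notation S := (schwartzT R pi).
Local Notation M := {malg C[int]}.
Local Notation PsiS := (PsiS pi_unif rs_ex v).

Definition schwartz_of : {linear M -> S} := linext PsiS.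

Lemma schwartz_ofU j : schwartz_of << j >> = PsiS j.
Proof. exact: linextU. Qed.

Definition evS (z : 'cV[F]_2) (x : M) : C := schwartz_of x z.

Fact evS_is_linear z : linear_for *%R (evS z).
Proof. by move=> c x y; rewrite /evS linearP. Qed.
HB.instance Definition _ z := GRing.isLinear.Build C M C _ (evS z) (evS_is_linear z).

Lemma evSE z x : evS z x = \sum_(k <- msupp x) x@_k * psiC k z.
Proof.
rewrite {1}[x]monalgE linear_sum; apply: eq_bigr => k _.
by rewrite malgUZ linearZ /= /evS schwartz_ofU.
Qed.

Lemma evS_level z n x : z != 0 -> lev z = n ->
  evS z x = \sum_(k <- msupp x) (if k <= n then x@_k * (v ^ k)%:C else 0).
Proof.
move=> z0 <-; rewrite evSE; apply: eq_bigr => k _.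
by rewrite /psiC lattice_lev //; case: ifP => _; rewrite ?mulr0.
Qed.

(** The values at levels n and n - 1 differ by v^n times the coefficient of
    index n. *)
Lemma schwartz_of_inj : injective schwartz_of.
Proof.
apply/raddf_inj => x x0; apply/malgP => n; rewrite mcoeff0.
have [z z0 zn] := lev_surj pi_unif n.
have [t t0 tn] := lev_surj pi_unif (n - 1).
have e0 y : evS y x = 0 by rewrite /evS x0.
have : evS z x - evS t x = x@_n * (v ^ n)%:C.
  rewrite (evS_level _ z0 zn) (evS_level _ t0 tn) -sumrB.
  have [nx|nx] := boolP (n \in msupp x); last first.
    rewrite mcoeff_outdom // mul0r big_seq big1 // => k kx.
    have kn : (k <= n - 1) = (k <= n).
      have : k != n by apply: contraNneq nx => <-.
      lia.
    by rewrite kn subrr.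
  rewrite (big_fsetD1 _ nx) /= lexx ifF ?subr0; last by lia.
  rewrite big1_fset ?addr0 // => k; rewrite !inE => /andP[kn _] _.
  have -> : (k <= n - 1) = (k <= n) by lia.
  by rewrite subrr.
rewrite !e0 subr0 => /esym/eqP; rewrite mulf_eq0 => /orP[/eqP//|].
by rewrite fmorph_eq0 (negPf (expfz_neq0 n v0)).
Qed.

(** A Schwartz function h depends on the level only, vanishes on low levels and takes
    the value h 0 on high levels; it is the sum of its finitely many jumps. *)
Lemma schwartz_of_surj (h : S) : exists x, schwartz_of x = h.
Proof.
have [n1 near0] := schwartz_near0 h; have [n2 supp] := schwartz_support h.
pose b := (`|n1| + `|n2|)%N.
have hI : forall i z, iwahori pi i -> h (i *m z) = h z by have /schwartzbP[] := valP h.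
(* The value of h at level n. *)
pose d n : C := h (xget 0 [set z | z != 0 /\ lev z = n]).
have dE z : z != 0 -> h z = d (lev z).
  move=> z0; rewrite /d; set t := xget _ _.
  have [t0 tz] : [set z' | z' != 0 /\ lev z' = lev z] t by apply: xgetPex; exists z.
  by have [g gI ->] := lev_transitive pi_unif z0 t0 (esym tz); rewrite hI.
have dlo n : n < - b%:Z -> d n = 0.
  have [z z0 <-] := lev_surj pi_unif n; rewrite -dE // => nb.
  apply/eqP; apply: contraTT nb => /supp; rewrite lattice_lev // /b -leNgt; lia.
have dhi n : b%:Z <= n -> d n = h 0.
  have [z z0 <-] := lev_surj pi_unif n; rewrite -dE // => nb.
  by apply: near0; rewrite lattice_lev // (le_trans _ nb) // /b; lia.
pose x : M := \sum_(j < (b + b).+1)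
  ((v ^ (- b%:Z + j%:Z))%:C^-1 * (d (- b%:Z + j%:Z) - d (- b%:Z + j%:Z - 1))) *: << - b%:Z + j%:Z >>.
exists x; apply/val_inj/funext => z /=.
have -> : schwartz_of x z = \sum_(j < (b + b).+1)
    (if lattice (- b%:Z + j%:Z) z then d (- b%:Z + j%:Z) - d (- b%:Z + j%:Z - 1) else 0).
  rewrite -[LHS]/(evS z x) linear_sum; apply: eq_bigr => j _.
  rewrite linearZ /= /evS schwartz_ofU /= /psiC.
  case: ifP => _; last by rewrite mulr0.
  by rewrite mulrAC mulVf ?mul1r // fmorph_eq0 expfz_neq0.
have lohi : - b%:Z + (b + b).+1%:Z - 1 = b%:Z by lia.
have [->|z0] := eqVneq z 0.
  have := sum_differences d (- b%:Z) (b + b).+1 b%:Z.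
  have blo : - b%:Z - 1 < - b%:Z by clear; lia.
  have bb : (b%:Z < - b%:Z) = false by clear; lia.
  rewrite lohi minxx bb (dlo _ blo) (dhi _ (lexx _)) subr0.
  move=> <-; apply: eq_bigr => j _.
  by rewrite lattice0 ifT //; have := ltn_ord j; clear; lia.
under eq_bigr => j _ do rewrite lattice_lev //.
rewrite sum_differences lohi dE //; case: ltP => [/dlo->//|bz].
rewrite (dlo (_ - 1)) ?subr0; last by clear; lia.
by have [//|bz'] := leP (lev z) b%:Z; rewrite !dhi // ltW.
Qed.

Lemma conv_linear f (h1 h2 k1 k2 : S) (c : C) :
  is_conv pi f h1 k1 -> is_conv pi f h2 k2 ->
  is_conv pi f (c *: h1 + h2 : S) (c *: k1 + k2 : S).
Proof.
move=> c1 c2 z z0; have FF := @summability.totally_filter (set 'M[F]_2).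
have -> : summability.partial_sum (conv_term pi f (c *: h1 + h2 : S) z) =
    (fun J => c *: summability.partial_sum (conv_term pi f h1 z) J
      + summability.partial_sum (conv_term pi f h2 z) J).
  apply/funext => J; rewrite /summability.partial_sum scaler_sumr -big_split.
  apply: eq_bigr => u _; rewrite /conv_term /=; case: ifP => _; last by rewrite scaler0 addr0.
  by rewrite -[RHS]/(c * (_ * _) + _) [c * (_ * _)]mulrCA -mulrDr.
by have := cvgD (cvgZl_tmp (k := c) (c1 z z0)) (c2 z z0); apply.
Qed.

(** The value at z is additive, both on formal combinations and on functions of the
    level, so both sides are the same string of the values of the psi_i. *)
Lemma evS_Jbas w j z : z != 0 ->
  evS z (Jbas (fun i : int => << i >> : M) w j) = (Jbas (psi v) w j (lev z))%:C.
Proof.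
move=> z0; rewrite raddf_Jbas.
rewrite -[RHS]/((fun c : int -> R^o => (c (lev z))%:C : C) (Jbas (psi v) w j)).
pose ev (c : int -> R^o) : C := (c (lev z))%:C.
have evB : zmod_morphism ev by move=> c d; rewrite -rmorphB.
pose evA : {additive (int -> R^o) -> C} := HB.pack ev (GRing.isZmodMorphism.Build _ _ ev evB).
rewrite -[RHS]/(evA _) raddf_Jbas; congr (Jbas _ w j); apply/funext => i /=.
by rewrite /evS schwartz_ofU /= psiC_lev.
Qed.

Lemma conv_schwartz_of w x :
  is_conv pi (tfun R pi q w) (schwartz_of x) (schwartz_of (Jop C (tbas w) x)).
Proof.
elim/malg_lin_ind: x => [|j|c x y IHx IHy].
- rewrite !linear0 => z z0; have FF := @summability.totally_filter (set 'M[F]_2).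
  have -> : summability.partial_sum (conv_term pi (tfun R pi q w) (0 : S) z) = fun=> 0.
    apply/funext => J; rewrite /summability.partial_sum big1 // => u _.
    by rewrite /conv_term; case: ifP => // _; apply: mulr0.
  exact: cvg_cst.
- rewrite schwartz_ofU Jop_bas Jact_bas => z z0.
  have -> : schwartz_of (Jbas (fun i : int => << i >>) w j) z = (Jbas (psi v) w j (lev z))%:C.
    exact: evS_Jbas.
  exact: (conv_bas pi_unif rs_vge rs_inj rs_ex rs_uniq rs_size vq v1).
- by rewrite !linearP; apply: conv_linear.
Qed.

Definition coords (h : S) : M := xget 0 [set x | schwartz_of x = h].

Lemma coordsK : cancel coords schwartz_of.
Proof. by move=> h; apply: (@xgetPex _ 0 [set x | schwartz_of x = h] (schwartz_of_surj h)). Qed.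

Lemma schwartz_ofK : cancel schwartz_of coords.
Proof. by move=> x; apply: schwartz_of_inj; rewrite coordsK. Qed.

Definition action (a : asymp) (h : S) : S := schwartz_of (Jop C a (coords h)).

Fact action_is_linear a : linear (action a).
Proof.
move=> c h1 h2; rewrite /action.
have -> : coords (c *: h1 + h2) = c *: coords h1 + coords h2.
  by apply: schwartz_of_inj; rewrite linearP !coordsK.
by rewrite !linearP.
Qed.
HB.instance Definition _ a :=
  GRing.isLinear.Build C S S _ (action a) (action_is_linear a).

Lemma asymp_representation : exists rho : asymp -> {linear S -> S},
  [/\ forall a b h, rho (a + b) h = rho a h + rho b h,
      forall a b h, rho (asymp_mul a b) h = rho a (rho b h),
      forall h, rho asymp_one h = h
    & forall w (h : S), is_conv pi (tfun R pi q w) h (rho (tbas w) h)].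
Proof.
exists (fun a => action a); split=> [a b h|a b h|h|w h] /=; rewrite /action.
- by rewrite Jop_D linearD.
- by rewrite schwartz_ofK Jop_mul.
- by rewrite Jop_one coordsK.
- by rewrite -{1}(coordsK h); apply: conv_schwartz_of.
Qed.
End Representation.

Theorem theorem4 (R : realType) (F : nonarchLocalFieldType) (pi : F) (q : nat)
    (pi_unif : uniformizer pi) (q_card : (residue_field pi #= `I_q)%card) :
  (forall (w : weyl) (h : schwartzT R pi), exists k : schwartzT R pi,
     is_conv pi (tfun R pi q w) h k) /\
  exists rho : asymp -> {linear schwartzT R pi -> schwartzT R pi},
    [/\ forall (a b : asymp) (h : schwartzT R pi),
          rho (a + b) h = rho a h + rho b h,
        forall (a b : asymp) (h : schwartzT R pi),
          rho (asymp_mul a b) h = rho a (rho b h),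
        forall h : schwartzT R pi, rho asymp_one h = h
      & forall (w : weyl) (h : schwartzT R pi),
          is_conv pi (tfun R pi q w) h (rho (tbas w) h)].
Proof.
have [rs [rs_vge rs_inj rs_ex [rs_uniq sq]]] := reps_ex pi_unif q_card.
have q2 : (1 < q)%N.
  have o1 : vge 0 (1 : F) by rewrite vgeE ?oner_neq0 // val_one.
  have [a ar a0] := rs_ex _ (vge0 F 0); have [b br b1] := rs_ex _ o1.
  rewrite -sq ltnNge; apply/negP => s1.
  have ab : a = b.
    by case: (rs) s1 ar br => [|c [|//]] //= _; rewrite !inE => /eqP-> /eqP->.
  have := vgeB b1 a0; rewrite sub0r ab opprK subrK vgeE ?oner_neq0 // val_one.
  by [].
have v1 : 1 < Num.sqrt q%:R :> R by rewrite -{1}sqrtr1 ltr_sqrt ?ltr0n ?ltr1n // ltnW.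
have rs_size : (size rs)%:R = (Num.sqrt q%:R : R) ^+ 2 by rewrite sq sqr_sqrtr ?ler0n.
have [rho rhoP] := asymp_representation pi_unif rs_vge rs_inj rs_ex rs_uniq rs_size erefl v1.
split; last by exists rho.
by case: rhoP => _ _ _ rho_conv w h; exists (rho (tbas w) h).
Qed.
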